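(* The following tri-linear version of the $L^3$-Strichartz estimate on $\mathbb{T}^2$ holds without any derivative loss: there is a constant $C>0$ such that $$\bigg|\int_0^1\int_{\mathbb{T}^2}\prod_{j=1}^3\big(e^{it\Delta}\phi_j\big)^*\,dx\,dt\bigg|\le C\prod_{j=1}^3\|\phi_j\|_{L^2(\mathbb{T}^2)}$$ for all $\phi_1,\phi_2,\phi_3\in L^2(\mathbb{T}^2)$, where $u^*$ denotes $u$ or its complex conjugate $\overline u$ (the choice being made independently for each factor $j=1,2,3$).
   Context: $\mathbb{T}^2=(\mathbb{R}/\mathbb{Z})^2$ is the two-dimensional torus, functions are complex-valued, $\Delta$ is the Laplacian on $\mathbb{T}^2$, and $e^{it\Delta}$ is the linear Schrödinger propagator, i.e. $e^{it\Delta}\phi$ is the solution of $i\partial_t u+\Delta u=0$ with $u|_{t=0}=\phi$. *)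

(* Defs.v *)
From HB Require Import structures.
From mathcomp Require Import all_boot all_order all_algebra.
From mathcomp Require Import all_classical all_reals all_analysis.
From mathcomp Require Import complex.

Set Implicit Arguments.
Unset Strict Implicit.
Unset Printing Implicit Defensive.

Import Order.TTheory GRing.Theory Num.Theory.
Import numFieldNormedType.Exports.

Local Open Scope classical_set_scope.
Local Open Scope ring_scope.
Local Open Scope complex_scope.

Section Strichartz.
Context {R : realType}.

Definition cmod (z : R[i]) : R := Normc.normc z.

(* A function on the torus (R/Z)^2 is a function on R * R that is 1-periodic in
   each variable, integrated over the fundamental domain [0, 1]^2. *)
Definition periodic2 (T : Type) (f : R * R -> T) : Prop :=
  forall x, f (x.1 + 1, x.2) = f x /\ f (x.1, x.2 + 1) = f x.

Definition unit_itv : set R := `[0, 1].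
Definition unit_square : set (R * R) := unit_itv `*` unit_itv.
Local Notation mR := (measurableTypeR R).
Local Notation leb1 := (@lebesgue_measure R).
Local Notation leb2 := (leb1 \x leb1)%E.

Definition cmeasurable d (T : measurableType d) (f : T -> R[i]) : Prop :=
  measurable_fun setT (fun x => complex.Re (f x)) /\
  measurable_fun setT (fun x => complex.Im (f x)).

Definition cintegral d (T : measurableType d)
    (mu : {measure set T -> \bar R}) (D : set T) (f : T -> R[i]) : R[i] :=
  (\int[mu]_(x in D) complex.Re (f x)) +i* (\int[mu]_(x in D) complex.Im (f x)).

Definition L2T (f : R * R -> R[i]) : Prop :=
  [/\ periodic2 f, cmeasurable (f : mR * mR -> R[i])
    & (\int[leb2]_(x in unit_square) ((cmod (f x) ^+ 2)%R)%:E < +oo)%E].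

Definition L2norm (f : R * R -> R[i]) : R :=
  Num.sqrt (\int[leb2]_(x in unit_square) (cmod (f x) ^+ 2)).

Definition dx1 (f : R * R -> R) : R * R -> R := fun x => 'D_(1, 0) f x.
Definition dx2 (f : R * R -> R) : R * R -> R := fun x => 'D_(0, 1) f x.

Fixpoint Ck (k : nat) (f : R * R -> R) : Prop :=
  continuous f /\
  (if k is k'.+1 then
     [/\ forall x, derivable f x (1, 0), forall x, derivable f x (0, 1),
         Ck k' (dx1 f) & Ck k' (dx2 f)]
   else True).

Definition test_fun (psi : R * R -> R) : Prop :=
  periodic2 psi /\ forall k, Ck k psi.

Definition laplacian (f : R * R -> R) : R * R -> R :=
  fun x => dx1 (dx1 f) x + dx2 (dx2 f) x.

Definition pairing (f : R * R -> R[i]) (psi : R * R -> R) : R[i] :=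
  cintegral leb2 unit_square (fun x => f x * (psi x)%:C).

Definition is_cderive (f : R -> R[i]) (t : R) (df : R[i]) : Prop :=
  is_derive t 1 (fun s => complex.Re (f s)) (complex.Re df) /\
  is_derive t 1 (fun s => complex.Im (f s)) (complex.Im df).

(* [u t x] is e^(it Delta) phi at x: the solution of i u_t + Delta u = 0 with
   u(0) = phi.  As phi is only in L^2, Delta acts in the sense of distributions
   on the torus.  (Real test functions suffice, by linearity.)  Joint
   measurability picks a representative for which the space-time integrals make
   sense. *)
Definition schrodinger_solution (phi : R * R -> R[i])
    (u : R -> R * R -> R[i]) : Prop :=
  [/\ cmeasurable (fun z : mR * (mR * mR) => u z.1 z.2),
      forall t, L2T (u t),
      {ae leb2, forall x, u 0 x = phi x}
    & forall psi, test_fun psi -> forall t, exists2 v : R[i],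
        is_cderive (fun s => pairing (u s) psi) t v
        & 'i%C * v + pairing (u t) (laplacian psi) = 0].

Definition L3_spacetime (u : R -> R * R -> R[i]) : Prop :=
  (\int[leb1]_(t in unit_itv)
     \int[leb2]_(x in unit_square) ((cmod (u t x) ^+ 3)%R)%:E < +oo)%E.

Definition star (b : bool) (z : R[i]) : R[i] := if b then z^* else z.

Definition spacetime_integral (s : 'I_3 -> bool)
    (u : 'I_3 -> R -> R * R -> R[i]) : R[i] :=
  cintegral leb1 unit_itv (fun t =>
    cintegral leb2 unit_square (fun x => \prod_(j < 3) star (s j) (u j t x))).

(* L^2 approximations of phi by data whose evolutions are in L^3 of
   [0, 1] x torus, so that products of three of them are integrable by
   Hoelder's inequality. *)
Definition approximation (phi : 'I_3 -> R * R -> R[i])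
    (phin : nat -> 'I_3 -> R * R -> R[i])
    (un : nat -> 'I_3 -> R -> R * R -> R[i]) : Prop :=
  (forall n j, [/\ L2T (phin n j), schrodinger_solution (phin n j) (un n j)
                 & L3_spacetime (un n j)]) /\
  (forall j, (fun n => L2norm (fun x => phin n j x - phi j x)) @ \oo --> 0).

(* I is the value of the integral over [0, 1] x torus of the product of the
   (e^(it Delta) phi_j)^*.  For arbitrary phi_j in L^2 the evolutions are not
   known to be in L^3 and the product need not be absolutely integrable; as
   usual, the integral is the extension by L^2-continuity from data for which it
   converges absolutely.  The lemmas below show that I is unique, and that it is
   the Lebesgue integral when the evolutions are in L^3. *)
Definition is_trilinear_integral (s : 'I_3 -> bool)
    (phi : 'I_3 -> R * R -> R[i]) (I : R[i]) : Prop :=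
  (exists phin un, approximation phi phin un) /\
  (forall phin un, approximation phi phin un ->
     (fun n => cmod (spacetime_integral s (un n) - I)) @ \oo --> 0).

Lemma is_trilinear_integral_unique s phi I J :
  is_trilinear_integral s phi I -> is_trilinear_integral s phi J -> I = J.
Proof.
move=> [[phin [un happ]] /(_ _ _ happ) hI] [_ /(_ _ _ happ) hJ].
apply/eqP; rewrite -subr_eq0; apply/eqP/Normc.eq0_normc.
apply/eqP; rewrite eq_le; apply/andP; split; last first.
  by case: (I - J) => a b; exact: sqrtr_ge0.
have hIJ : (fun n => cmod (spacetime_integral s (un n) - I) +
                     cmod (spacetime_integral s (un n) - J)) @ \oo --> (0 : R).
  by have := cvgD hI hJ; rewrite addr0; apply.
rewrite -(cvg_lim (@Rhausdorff R) hIJ); apply: limr_ge.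
  by apply/cvg_ex; exists 0; exact: hIJ.
apply: nearW => n; rewrite /= /cmod.
set z := spacetime_integral s (un n).
have -> : I - J = - (z - I) + (z - J) by rewrite opprB addrA subrK.
by rewrite -[in leRHS]normcN; apply: le_normcD.
Qed.

Lemma is_trilinear_integralE s phi u I :
  (forall j, [/\ L2T (phi j), schrodinger_solution (phi j) (u j)
               & L3_spacetime (u j)]) ->
  is_trilinear_integral s phi I -> I = spacetime_integral s u.
Proof.
move=> hu [_ hI].
have happ : approximation phi (fun=> phi) (fun=> u).
  split=> // j; rewrite (_ : (fun _ => _) = cst 0); first exact: cvg_cst.
  apply/funext => n /=; rewrite /L2norm /Rintegral.
  rewrite (_ : integral _ _ _ = 0%E) /= ?sqrtr0 //.
  apply: integral0_eq => x _; rewrite subrr /cmod.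
  by rewrite Normc.normc0 expr0n.
have := hI _ _ happ => /(cvg_lim (@Rhausdorff R)).
rewrite lim_cst; last exact: Rhausdorff.
by move=> /Normc.eq0_normc/eqP; rewrite subr_eq0 => /eqP.
Qed.

End Strichartz.

(* Main.v *)
(** Evolutions of the characters [chr k] are the modes [cis (eigen k * t) * chr k x].
    The space integral of a product of three modes (or conjugates) vanishes unless
    [+-k1 +- k2 +- k3 = 0], and then the integral over [0 <= t <= 1] is at most
    [1 / (1 + `|q|)], where [q] is the signed sum of the [|kj|^2]; as [0, 1] is not
    a period of the flow, the terms with [q != 0] do contribute.  When the signs
    are not all equal, [q] is up to sign twice the scalar product of two of the
    frequencies, and the sum of [a(x) b(y) c(x + y) / (1 + |x.y|)] has to be
    bounded by l2 norms.  Cauchy-Schwarz over the dyadic blocks [|x.y| ~ 2^j]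
    reduces this to counting the points [x] of a block on the circle of diameter
    [0, z]: [x.y] is, up to an affine change, the abscissa of a lattice point of
    another circle.  Modulo a prime [l = 3 mod 4], where -1 is not a square, such
    abscissae occupy only about half of the classes, so sieving by many primes
    leaves at most [C 2^j / (j + 1)^4] of them, and the sum over [j] converges.

    The estimate for trigonometric polynomials extends by means of averages [proj n]
    against a positive kernel: they act on Fourier coefficients, hence commute with
    the evolution, and they converge in every L^p, so that [proj n (u t)] tends to
    [u] in L^3 of space-time by dominated convergence.  The form being trilinear,
    the bound for evolutions in L^3 makes the integrals converge along every
    L^2-approximation, to a limit that does not depend on it. *)

From HB Require Import structures.
Require Import Defs.
From mathcomp Require Import all_boot all_order all_algebra.
From mathcomp Require Import all_classical all_reals all_analysis.
From mathcomp Require Import measurable_realfun complex.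
From mathcomp Require Import ring lra zify finfield.

Set Implicit Arguments.
Unset Strict Implicit.
Unset Printing Implicit Defensive.

Import Order.TTheory GRing.Theory Num.Theory.
Import numFieldNormedType.Exports.
Local Open Scope ring_scope.

(** * Lattice points on circles *)

(** The obstacle is the sum over the scales [j]: with only the trivial [O(2^j)] points in a block,
    every scale would contribute equally. The Cauchy-Schwarz weight is [(j+1)^2 / 2^j], so that the
    sum of the kernels costs [(j+1)^-2] at scale [j]; the other factor has the same decay once a
    block holds [O(2^j / (j+1)^4)] points, which fixes the exponent 4. The circle appears on
    squaring: [x.y = x.y'] and [z = x + y'] give [x.(z - y) = x.x]. The moduli of the sieve must
    have product at most [2^j], but about [j^(1/3)] of them already give a gain [(3/4)^n] that beats
    every power of [j]; hence very large primes are affordable, and they are found as factors of the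
    numbers [i (n+4)! - 1]. On the analytic side, a nonnegative kernel whose two marginals are 1
    contracts every L^p norm by Jensen's inequality, which reduces convergence in L^p to indicators
    of rectangles, where the kernel is seen to concentrate. Hoelder's inequality for three factors
    enters in the form [a b c <= d^-2 a^3 + d (b^3 + c^3)], in which [d] makes one small factor win
    over two bounded ones. *)

Lemma sqr_add_eq0_card3 (F : finFieldType) (y z : F) :
  (#|F| %% 4 = 3)%N -> 2%:R != 0 :> F -> y ^+ 2 + z ^+ 2 = 0 -> y = 0.
Proof.
move=> cF two yz; apply/eqP/negPn/negP => y0.
pose w := z / y.
have w2 : w ^+ 2 = -1.
  rewrite /w expr_div_n; move/eqP: yz; rewrite addrC addr_eq0 => /eqP ->.
  by rewrite mulNr divff// sqrf_eq0.
have w0 : w != 0 by rewrite -sqrf_eq0 w2 oppr_eq0 oner_eq0.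
(* Every element is fixed by the power [#|F|], which is twice an odd number plus 1; since
   [w ^+ 2 = -1], that power of [w] is [- w], so [2 w = 0]. *)
have := expf_card w.
rewrite (divn_eq #|F| 4) cF.
rewrite (_ : (_ * 4 + 3 = 2 * ((#|F| %/ 4).*2.+1) + 1)%N); last by lia.
rewrite exprD expr1 exprM w2 -signr_odd /= odd_double /= expr1 mulN1r => /eqP.
rewrite eq_sym -subr_eq0 opprK -mulr2n -mulr_natr mulf_eq0 (negbTE w0) /=.
by rewrite (negbTE two).
Qed.

Lemma size_fiber_le (S T : eqType) (f : S -> T) (t : seq S) (rs : seq T) B :
  (forall k, k \in t -> f k \in rs) ->
  (forall r, r \in rs -> size [seq k <- t | f k == r] <= B)%N ->
  (size t <= size rs * B)%N.
Proof.
elim: rs t => [|r rs IH] t trs hB /=.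
  by case: t trs {hB} => // k t /(_ k); rewrite inE eqxx => /(_ isT).
rewrite -(count_predC (fun k => f k == r)) mulSn; apply: leq_add.
  by rewrite -size_filter; apply: hB; rewrite inE eqxx.
rewrite -size_filter; apply: IH => [k|s srs].
  by rewrite mem_filter => /andP[/= kr /trs]; rewrite inE (negbTE kr).
apply: leq_trans (hB s _); last by rewrite inE srs orbT.
rewrite !size_filter count_filter; apply: sub_count => k /= /andP[] -> //.
Qed.

(* When -1 is not a square, R - x^2 and x^2 - R are both squares only if they
   vanish, and x^2 - R is a square for x = (u + R / u) / 2. *)
Lemma card_circle_abscissa (F : finFieldType) (R : F) :
  (#|F| %% 4 = 3)%N -> 2%:R != 0 :> F ->
  (2 * #|[set x : F | [exists y : F, x ^+ 2 + y ^+ 2 == R]%R]| <= #|F| + 3)%N.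
Proof.
move=> cF two; set G := [set x | _].
pose f (u : F) := (u + R / u) / 2%:R.
pose U := [set u : F | (u != 0) && (u ^+ 2 != R)].
have fib (u v : F) : u != 0 -> v != 0 -> f u = f v -> v = u \/ v = R / u.
  move=> u0 v0 /(congr1 ( *%R^~ 2%:R)); rewrite /f !divfK// => uv.
  have /eqP : (u - v) * (u * v - R) = 0.
    have -> : (u - v) * (u * v - R) = u * v * ((u + R / u) - (v + R / v)).
      by field; rewrite u0 v0.
    by rewrite uv subrr mulr0.
  rewrite mulf_eq0 !subr_eq0 => /orP[/eqP->|/eqP uvR]; [by left|right].
  by rewrite -uvR; field.
(* The values outside [U] are 0 and at most two square roots of [R]; this is the 3 of the
   statement. *)
have U3 : (#|F| <= #|U| + 3)%N.
  rewrite -(cardsC U) leq_add2l.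
  have sq2 : (#|[set u : F | (u ^+ 2 == R)%R]| <= 2)%N.
    have [->|/set0Pn[u0]] := eqVneq [set u : F | (u ^+ 2 == R)%R] finset.set0.
      by rewrite cards0.
    rewrite inE => /eqP uR; apply: (@leq_trans #|[set u0; - u0]|).
      apply/subset_leq_card/fintype.subsetP => u; rewrite !inE -uR eqf_sqr.
      by [].
    by rewrite cards2; case: (_ != _).
  apply: (@leq_trans #|[set (0 : F)] :|: [set u : F | (u ^+ 2 == R)%R]|).
    apply/subset_leq_card/fintype.subsetP => u.
    by rewrite !inE negb_and !negbK.
  by apply: leq_trans (leq_card_setU _ _) _; rewrite cards1 ltnS.
have fU : (#|U| <= 2 * #|f @: U|)%N.
  rewrite [#|U|]cardE [#|f @: U|]cardE mulnC.
  apply: (@size_fiber_le _ _ f) => [u|x].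
    by rewrite !mem_enum => uU; apply: imset_f.
  rewrite mem_enum => /imsetP[u]; rewrite inE => /andP[u0 _] ->.
  apply: (@leq_trans (size [:: u; R / u])) => //.
  apply: uniq_leq_size; first by rewrite filter_uniq// enum_uniq.
  move=> v; rewrite mem_filter mem_enum inE => /and3P[/eqP vu v0 _].
  by rewrite !inE; case: (fib _ _ u0 v0 (esym vu)) => ->; rewrite eqxx ?orbT.
have dis : [disjoint G & f @: U].
  rewrite -setI_eq0; apply/eqP/setP => x; rewrite !inE; apply/negbTE/negP.
  move=> /andP[/existsP[y /eqP xy] /imsetP[u]].
  rewrite inE => /andP[u0 uR] xE.
  (* At [x = f u] one has [x ^+ 2 - R = z ^+ 2]. If [R - x ^+ 2] is also a square, then [z = 0],
     that is [u ^+ 2 = R], which [U] excludes. *)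
  pose z := (u - R / u) / 2%:R.
  have : z ^+ 2 + y ^+ 2 = 0.
    rewrite -[LHS]addr0 -(subrr R) -{2}xy xE /z /f.
    by field; rewrite two u0.
  move/(sqr_add_eq0_card3 cF two)/eqP; rewrite /z mulf_eq0 invr_eq0.
  rewrite (negbTE two) orbF subr_eq0 => /eqP uE; case/eqP: uR.
  by rewrite expr2 {1}uE divfK.
have : (#|G| + #|f @: U| <= #|F|)%N.
  by move: dis; rewrite -leq_card_setU => /eqP <-; apply: max_card.
move: U3 fU; lia.
Qed.

(** The prime factors of [m] are odd. Dividing by one that is 1 mod 4 leaves a smaller number that
    is still 3 mod 4, so the induction has to meet a factor that is 3 mod 4. *)
Lemma prime_factor_3mod4 m : (m %% 4 = 3)%N -> exists2 l, prime l & (l %| m)%N && (l %% 4 == 3)%N.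
Proof.
elim/ltn_ind: m => m IH m3.
have m1 : (1 < m)%N by case: m m3 {IH} => [|[]].
have pp := pdiv_prime m1; have pd := pdiv_dvd m.
have [p3|p3] := eqVneq (pdiv m %% 4)%N 3%N.
  by exists (pdiv m) => //; rewrite pd p3 eqxx.
have mE := divnK pd.
have p1 : (pdiv m %% 4 = 1)%N.
  have : ((pdiv m %% 4) * (m %/ pdiv m %% 4) = 3 %[mod 4])%N by rewrite modnMm mulnC mE m3.
  move: p3; have := ltn_pmod (pdiv m) (isT : 0 < 4)%N.
  have := ltn_pmod (m %/ pdiv m) (isT : 0 < 4)%N.
  by case: (pdiv m %% 4)%N => [|[|[|[|]]]] //; case: (m %/ pdiv m %% 4)%N => [|[|[|[|]]]].
have [||l pl /andP[lm l3]] := IH (m %/ pdiv m)%N.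
- by rewrite ltn_Pdiv ?prime_gt1// ltnW.
- by move: m3; rewrite -{1}mE -modnMmr p1 muln1.
by exists l => //; rewrite l3 andbT (dvdn_trans lm)// -[X in (_ %| X)%N]mE dvdn_mulr.
Qed.

Lemma subn_pred2 a b : (0 < a)%N -> (b - a = (b - 1) - (a - 1))%N.
Proof. lia. Qed.

(** Euclid's argument with control of size: [L i] is a prime factor, 3 mod 4, of [i N - 1] with
    [N = (n + 4)!], a multiple of 4. It exceeds [n + 4], for otherwise it would divide both [N] and
    [i N - 1]; being 3 mod 4 it is then at least 7. A common value at [i < j <= n] would divide
    [(j - i) N], but it is larger than [j - i] and prime to [N]. *)
Lemma exists_primes_3mod4 n : exists ls : seq nat,
  [/\ uniq ls, size ls = n,
      forall l : nat, l \in ls -> [/\ prime l, l %% 4 = 3 & 7 <= l]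
    & (\prod_(l <- ls) l <= 2 ^ ((n + 5) ^ 3))%N]%N.
Proof.
pose N := ((n + 4)`!)%N.
have N4 : (4 %| N)%N by apply: dvdn_fact; lia.
have N0 : (0 < N)%N := fact_gt0 _.
have hN : (4 <= N)%N by apply: dvdn_leq.
have hM i : exists l, (0 < i)%N -> [/\ prime l, l %| i * N - 1, l %% 4 = 3 & l <= i * N]%N.
  have [i0|//] := ltnP 0 i; last by exists 0%N.
  have iN : (N <= i * N)%N by rewrite leq_pmull.
  have [|l pl /andP[lM /eqP l3]] := @prime_factor_3mod4 (i * N - 1)%N.
    have /dvdnP[q qE] : (4 %| i * N)%N by rewrite dvdn_mull.
    by move: iN; rewrite qE; lia.
  exists l; split => //; apply: leq_trans (dvdn_leq _ lM) _; lia.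
have [L LP] := choice hM.
have LN i : (0 < i)%N -> (n + 4 < L i)%N.
  move=> i0; have [pl lM _ _] := LP i i0; rewrite ltnNge; apply/negP => le.
  have lN : (L i %| N)%N by apply: dvdn_fact; rewrite prime_gt0.
  have : (L i %| 1)%N.
    have iN : (0 < i * N)%N by rewrite muln_gt0 i0.
    by rewrite -(@dvdn_addr (i * N - 1)%N)// subnK// dvdn_mull.
  by rewrite dvdn1 => /eqP l1; move: pl; rewrite l1.
exists [seq L i | i <- iota 1 n]; split.
- rewrite map_inj_in_uniq ?iota_uniq// => i j.
  rewrite !mem_iota => /andP[i0 ih] /andP[j0 jh] Lij.
  wlog ij : i j i0 ih j0 jh Lij / (i < j)%N.
    move=> H; have [ij|ji|//] := ltngtP i j; first exact: H.
    by apply/esym/H.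
  have [pl lM _ _] := LP _ i0; have [_ lM' _ _] := LP _ j0.
  have : (L i %| (j - i) * N)%N.
    have -> : ((j - i) * N = (j * N - 1) - (i * N - 1))%N.
      have : (0 < i * N)%N by rewrite muln_gt0 i0.
      by move=> iN; rewrite mulnBl subn_pred2.
    by rewrite dvdn_sub// Lij.
  rewrite Euclid_dvdM// => /orP[/dvdn_leq|lN].
    by move=> /(_ ltac:(lia)); have := LN _ i0; lia.
  have : (L i %| 1)%N.
    have iN : (0 < i * N)%N by rewrite muln_gt0 i0.
    by rewrite -(@dvdn_addr (i * N - 1)%N)// subnK// dvdn_mull.
  by rewrite dvdn1 => /eqP l1; move: pl; rewrite l1.
- by rewrite size_map size_iota.
- move=> l lL; case: (elimT (seq.mapP (f := L)) lL) => i; rewrite mem_iota => /andP[i0 _] ->.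
  have [pl _ l3 _] := LP _ i0; split => //.
  have := LN _ i0; move: l3; lia.
- rewrite big_map.
  (* For [i <= n], [L i <= i (n + 4)! <= (n + 5)!]. The crude bounds [m! <= m ^ m] and [m <= 2 ^ m]
     then produce the exponent [(n + 5)^2 n]. *)
  apply: (@leq_trans (\prod_(i <- iota 1 n) (n + 5)`!)%N).
    rewrite big_seq_cond [leqRHS]big_seq_cond; apply: leq_prod => i.
    rewrite mem_iota => /andP[/andP[i0 ih] _].
    have [_ _ _ le] := LP _ i0; apply: leq_trans le _.
    by rewrite addnS factS leq_mul//; lia.
  rewrite big_const_seq count_predT size_iota iter_muln_1.
  have fact_le m : (m`! <= m ^ m)%N.
    elim: m => // m IH; rewrite factS expnS leq_mul//.
    by apply: leq_trans IH _; case: (m) => // m'; rewrite leq_exp2r.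
  apply: (@leq_trans (((n + 5) ^ (n + 5)) ^ n)%N).
    by case: (n) => // n'; rewrite leq_exp2r.
  rewrite -expnM; apply: (@leq_trans ((2 ^ (n + 5)) ^ ((n + 5) * n))%N).
    have [->|n0] := posnP n; first by rewrite muln0.
    rewrite leq_exp2r ?muln_gt0 ?n0 ?addn_gt0 ?orbT//.
    by rewrite ltnW// ltn_expl.
  by rewrite -expnM leq_exp2l// !expnS expn0 muln1 !leq_mul2l leq_addr !orbT.
Qed.

(** Induction on the moduli. Inside one class mod [l], reduction mod the product [L] of the other
    moduli is injective below [l * L] by the Chinese remainder theorem, so each admissible class mod
    [l] carries at most the product of the remaining counts. *)
Lemma crt_count (ls : seq nat) (G : nat -> nat -> bool) (t : seq nat) :
  uniq ls -> all prime ls -> uniq t ->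
  (forall k, k \in t -> k < \prod_(l <- ls) l)%N ->
  (forall k l, k \in t -> l \in ls -> G l (k %% l)%N) ->
  (size t <= \prod_(l <- ls) count (G l) (iota 0 l))%N.
Proof.
elim: ls t => [|l ls IH] t /=.
  rewrite !big_nil => _ _ ut tlt _.
  apply: (@leq_trans (size [:: 0%N])) => //; apply: uniq_leq_size => // k /tlt.
  by case: k.
move=> /andP[lls uls] /andP[pl pls] ut tlt tG; rewrite !big_cons -size_filter.
apply: (@size_fiber_le _ _ (fun k => k %% l)%N) => [k kt|r].
  by rewrite mem_filter tG ?inE ?eqxx// mem_iota /= ltn_pmod// prime_gt0.
rewrite mem_filter => /andP[Gr]; rewrite mem_iota /= => rl.
set L := (\prod_(l <- ls) l)%N.
have L0 : (0 < L)%N.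
  rewrite /L big_seq; apply: prodn_cond_gt0 => i ils.
  exact: (prime_gt0 (allP pls _ ils)).
have cop : coprime l L.
  rewrite /L prime_coprime// big_seq; elim/big_ind: _ => [|x y hx hy|i ils].
  - by rewrite dvdn1; apply/eqP => l1; move: pl; rewrite l1.
  - by rewrite Euclid_dvdM// negb_or hx.
  - rewrite dvdn_prime2// ?(allP pls)//.
    by apply: contra lls => /eqP ->.
rewrite -(size_map (fun k => k %% L)%N); apply: IH => //.
- rewrite map_inj_in_uniq ?filter_uniq// => x y.
  rewrite !mem_filter => /andP[/eqP xr xt] /andP[/eqP yr yt] xy.
  have : (x = y %[mod l * L])%N.
    by apply/eqP; rewrite chinese_remainder// xr yr xy !eqxx.
  have := tlt _ xt; have := tlt _ yt; rewrite big_cons -/L => hx hy.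
  by rewrite !modn_small.
- by move=> k /seq.mapP[x _ ->]; rewrite ltn_pmod.
- move=> k m /seq.mapP[x]; rewrite mem_filter => /andP[_ xt] -> mls.
  have mL : (m %| L)%N by rewrite /L (big_rem m)//= dvdn_mulr.
  by rewrite modn_dvdm// tG// inE mls orbT.
Qed.

(** The abscissa has the form [2 r - p] because the sieve is applied to [r], the absolute value of
    [x.y], whereas the coordinate on the circle is [2 (x.y) - z.y]. *)
Definition circle_res (p R : int) (l r : nat) : bool :=
  [exists y : 'F_l, ((2 * r%:Z - p)%:~R : 'F_l) ^+ 2 + y ^+ 2 == R%:~R].

Lemma count_circle_res p R l : prime l -> (l %% 4 = 3)%N ->
  (2 * count (circle_res p R l) (iota 0 l) <= l + 3)%N.
Proof.
move=> pl l3.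
have ch := pchar_Fp pl.
have two : 2%:R != 0 :> 'F_l.
  rewrite -(dvdn_pcharf ch) /=; apply/negP => /(dvdn_leq (isT : 0 < 2)%N).
  by case: l l3 {pl ch} => [|[|[|[]]]].
have := @card_circle_abscissa 'F_l R%:~R.
rewrite card_Fp// => /(_ l3 two); apply: leq_trans; rewrite leq_mul2l /=.
set G := [set x | _].
pose f (r : nat) : 'F_l := (2 * r%:Z - p)%:~R.
rewrite -size_filter -(size_map f) cardE; apply: uniq_leq_size.
  rewrite map_inj_in_uniq ?filter_uniq ?iota_uniq// => x y.
  rewrite !mem_filter !mem_iota /= => /andP[_ xl] /andP[_ yl].
  rewrite /f !rmorphB /= => /addIr; rewrite !rmorphM /=.
  move=> /(mulfI two) /(congr1 (@nat_of_ord _)).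
  by rewrite -!pmulrn !val_Fp_nat// !modn_small.
move=> x /seq.mapP[r]; rewrite mem_filter mem_iota /= => /andP[/existsP[y yE] _] ->.
by rewrite mem_enum inE; apply/existsP; exists y.
Qed.

Lemma circle_res_mod p R l (k : nat) : prime l ->
  circle_res p R l (k %% l)%N = circle_res p R l k.
Proof.
move=> pl; rewrite /circle_res.
suff -> : ((2 * (k %% l)%N%:Z - p)%:~R : 'F_l) = (2 * k%:Z - p)%:~R by [].
rewrite !rmorphB !rmorphM /=; congr (_ * _ - _).
by rewrite -!pmulrn; apply/val_inj; rewrite /= !val_Fp_nat// modn_mod.
Qed.

(** The hypothesis on [j] makes the product [L] of the [n] primes at most [2 ^ j]. Hence at most
    [2 * 2 ^ j / L] intervals of length [L] cover the range of [k], and each contains at most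
    [(3/4)^n L] admissible [k]. *)
Lemma circle_sieve (n j : nat) (p R : int) (t : seq nat) :
  ((n + 5) ^ 3 <= j)%N -> uniq t ->
  (forall k : nat, k \in t -> (k < 2 ^ j)%N /\
     exists y : int, (2 * k%:Z - p) ^+ 2 + y ^+ 2 = R) ->
  (4 ^ n * size t <= 2 * 3 ^ n * 2 ^ j)%N.
Proof.
move=> nj ut tP.
have [ls [uls sls lsP Lle]] := exists_primes_3mod4 n.
set L := (\prod_(l <- ls) l)%N in Lle.
have L0 : (0 < L)%N.
  rewrite /L big_seq; apply: prodn_cond_gt0 => i /lsP[pi _ _].
  exact: prime_gt0.
have LX : (L <= 2 ^ j)%N by apply: leq_trans Lle _; rewrite leq_exp2l.
have tres k l : k \in t -> l \in ls -> circle_res p R l k.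
  move=> /tP[_ [y yE]] /lsP[pl _ _]; apply/existsP; exists y%:~R.
  by rewrite -!rmorphXn -rmorphD /= yE.
have h1 : (size t <= (2 ^ j %/ L + 1) * \prod_(l <- ls) count (circle_res p R l) (iota 0 l))%N.
  have := @size_fiber_le _ _ (fun k => k %/ L)%N t (iota 0 (2 ^ j %/ L + 1)).
  rewrite size_iota; apply => [k /tP[kj _]|r _].
    by rewrite mem_iota /= addn1 ltnS leq_div2r// ltnW.
  rewrite -(size_map (fun k => k %% L)%N); apply: crt_count => //.
  - by apply/allP => l /lsP[].
  - rewrite map_inj_in_uniq ?filter_uniq// => x y.
    rewrite !mem_filter => /andP[/eqP xr _] /andP[/eqP yr _] xy.
    by rewrite (divn_eq x L) (divn_eq y L) xr yr xy.
  - by move=> k /seq.mapP[x _ ->]; rewrite ltn_pmod.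
  - move=> k m /seq.mapP[x]; rewrite mem_filter => /andP[_ xt] -> mls.
    have mL : (m %| L)%N by rewrite /L (big_rem m)//= dvdn_mulr.
    have [pm _ _] := lsP _ mls.
    by rewrite modn_dvdm// circle_res_mod// tres.
have h2 : (4 ^ n * \prod_(l <- ls) count (circle_res p R l) (iota 0 l) <= 3 ^ n * L)%N.
  rewrite /L -sls; elim: ls lsP {uls sls Lle L L0 LX tres h1} => [|l ls IH] lsP.
    by rewrite !big_nil.
  have [pl l3 l7] := lsP l (mem_head _ _).
  have {}IH := IH (fun m mls => lsP m (mem_behead (s := l :: ls) mls)).
  have := count_circle_res p R pl l3.
  rewrite !big_cons /= !expnS; set c := count _ _ => hc.
  (* From [2 c <= l + 3] to [4 c <= 3 l]: this is where [7 <= l] enters. *)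
  rewrite mulnACA [leqRHS]mulnACA leq_mul//; lia.
apply: leq_trans (leq_mul (leqnn (4 ^ n)) h1) _.
rewrite mulnCA.
apply: leq_trans (leq_mul (leqnn _) h2) _.
rewrite mulnCA [(2 * _)%N]mulnC -mulnA leq_mul// mulnDl mul1n mul2n -addnn.
by rewrite leq_add// leq_divM.
Qed.

(** * The discrete trilinear inequality *)

(** Induction on [d], splitting [q = r ^+ 2]: one power of [r ^+ n] absorbs a factor [n + 1] by
    Bernoulli's inequality for [r^-1 = 1 + h], the other absorbs the remaining factors by
    induction. *)
Lemma poly_geometric_bounded (R : realType) (d : nat) (q : R) : 0 < q < 1 ->
  exists C : R, forall n, n.+1%:R ^+ d * q ^+ n <= C.
Proof.
elim: d q => [|d IH] q /andP[q0 q1].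
  exists 1 => n; rewrite expr0 mul1r exprn_ile1// ltW//.
pose r := Num.sqrt q.
have r0 : 0 < r by rewrite sqrtr_gt0.
have r2 : r ^+ 2 = q by rewrite sqr_sqrtr// ltW.
have r1 : r < 1 by rewrite -(@ltr_pXn2r _ 2)// ?nnegrE ?(ltW r0)// r2 expr1n.
have [|C hC] := IH r; first by rewrite r0 r1.
pose h := r^-1 - 1.
have h0 : 0 < h by rewrite subr_gt0 invf_gt1.
have B n : n.+1%:R * r ^+ n <= 1 + h^-1.
  have rn : 0 < r ^+ n by rewrite exprn_gt0.
  rewrite -ler_pdivlMr// -exprVn.
  have -> : r^-1 = 1 + h by rewrite /h addrC subrK.
  have : 1 + n%:R * h <= (1 + h) ^+ n.
    elim: n {rn} => [|n IHn]; first by rewrite mul0r addr0 expr0.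
    have := ler_wpM2r (ltW (addr_gt0 ltr01 h0)) IHn.
    rewrite -exprSr; apply: le_trans.
    rewrite -natr1 -subr_ge0.
    have -> : (1 + n%:R * h) * (1 + h) - (1 + (n%:R + 1) * h) = n%:R * h ^+ 2.
      by ring.
    by rewrite mulr_ge0// exprn_ge0// ltW.
  have hi0 : 0 < h^-1 by rewrite invr_gt0.
  move=> /(ler_wpM2l (ltW (addr_gt0 ltr01 hi0))) => H.
  apply: le_trans H; rewrite -subr_ge0 -natr1.
  have -> : (1 + h^-1) * (1 + n%:R * h) - (n%:R + 1) = n%:R * h + h^-1.
    by field; rewrite gt_eqF.
  by apply: addr_ge0; [rewrite mulr_ge0// ltW | exact: ltW].
have C0 : 0 <= C.
  by apply: le_trans (hC 0%N); rewrite mulr_ge0// exprn_ge0// ?ltW.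
exists ((1 + h^-1) * C) => n.
have -> : n.+1%:R ^+ d.+1 * q ^+ n = (n.+1%:R * r ^+ n) * (n.+1%:R ^+ d * r ^+ n).
  by rewrite -r2 -exprM mulnC exprM expr2 exprS; ring.
by apply: ler_pM => //; rewrite mulr_ge0// exprn_ge0// ltW.
Qed.

(** For the largest [n] with [(n + 5)^3 <= j], the gain [(3/4)^n] of the sieve is [O((n + 1)^-12)],
    hence [O((j + 1)^-4)]: the exponent 12 is 3 times 4. The field [K] only serves to compare the
    exponential with the power. *)
Lemma circle_count (K : realType) : exists C : nat, forall (j : nat) (p R : int) (t : seq nat),
  uniq t ->
  (forall k : nat, k \in t -> (k < 2 ^ j)%N /\
     exists y : int, (2 * k%:Z - p) ^+ 2 + y ^+ 2 = R) ->
  (size t <= (C * 2 ^ j) %/ j.+1 ^ 4)%N.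
Proof.
have [|C hC] := @poly_geometric_bounded K 12 (3%:R / 4%:R) _.
  by apply/andP; split; lra.
have C0 : 0 <= C.
  by apply: le_trans (hC 0%N); rewrite mulr_ge0// exprn_ge0//; lra.
have [N CN] : exists N : nat, C <= N%:R.
  by exists (Num.bound C); rewrite ltW// archi_boundP.
exists (2 * 6 ^ 12 * N + 126 ^ 4)%N => j p R t ut tP.
rewrite leq_divRL ?expn_gt0//.
(* Below [125 = 5 ^ 3] no [n] qualifies; the trivial count [2 ^ j] is covered by the term [126 ^ 4]
   of the constant. *)
have [j125|j125] := ltnP j 125.
  have st : (size t <= 2 ^ j)%N.
    rewrite -(size_iota 0 (2 ^ j)); apply: uniq_leq_size => // k /tP[kj _].
    by rewrite mem_iota.
  apply: (@leq_trans (2 ^ j * 126 ^ 4)%N); last by rewrite mulnC leq_mul2r leq_addl orbT.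
  by rewrite leq_mul// leq_exp2r//; lia.
have [n [nj jn]] : exists n, ((n + 5) ^ 3 <= j)%N /\ (j < (n + 6) ^ 3)%N.
  pose P n := ((n + 5) ^ 3 <= j)%N.
  have Pb n : P n -> (n <= j)%N.
    rewrite /P => h; apply: leq_trans h; rewrite (leq_trans (leq_addr 5 n))//.
    by rewrite -{1}[(n + 5)%N]expn1 leq_exp2l//; lia.
  have P0 : exists n, P n by exists 0%N.
  case: (ex_maxnP P0 Pb) => n Pn nmax; exists n; split => //.
  rewrite ltnNge; apply/negP => h; have := nmax n.+1.
  by rewrite /P (_ : (n.+1 + 5 = n + 6)%N) ?addSnnS// => /(_ h); rewrite ltnn.
have H1 := circle_sieve nj ut tP.
have H2 : (n.+1 ^ 12 * 3 ^ n <= N * 4 ^ n)%N.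
  rewrite -(@ler_nat K) (natrM _ N) natrX natrM !natrX -ler_pdivrMr ?exprn_gt0//.
  apply: le_trans CN; apply: le_trans (hC n).
  by rewrite -mulrA -expr_div_n.
(* By [j + 1 <= (n + 6)^3] and [n + 6 <= 6 (n + 1)]. *)
have H3 : (j.+1 ^ 4 <= 6 ^ 12 * n.+1 ^ 12)%N.
  apply: (@leq_trans (((n + 6) ^ 3) ^ 4)%N); first by rewrite leq_exp2r.
  rewrite -expnM -expnMn leq_exp2r//; lia.
have p4 : (0 < 4 ^ n)%N by rewrite expn_gt0.
rewrite -(leq_pmul2l p4) mulnA.
apply: leq_trans (leq_mul H1 H3) _.
rewrite mulnDl mulnDr.
apply: (@leq_trans (4 ^ n * (2 * 6 ^ 12 * N * 2 ^ j))%N); last exact: leq_addr.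
have -> : (2 * 3 ^ n * 2 ^ j * (6 ^ 12 * n.+1 ^ 12) = (n.+1 ^ 12 * 3 ^ n) * (2 * 6 ^ 12 * 2 ^ j))%N.
  by move: (6 ^ 12)%N (n.+1 ^ 12)%N => u v; ring.
have -> : (4 ^ n * (2 * 6 ^ 12 * N * 2 ^ j) = (N * 4 ^ n) * (2 * 6 ^ 12 * 2 ^ j))%N.
  by move: (6 ^ 12)%N => u; ring.
by rewrite leq_mul2r H2 orbT.
Qed.

Section finite_sums.
Context {R : realType}.

(** Lagrange's identity: the difference of the two sides is half the double sum of the squares of
    [f i * g j - f j * g i]. *)
Lemma sum_cauchy_schwarz (I : Type) (s : seq I) (P : pred I) (f g : I -> R) :
  (\sum_(i <- s | P i) f i * g i) ^+ 2 <=
  (\sum_(i <- s | P i) f i ^+ 2) * (\sum_(i <- s | P i) g i ^+ 2).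
Proof.
rewrite -subr_ge0.
have : 0 <= \sum_(i <- s | P i) \sum_(j <- s | P j) (f i * g j - f j * g i) ^+ 2.
  by apply: sumr_ge0 => i _; apply: sumr_ge0 => j _; rewrite sqr_ge0.
suff -> : \sum_(i <- s | P i) \sum_(j <- s | P j) (f i * g j - f j * g i) ^+ 2 =
   2 * ((\sum_(i <- s | P i) f i ^+ 2) * (\sum_(i <- s | P i) g i ^+ 2) -
   (\sum_(i <- s | P i) f i * g i) ^+ 2) by rewrite pmulr_rge0.
have e : \sum_(i <- s | P i) \sum_(j <- s | P j) (f i * g j - f j * g i) ^+ 2 =
  \sum_(i <- s | P i) \sum_(j <- s | P j) (f i ^+ 2 * g j ^+ 2) +
  \sum_(i <- s | P i) \sum_(j <- s | P j) (g i ^+ 2 * f j ^+ 2) -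
  2 * \sum_(i <- s | P i) \sum_(j <- s | P j) ((f i * g i) * (f j * g j)).
  rewrite mulr_sumr -big_split -sumrB /=; apply: eq_bigr => i _.
  rewrite mulr_sumr -big_split -sumrB /=; apply: eq_bigr => j _.
  by ring.
by rewrite e -!big_distrlr /=; ring.
Qed.

Lemma sum_group (I J : eqType) (s : seq I) (h : I -> J) (F : I -> R) :
  \sum_(x <- s) F x = \sum_(u <- undup (map h s)) \sum_(x <- s | h x == u) F x.
Proof.
rewrite (exchange_big_dep xpredT)//= big_seq [RHS]big_seq.
apply: eq_bigr => x xs.
rewrite -big_filter (_ : [seq _ <- _ | _] = [:: h x]) ?big_seq1//.
have hu : h x \in undup (map h s) by rewrite mem_undup map_f.
by rewrite -(filter_pred1_uniq (undup_uniq _) hu); apply: eq_filter => u; rewrite /= eq_sym.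
Qed.

Lemma sum_block (I : eqType) (s : seq I) (h : I -> nat) (w B : nat -> R) (J : nat) :
  (forall j, 0 <= w j) -> (forall x, x \in s -> (h x < J)%N) ->
  (forall j, (size [seq x <- s | h x == j])%:R <= B j) ->
  \sum_(x <- s) w (h x) <= \sum_(j < J) w j * B j.
Proof.
move=> w0 hJ sB.
have -> : \sum_(x <- s) w (h x) = \sum_(j < J) \sum_(x <- s | h x == j) w (h x).
  rewrite (exchange_big_dep xpredT)//= big_seq [RHS]big_seq; apply: eq_bigr => x xs.
  by rewrite (big_pred1 (Ordinal (hJ x xs)))// => j; rewrite -val_eqE eq_sym.
apply: ler_sum => j _.
rewrite (eq_bigr (fun=> w j)); last by move=> x /eqP ->.
rewrite big_const_seq iter_addr_0 -mulr_natr -size_filter.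
by rewrite ler_wpM2l.
Qed.

Lemma sum_inv_sqr (J : nat) : \sum_(j < J) (j.+1%:R ^+ 2)^-1 <= 2 :> R.
Proof.
(* The bound is strengthened so that it telescopes. *)
suff : \sum_(j < J) (j.+1%:R ^+ 2)^-1 <= 2 * (1 - (J.+1%:R)^-1) :> R.
  by move=> h; apply: le_trans h _; rewrite ler_piMr// gerBl invr_ge0.
elim: J => [|J IH]; first by rewrite big_ord0 invr1 subrr mulr0.
rewrite big_ord_recr /=; apply: le_trans (lerD IH (lexx _)) _.
set x : R := J.+1%:R.
have x1 : 1 <= x by rewrite ler1n.
have x0 : 0 < x by rewrite (lt_le_trans ltr01).
have -> : J.+2%:R = x + 1 :> R by rewrite natr1.
have x10 : 0 < x + 1 by rewrite addr_gt0.
rewrite -subr_ge0.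
have -> : 2 * (1 - (x + 1)^-1) - (2 * (1 - x^-1) + (x ^+ 2)^-1) = (x - 1) / (x ^+ 2 * (x + 1)).
  by field; rewrite !gt_eqF.
by rewrite divr_ge0 ?subr_ge0// mulr_ge0 ?exprn_ge0// ltW.
Qed.

(** As [trunc_log 2 0] is 0, the integer 0 shares the block of 1 and -1; this is why [dyad_le] has
    [+ 1]. *)
Definition dyad (k : int) : nat := trunc_log 2 `|k|%N.

Lemma dyad_lt k : (`|k| < 2 ^ (dyad k).+1)%N.
Proof.
rewrite /dyad; case: (posnP `|k|%N) => [->|k0]; first by rewrite expn_gt0.
by rewrite trunc_log_ltn.
Qed.

Lemma dyad_le k : (2 ^ dyad k <= `|k| + 1)%N.
Proof.
rewrite /dyad; case: (posnP `|k|%N) => [->|k0]; first by rewrite trunc_log0.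
by rewrite (leq_trans (trunc_logP _ k0))// leq_addr.
Qed.

Lemma size_dyad_block (ks : seq int) j : uniq ks ->
  (size [seq k <- ks | dyad k == j] <= 4 * 2 ^ j)%N.
Proof.
move=> uks; rewrite (_ : 4 * 2 ^ j = 2 * (2 ^ j.+1))%N; last by rewrite expnS mulnA.
apply: (@size_fiber_le _ _ (fun k : int => 0 <= k) _ [:: true; false]) => [k _|b _].
  by case: (0 <= k).
rewrite -filter_predI -(size_map absz) -[leqRHS](size_iota 0).
apply: uniq_leq_size.
  rewrite map_inj_in_uniq ?filter_uniq// => x y.
  rewrite !mem_filter /= => /andP[/andP[/eqP xb _] _] /andP[/andP[/eqP yb _] _].
  by move: xb yb; lia.
move=> _ /mapP[k + ->]; rewrite mem_filter /= => /andP[/andP[_ /eqP <-] _].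
by rewrite mem_iota /= dyad_lt.
Qed.

Lemma seq_ltn_bound (I : eqType) (s : seq I) (h : I -> nat) :
  exists J, forall x, x \in s -> (h x < J)%N.
Proof.
elim: s => [|x s [J hJ]]; first by exists 0%N.
exists (maxn J (h x).+1) => y; rewrite inE => /orP[/eqP ->|/hJ yJ].
  by rewrite leq_max leqnn orbT.
by rewrite leq_max yJ.
Qed.

Lemma sum_dyad_block (I : eqType) (s : seq I) (h : I -> nat) (w : nat -> R) (C : R) :
  0 <= C -> (forall j, 0 <= w j) ->
  (forall j, w j * (size [seq x <- s | h x == j])%:R <= C / j.+1%:R ^+ 2) ->
  \sum_(x <- s) w (h x) <= C * 2.
Proof.
move=> C0 w0 hB; have [J hJ] := seq_ltn_bound s h.
apply: (le_trans (sum_block (B := fun j => (size [seq x <- s | h x == j])%:R) w0 hJ _)) => //.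
apply: (le_trans (ler_sum _ (fun (i : 'I_J) _ => hB i))).
by rewrite -mulr_sumr ler_wpM2l// sum_inv_sqr.
Qed.

(** A compromise between two sums over blocks: [ker ^+ 2 / wgt] over the [4 * 2 ^ j] integers of a
    block, and [wgt] over the [O(2 ^ j / (j + 1)^4)] circle points of a block, are both
    [O((j + 1)^-2)]. *)
Definition wgt (j : nat) : R := j.+1%:R ^+ 2 / 2 ^+ j.

Lemma wgt_gt0 j : 0 < wgt j.
Proof. by rewrite divr_gt0// exprn_gt0. Qed.

(** Bounds the integral over [0 <= t <= 1] of the exponential of [-4 i pi^2 k t]; see
    [cis_time_integral]. *)
Definition ker (k : int) : R := (1 + `|k|%:~R)^-1.

Lemma ker_gt0 k : 0 < ker k.
Proof. by rewrite invr_gt0 ltr_wpDr// ler0z. Qed.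

Lemma ker_le k : ker k <= (2 ^+ dyad k)^-1.
Proof.
rewrite lef_pV2 ?posrE ?exprn_gt0 ?ltr_wpDr ?ler0z// addrC.
by have := dyad_le k; rewrite -(ler_nat R) natrX natrD -abszE -pmulrn.
Qed.

Lemma sum_ker_wgt (ks : seq int) : uniq ks ->
  \sum_(k <- ks) ker k ^+ 2 / wgt (dyad k) <= 8.
Proof.
move=> uks.
apply: (@le_trans _ _ (\sum_(k <- ks) (fun j => ((2 ^+ j)^-1) ^+ 2 / wgt j) (dyad k))).
  apply: ler_sum => k _; rewrite ler_pM2r ?invr_gt0 ?wgt_gt0//.
  by rewrite lerXn2r ?nnegrE ?ker_le// ?ltW ?ker_gt0// invr_gt0 exprn_gt0.
rewrite [leRHS](_ : _ = 4 * 2); last by lra.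
apply: (@sum_dyad_block _ ks dyad (fun j => ((2 ^+ j)^-1) ^+ 2 / wgt j)) => // [j|j].
  by rewrite divr_ge0 ?sqr_ge0// ltW// wgt_gt0.
have := size_dyad_block j uks; rewrite -(ler_nat R) natrM natrX => h.
have p2 : 0 < 2 ^+ j :> R by rewrite exprn_gt0.
apply: (@le_trans _ _ ((2 ^+ j)^-1 ^+ 2 / wgt j * (4 * 2 ^+ j))).
  by rewrite ler_wpM2l// divr_ge0 ?sqr_ge0// ltW// wgt_gt0.
rewrite /wgt le_eqVlt; apply/orP; left; apply/eqP; field.
by rewrite !gt_eqF ?ltr0n.
Qed.

Definition dot (x y : int * int) : int := x.1 * y.1 + x.2 * y.2.

Definition cross (x y : int * int) : int := x.1 * y.2 - x.2 * y.1.

(** Up to the factor [|y|], the two products are the coordinates of [x] along [y] and along its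
    quarter turn. *)
Lemma dot_cross_inj (x x' y : int * int) : y != 0 ->
  dot x y = dot x' y -> cross x y = cross x' y -> x = x'.
Proof.
case: x x' y => [x1 x2] [u1 u2] [y1 y2] y0; rewrite /dot /cross /= => h1 h2.
have yy : y1 ^+ 2 + y2 ^+ 2 != 0.
  apply: contra y0; rewrite paddr_eq0 ?sqr_ge0// !sqrf_eq0 => /andP[/eqP -> /eqP ->].
  by [].
have e1 : (y1 ^+ 2 + y2 ^+ 2) * (x1 - u1) = 0.
  transitivity (y1 * ((x1 * y1 + x2 * y2) - (u1 * y1 + u2 * y2)) +
     y2 * ((x1 * y2 - x2 * y1) - (u1 * y2 - u2 * y1))); first by ring.
  by rewrite h1 h2; ring.
have e2 : (y1 ^+ 2 + y2 ^+ 2) * (x2 - u2) = 0.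
  transitivity (y2 * ((x1 * y1 + x2 * y2) - (u1 * y1 + u2 * y2)) -
     y1 * ((x1 * y2 - x2 * y1) - (u1 * y2 - u2 * y1))); first by ring.
  by rewrite h1 h2; ring.
move/eqP: e1; move/eqP: e2; rewrite !mulf_eq0 (negbTE yy) /= !subr_eq0.
by move=> /eqP -> /eqP ->.
Qed.

(* The x in question lie on the circle with diameter [0, z]; writing v for the
   cross product of 2 x - z with y, (2 (x.y) - z.y)^2 + v^2 = |z|^2 |y|^2, and x
   is determined by x.y and the sign of v. *)
Lemma circle_block : exists C : nat, forall (s : seq (int * int)) (y z : int * int) (j : nat),
  uniq s -> y != 0 ->
  (size [seq x <- [seq x <- s | dot x z == dot x x] | dyad (dot x y) == j] <=
    4 * ((C * 2 ^ j.+1) %/ j.+2 ^ 4))%N.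
Proof.
have [C hC] := circle_count R; exists C => s y z j us y0.
(* The sieve counts the natural numbers [|x.y|], so the sign of [x.y] has to be fixed along with
   that of the cross product: four classes, hence the factor 4. *)
pose f (x : int * int) := (0 <= dot x y, 0 <= cross (2%:R * x.1 - z.1, 2%:R * x.2 - z.2) y).
apply: (@size_fiber_le _ _ f _ [:: (true, true); (true, false); (false, true);
  (false, false)]) => [x _|[b1 b2] _].
  by rewrite /f; case: (0 <= _); case: (0 <= _).
rewrite -!filter_predI -(size_map (fun x => `|dot x y|%N)).
pose sg : int := if b1 then 1 else -1.
have sgE x : (0 <= dot x y) = b1 -> (`|dot x y|%N%:Z = sg * dot x y).
  by rewrite /sg => <-; move: (dot x y) => k; case: (lerP 0 k); lia.
have idE x : dot x z = dot x x ->
  (2 * dot x y - dot z y) ^+ 2 + cross (2%:R * x.1 - z.1, 2%:R * x.2 - z.2) y ^+ 2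
   = dot z z * dot y y.
  case: x => x1 x2; case: (y) (z) => [y1 y2] [z1 z2]; rewrite /dot /cross /= => e.
  transitivity ((z1 * z1 + z2 * z2) * (y1 * y1 + y2 * y2) +
    4%:R * (y1 * y1 + y2 * y2) * ((x1 * x1 + x2 * x2) - (x1 * z1 + x2 * z2))); first by ring.
  by rewrite e subrr mulr0 addr0.
apply: (hC j.+1 (sg * dot z y) (dot z z * dot y y)).
  rewrite map_inj_in_uniq ?filter_uniq// => x x'.
  rewrite !mem_filter /= => /andP[/and3P[/eqP[xb1 xb2] _ /eqP xz] _].
  move=> /andP[/and3P[/eqP[ub1 ub2] _ /eqP uz] _] xx'.
  have dd : dot x y = dot x' y.
    have := congr1 Posz xx'; rewrite !sgE//.
    by move=> /mulfI; apply; rewrite /sg; case: (b1).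
  apply: (dot_cross_inj y0) => //.
  have cc : cross (2%:R * x.1 - z.1, 2%:R * x.2 - z.2) y =
            cross (2%:R * x'.1 - z.1, 2%:R * x'.2 - z.2) y.
    have : cross (2%:R * x.1 - z.1, 2%:R * x.2 - z.2) y ^+ 2 =
           cross (2%:R * x'.1 - z.1, 2%:R * x'.2 - z.2) y ^+ 2.
      by have := idE _ xz; rewrite -(idE _ uz) dd => /addrI.
    move/eqP; rewrite eqf_sqr => /orP[/eqP//|/eqP e].
    by move: xb2 ub2; rewrite e oppr_ge0 => <-; move: (cross _ _) => c; lia.
  move: cc; rewrite /cross /=; lia.
move=> k /mapP[x]; rewrite !mem_filter /= => /andP[/and3P[/eqP[xb1 xb2] /eqP xj /eqP xz] _] ->.
split; first by rewrite -xj dyad_lt.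
exists (cross (2%:R * x.1 - z.1, 2%:R * x.2 - z.2) y).
rewrite -(idE _ xz) sgE//; congr (_ + _).
by rewrite /sg; case: (b1); ring.
Qed.

Lemma sum_circle_wgt : exists2 C : R, 0 <= C & forall (s : seq (int * int)) (y z : int * int),
  uniq s -> y != 0 ->
  \sum_(x <- s | dot x z == dot x x) wgt (dyad (dot x y)) <= C.
Proof.
have [C hC] := circle_block; exists (8 * C%:R * 2); first by rewrite !mulr_ge0.
move=> s y z us y0; rewrite -big_filter.
apply: sum_dyad_block => [|j|j]; first by rewrite mulr_ge0.
  exact/ltW/wgt_gt0.
have p2 : 0 < 2 ^+ j :> R by rewrite exprn_gt0.
(* In the constant 8, 4 comes from the sign classes and 2 from [2 ^ j.+1]. Multiplication by [wgt j]
   leaves [8 C / (j + 1)^2]. *)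
have h : (size [seq x <- [seq x <- s | dot x z == dot x x] | dyad (dot x y) == j])%:R
   <= 8 * C%:R * 2 ^+ j / j.+1%:R ^+ 4 :> R.
  rewrite ler_pdivlMr ?exprn_gt0//.
  have := hC s y z j us y0; set n := size _ => nle.
  have : (n * j.+1 ^ 4 <= 8 * C * 2 ^ j)%N.
    apply: leq_trans (leq_mul nle (leqnn _)) _.
    apply: (@leq_trans (4 * ((C * 2 ^ j.+1) %/ j.+2 ^ 4) * j.+2 ^ 4)%N).
      by rewrite leq_mul// leq_exp2r.
    rewrite -mulnA (leq_trans (leq_mul (leqnn 4) (leq_divM _ _)))// expnS.
    by apply/eq_leq; ring.
  by rewrite -(ler_nat R) !natrM !natrX.
apply: le_trans (ler_wpM2l (ltW (wgt_gt0 j)) h) _.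
rewrite /wgt le_eqVlt; apply/orP; left; apply/eqP; field.
by rewrite !gt_eqF ?ltr0n.
Qed.

Definition l2 (s : seq (int * int)) (a : int * int -> R) : R :=
  Num.sqrt (\sum_(x <- s) a x ^+ 2).

(** For a duplicate-free [s], the extension of [c] by 0 outside [s]. The form of a sum lets the
    constraint [z == x + y] be moved in and out of other sums. *)
Definition ext (s : seq (int * int)) (c : int * int -> R) (v : int * int) : R :=
  \sum_(z <- s | z == v) c z.

Lemma extE s c v : uniq s -> ext s c v = (v \in s)%:R * c v.
Proof.
move=> us; rewrite /ext -big_filter; case: (boolP (v \in s)) => vs.
  by rewrite (filter_pred1_uniq us vs) big_seq1 mul1r.
rewrite mul0r big_seq_cond big1// => z; rewrite mem_filter.
by move=> /andP[/andP[/eqP -> zs]]; rewrite (negbTE vs) in zs.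
Qed.

(** As [h] is injective, each [z] is reached from at most one [y]. *)
Lemma sum_ext_sqr s c (h : int * int -> int * int) : uniq s -> injective h ->
  \sum_(y <- s) ext s c (h y) ^+ 2 <= \sum_(z <- s) c z ^+ 2.
Proof.
move=> us hi.
have -> : \sum_(y <- s) ext s c (h y) ^+ 2 = \sum_(y <- s) \sum_(z <- s | z == h y) c z ^+ 2.
  apply: eq_bigr => y _; rewrite -[RHS]/(ext s (fun z => c z ^+ 2) (h y)) !extE//.
  by case: (h y \in s); rewrite ?mul1r// !mul0r expr0n.
rewrite (exchange_big_dep xpredT)//=; apply: ler_sum => z _.
rewrite big_const_seq iter_addr_0 -[leRHS]mulr1 -mulr_natr ler_wpM2l ?sqr_ge0//.
rewrite -[1]/(1%:R) ler_nat -size_filter.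
have u : uniq [seq y <- s | z == h y] by rewrite filter_uniq.
case e : [seq y <- s | z == h y] => [|y1 [|y2 t]]//.
move: u; rewrite e /= inE negb_or -andbA => /and3P[/eqP + _ _]; case; apply: hi.
have : y1 \in [seq y <- s | z == h y] by rewrite e inE eqxx.
have : y2 \in [seq y <- s | z == h y] by rewrite e !inE eqxx orbT.
by rewrite !mem_filter => /andP[/eqP <- _] /andP[/eqP <- _].
Qed.

Lemma l2_ge0 s a : 0 <= l2 s a.
Proof. exact: sqrtr_ge0. Qed.

Lemma l2_sqr s a : l2 s a ^+ 2 = \sum_(x <- s) a x ^+ 2.
Proof. by rewrite sqr_sqrtr// sumr_ge0// => x _; rewrite sqr_ge0. Qed.

Lemma sum_mul_le_l2 s a g (G : R) : 0 <= G ->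
  \sum_(x <- s) g x ^+ 2 <= G ^+ 2 -> \sum_(x <- s) a x * g x <= l2 s a * G.
Proof.
move=> G0 gG.
have p0 : 0 <= l2 s a * G by rewrite mulr_ge0// l2_ge0.
have [n0|n0] := leP (\sum_(x <- s) a x * g x) 0; first exact: le_trans p0.
rewrite -(@ler_pXn2r _ 2) ?nnegrE//; last exact: ltW.
apply: le_trans (sum_cauchy_schwarz _ _ _ _) _.
by rewrite exprMn l2_sqr ler_wpM2l// sumr_ge0// => x _; rewrite sqr_ge0.
Qed.

(** The cofactor of [a x] in the trilinear sum; by duality its l2 norm is what has to be bounded.
    The frequency [y = 0] is set apart, because [x.0] vanishes for all [x] and the circle count says
    nothing there. *)
Definition fiber_sum (s : seq (int * int)) (b c : int * int -> R) (x : int * int) : R :=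
  \sum_(y <- s | y != 0) b y * ext s c (x + y) * ker (dot x y).

(** For fixed [x], the [y] are grouped by [k = x.y]. A weighted Cauchy-Schwarz in [k], then a plain
    one inside each group, leaves pairs [y], [y'] with [x.y = x.y']; for fixed [y] and [z = x + y']
    the remaining sum over [x] runs over a circle and is bounded by [sum_circle_wgt]. *)
Lemma sum_fiber_sum_sqr : exists2 C : R, 0 <= C &
  forall (s : seq (int * int)) (b c : int * int -> R), uniq s ->
  \sum_(x <- s) fiber_sum s b c x ^+ 2 <=
    C * ((\sum_(y <- s) b y ^+ 2) * (\sum_(z <- s) c z ^+ 2)).
Proof.
have [W W0 hW] := sum_circle_wgt; exists (8 * W); first by rewrite mulr_ge0.
move=> s b c us.
pose s' := [seq y <- s | y != 0].
have us' : uniq s' by rewrite filter_uniq.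
pose H x k := \sum_(y <- s' | dot x y == k) b y * ext s c (x + y).
have fE x : fiber_sum s b c x ^+ 2 <=
    8 * \sum_(y <- s') \sum_(y' <- s | dot x y == dot x y')
        wgt (dyad (dot x y)) * (b y ^+ 2 * ext s c (x + y') ^+ 2).
  rewrite /fiber_sum -big_filter -/s' (sum_group _ (dot x)).
  set ks := undup _; have uks : uniq ks by rewrite undup_uniq.
  (* The weight is inserted and compensated, so that Cauchy-Schwarz separates the sum of
     [ker ^+ 2 / wgt], at most 8, from the sum of [wgt] times the squares of the group sums
     [H x k]. *)
  rewrite (eq_bigr (fun k => (ker k / Num.sqrt (wgt (dyad k))) * (Num.sqrt (wgt (dyad k))
    * H x k))); last first.
    move=> k _; rewrite mulrA divfK ?gt_eqF ?sqrtr_gt0 ?wgt_gt0// /H mulr_sumr.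
    by apply: eq_bigr => y /eqP ->; rewrite mulrC.
  apply: le_trans (sum_cauchy_schwarz _ _ _ _) _; apply: ler_pM.
  - by apply: sumr_ge0 => k _; rewrite sqr_ge0.
  - by apply: sumr_ge0 => k _; rewrite sqr_ge0.
  - rewrite (eq_bigr (fun k => ker k ^+ 2 / wgt (dyad k))); first exact: sum_ker_wgt.
    by move=> k _; rewrite expr_div_n sqr_sqrtr// ltW// wgt_gt0.
  rewrite [leRHS](sum_group _ (dot x)) -/ks; apply: ler_sum => k _.
  rewrite exprMn sqr_sqrtr; last by rewrite ltW// wgt_gt0.
  apply: (@le_trans _ _ (wgt (dyad k) * ((\sum_(y <- s' | dot x y == k) b y ^+ 2) *
      (\sum_(y <- s' | dot x y == k) ext s c (x + y) ^+ 2)))).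
    by rewrite ler_wpM2l ?sum_cauchy_schwarz// ltW// wgt_gt0.
  rewrite mulr_suml mulr_sumr; apply: ler_sum => y /eqP yk.
  rewrite yk -mulr_sumr -mulr_sumr; apply: ler_wpM2l; first exact/ltW/wgt_gt0.
  apply: ler_wpM2l; first exact: sqr_ge0.
  rewrite big_filter_cond big_mkcond [leRHS]big_mkcond /=; apply: ler_sum => y' _.
  rewrite [k == _]eq_sym; case: (_ == k); rewrite ?andbF// andbT.
  by case: ifP => // _; rewrite sqr_ge0.
apply: le_trans (ler_sum _ (fun x _ => fE x)) _.
rewrite -mulr_sumr -mulrA ler_wpM2l//.
rewrite exchange_big /= mulrCA big_distrl /= .
apply: (@le_trans _ _ (\sum_(y <- s') b y ^+ 2 * (W * \sum_(z <- s) c z ^+ 2))); last first.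
  rewrite /s' big_filter [leRHS](bigID (fun y => y != 0)) /= lerDl.
  apply: sumr_ge0 => y _; rewrite mulr_ge0 ?sqr_ge0// mulr_ge0//.
  by apply: sumr_ge0 => z _; rewrite sqr_ge0.
rewrite big_seq [leRHS]big_seq; apply: ler_sum => y; rewrite mem_filter => /andP[y0 ys].
under eq_bigr do rewrite -mulr_sumr.
rewrite (eq_bigr (fun x => b y ^+ 2 * \sum_(y' <- s |
  dot x y == dot x y') wgt (dyad (dot x y)) * ext s c (x + y') ^+ 2)); last first.
  by move=> x _; rewrite -!mulr_sumr mulrCA.
rewrite -mulr_sumr ler_wpM2l ?sqr_ge0//.
(* Naming [z = x + y'] decouples [c z] from [x], so that the sum over [x] can be carried out for
   fixed [z]. *)
have -> : \sum_(x <- s) \sum_(y' <- s | dot x y == dot x y') wgt (dyad (dot x y)) * ext s c (x + y') ^+ 2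
  = \sum_(x <- s) \sum_(z <- s) \sum_(y' <- s | (dot x y == dot x y') && (z == x + y'))
      wgt (dyad (dot x y)) * c z ^+ 2.
  apply: eq_bigr => x _; rewrite (exchange_big_dep (fun y' => dot x y == dot x y'))/=;
    last by move=> ? ? _ /andP[].
  apply: eq_bigr => y' e; under eq_bigl do rewrite e /=.
  rewrite -mulr_sumr -[\sum_(_ <- _ | _) _]/(ext s (fun z => c z ^+ 2) (x + y')) !extE//.
  by case: (x + y' \in s); rewrite ?mul1r// !mul0r expr0n.
rewrite exchange_big /= mulr_sumr; apply: ler_sum => z _.
(* With [y' = z - x], the condition [x.y = x.y'] becomes [x.(z - y) = x.x]: the circle with diameter
   from 0 to [z - y]. *)
apply: (@le_trans _ _ (\sum_(x <- s | dot x (z - y) == dot x x) wgt (dyad (dot x y)) * c z ^+ 2));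
  last first.
  by rewrite -mulr_suml ler_wpM2r ?sqr_ge0// hW.
rewrite [leRHS]big_mkcond /=; apply: ler_sum => x _.
have wc : 0 <= wgt (dyad (dot x y)) * c z ^+ 2 by rewrite mulr_ge0 ?sqr_ge0 ?ltW ?wgt_gt0.
rewrite big_const_seq iter_addr_0 -mulr_natr -size_filter.
have sub : {subset [seq y' <- s | (dot x y == dot x y') && (z == x + y')] <= [:: z - x]}.
  move=> y'; rewrite mem_filter inE => /andP[/andP[_ /eqP ->] _].
  by rewrite addrC addKr eqxx.
have usz : uniq [seq y' <- s | (dot x y == dot x y') && (z == x + y')] by rewrite filter_uniq.
have := uniq_leq_size usz sub; case e : [seq y' <- s | _] => [|y' [|]]//= _.
  by rewrite mulr0; case: ifP.
have : y' \in [seq y' <- s | (dot x y == dot x y') && (z == x + y')] by rewrite e inE eqxx.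
rewrite mem_filter => /andP[/andP[/eqP e1 /eqP e2] _]; rewrite mulr1 ifT//.
rewrite e2; apply/eqP; move: e1; rewrite /dot /=; lia.
Qed.

Definition tri_mixed s (a b c : int * int -> R) : R :=
  \sum_(x <- s) \sum_(y <- s) \sum_(z <- s | z == x + y) a x * b y * c z * ker (dot x y).

(** The 1 added to the square root of [C] pays for the terms with [y = 0]: there the kernel is 1 and
    the sum is [b 0] times the scalar product of [a] and [c]. *)
Lemma tri_mixed_le : exists2 C : R, 0 < C & forall s a b c, uniq s ->
  (forall x, 0 <= a x) -> (forall x, 0 <= b x) -> (forall x, 0 <= c x) ->
  tri_mixed s a b c <= C * (l2 s a * l2 s b * l2 s c).
Proof.
have [C C0 hC] := sum_fiber_sum_sqr; exists (Num.sqrt C + 1).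
  by rewrite ltr_wpDl// sqrtr_ge0.
move=> s a b c us a0 b0 c0.
have -> : tri_mixed s a b c = \sum_(x <- s) a x * fiber_sum s b c x +
    ext s b 0 * \sum_(x <- s) a x * ext s c x.
  rewrite mulr_sumr -big_split /=; apply: eq_bigr => x _.
  rewrite (bigID (fun y => y != 0)) /=; congr (_ + _).
    rewrite /fiber_sum mulr_sumr; apply: eq_bigr => y _.
    by rewrite -mulr_suml -mulr_sumr -/(ext s c (x + y)); ring.
  under eq_bigl do rewrite negbK.
  rewrite /ext mulr_suml; apply: eq_bigr => y /eqP ->; rewrite addr0.
  rewrite -mulr_suml -mulr_sumr -/(ext s c x) /dot !mulr0 addr0 /ker normr0 addr0 invr1.
  by rewrite mulr1 -/(ext s c x); ring.
rewrite mulrDl mul1r; apply: lerD.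
  rewrite -!mulrA mulrCA; apply: sum_mul_le_l2.
    by rewrite !mulr_ge0// ?l2_ge0 ?sqrtr_ge0.
  by rewrite !exprMn !l2_sqr sqr_sqrtr// hC.
rewrite [leRHS](_ : _ = l2 s b * (l2 s a * l2 s c)); last by ring.
apply: ler_pM.
- by rewrite sumr_ge0.
- by apply: sumr_ge0 => x _; rewrite mulr_ge0// sumr_ge0.
- rewrite -(@ler_pXn2r _ 2) ?nnegrE ?l2_ge0 ?sumr_ge0// l2_sqr extE//.
  case: (boolP (0 \in s)) => s0; last first.
    by rewrite mul0r expr0n sumr_ge0// => x _; rewrite sqr_ge0.
  rewrite mul1r (big_rem 0)//= lerDl sumr_ge0// => x _; exact: sqr_ge0.
- apply: sum_mul_le_l2; first exact: l2_ge0.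
  by rewrite l2_sqr; apply: (@sum_ext_sqr s c id).
Qed.

Definition tri_same s (a b c : int * int -> R) : R :=
  \sum_(x <- s) \sum_(y <- s) \sum_(z <- s | z == - (x + y))
    a x * b y * c z * ker (dot x x + dot y y + dot z z).

(** On a dyadic block [1 + k^2 >= (1 + |k|)^2 / 2 >= 4^j / 2], and there are at most [4 * 2^j]
    integers, so the block contributes at most [8 / 2^j <= 32 / (j + 1)^2]. *)
Lemma sum_ker_sqr (ks : seq int) : uniq ks ->
  \sum_(k <- ks) (1 + k%:~R ^+ 2)^-1 <= 64 :> R.
Proof.
move=> uks.
apply: (@le_trans _ _ (\sum_(k <- ks) (fun j => 2 / (2 ^+ j) ^+ 2) (dyad k))).
  apply: ler_sum => k _.
  have k0 : 0 < 1 + (k%:~R : R) ^+ 2 by rewrite ltr_pwDl// sqr_ge0.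
  have p0 : 0 < (2 ^+ dyad k : R) by rewrite exprn_gt0.
  rewrite -[leLHS]mul1r ler_pdivrMr// mulrAC ler_pdivlMr ?exprn_gt0// mul1r.
  have := dyad_le k; rewrite -(ler_nat R) natrX natrD => h.
  apply: (@le_trans _ _ ((`|k|%N%:R + 1) ^+ 2)).
    by apply: lerXn2r; rewrite ?nnegrE ?addr_ge0 ?(ltW p0).
  have -> : (k%:~R : R) ^+ 2 = `|k|%N%:R ^+ 2.
    by case: (k) => n //; rewrite NegzE rmorphN sqrrN.
  rewrite -subr_ge0.
  have -> : 2 * (1 + `|k|%N%:R ^+ 2) - (`|k|%N%:R + 1) ^+ 2 = (`|k|%N%:R - 1) ^+ 2 :> R.
    by ring.
  exact: sqr_ge0.
rewrite [leRHS](_ : _ = 32 * 2); last by lra.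
apply: (@sum_dyad_block _ ks dyad (fun j => 2 / (2 ^+ j) ^+ 2)) => // j.
have p2 : 0 < 2 ^+ j :> R by rewrite exprn_gt0.
have := size_dyad_block j uks; rewrite -(ler_nat R) natrM natrX => h.
apply: le_trans (ler_wpM2l _ h) _; first by rewrite divr_ge0 ?sqr_ge0.
have -> : 2 / 2 ^+ j ^+ 2 * (4 * 2 ^+ j) = 8 / 2 ^+ j :> R by field; rewrite gt_eqF.
rewrite ler_pdivrMr// mulrAC ler_pdivlMr ?exprn_gt0//.
suff : (j.+1 ^ 2 <= 4 * 2 ^ j)%N.
  rewrite -(ler_nat R) natrX natrM natrX => hj.
  rewrite [leRHS](_ : _ = 8 * (4 * 2 ^+ j)); last by ring.
  by rewrite ler_wpM2l.
elim: j {h p2} => // -[|[|j]] // IH; rewrite expnS mulnCA.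
apply: leq_trans (leq_mul (leqnn 2) IH); rewrite !expnS !expn0; nia.
Qed.

(** Nothing cancels in the phase, so the kernel is at most [(1 + |x|^2)^-1]. This is square summable
    over the plane lattice, because [(1 + u + v)^2 >= (1 + u)(1 + v)] splits it into two
    one-dimensional sums; for each [x] the sum over [y] is handled by Cauchy-Schwarz. *)
Lemma tri_same_le : exists2 C : R, 0 < C & forall s a b c, uniq s ->
  (forall x, 0 <= a x) -> (forall x, 0 <= b x) -> (forall x, 0 <= c x) ->
  tri_same s a b c <= C * (l2 s a * l2 s b * l2 s c).
Proof.
exists 64 => // s a b c us a0 b0 c0.
pose g (k : int) : R := (1 + k%:~R ^+ 2)^-1.
have g0 k : 0 <= g k by rewrite invr_ge0 addr_ge0// sqr_ge0.
have gs : \sum_(x <- s) g x.1 * g x.2 <= 64 ^+ 2.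
  rewrite (sum_group _ fst).
  apply: (@le_trans _ _ (\sum_(u <- undup (map fst s)) g u * 64)); last first.
    by rewrite -mulr_suml expr2 ler_wpM2r// sum_ker_sqr ?undup_uniq.
  apply: ler_sum => u _.
  under eq_bigr => x /eqP -> do [].
  rewrite -mulr_sumr ler_wpM2l// -big_filter -(big_map snd xpredT g).
  apply: sum_ker_sqr; rewrite map_inj_in_uniq ?filter_uniq// => -[x1 x2] [y1 y2].
  by rewrite !mem_filter /= => /andP[/eqP -> _] /andP[/eqP -> _] ->.
pose K (x : int * int) : R := (1 + (dot x x)%:~R)^-1.
have dE (x : int * int) : (dot x x)%:~R = (x.1%:~R) ^+ 2 + (x.2%:~R) ^+ 2 :> R.
  by rewrite /dot rmorphD !rmorphM -!expr2.
have d0 (x : int * int) : 0 <= dot x x by rewrite /dot addr_ge0// -expr2 sqr_ge0.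
have K0 x : 0 <= K x by rewrite invr_ge0 addr_ge0// ler0z.
have KK x : K x ^+ 2 <= g x.1 * g x.2.
  rewrite /K /g dE -invfM exprVn.
  set u := x.1%:~R ^+ 2; set v := x.2%:~R ^+ 2.
  have u0 : 0 <= u by exact: sqr_ge0.
  have v0 : 0 <= v by exact: sqr_ge0.
  rewrite lef_pV2 ?posrE ?exprn_gt0 ?mulr_gt0 ?ltr_pwDl ?addr_ge0//.
  nra.
have kle x y z : ker (dot x x + dot y y + dot z z) <= K x.
  have le : dot x x <= dot x x + dot y y + dot z z.
    by rewrite -addrA lerDl; apply: addr_ge0; apply: d0.
  have p : 0 <= dot x x + dot y y + dot z z by apply: le_trans le; apply: d0.
  rewrite /ker (ger0_norm p).
  have q : 0 < 1 + (dot x x)%:~R :> R by rewrite ltr_pwDl// ler0z.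
  have q' : 0 < 1 + (dot x x + dot y y + dot z z)%:~R :> R by rewrite ltr_pwDl// ler0z.
  by rewrite /K lef_pV2// lerD2l ler_int.
apply: (@le_trans _ _ (\sum_(x <- s) a x * (K x * \sum_(y <- s) b y * ext s c (- (x + y))))).
  apply: ler_sum => x _; rewrite mulr_sumr mulr_sumr; apply: ler_sum => y _.
  rewrite /ext !mulr_sumr; apply: ler_sum => z _.
  rewrite [leRHS](_ : _ = a x * b y * c z * K x); last by ring.
  by rewrite ler_wpM2l// !mulr_ge0.
rewrite mulrA -mulrA mulrCA; apply: le_trans (sum_mul_le_l2 (G := 64 * (l2 s b * l2 s c)) _ _ _) _.
- by rewrite !mulr_ge0// l2_ge0.
- apply: (@le_trans _ _ (\sum_(x <- s) K x ^+ 2 * (l2 s b * l2 s c) ^+ 2)).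
    apply: ler_sum => x _; rewrite exprMn ler_wpM2l ?sqr_ge0//.
    have S0 : 0 <= \sum_(y <- s) b y * ext s c (- (x + y)).
      by apply: sumr_ge0 => y _; rewrite mulr_ge0// sumr_ge0.
    apply: lerXn2r; rewrite ?nnegrE ?mulr_ge0 ?l2_ge0//.
    apply: sum_mul_le_l2; rewrite ?l2_ge0// l2_sqr.
    by apply: sum_ext_sqr => // y y' /oppr_inj /addrI.
  rewrite -mulr_suml [leRHS]exprMn ler_wpM2r ?sqr_ge0//.
  by apply: le_trans gs; apply: ler_sum.
- by rewrite le_eqVlt; apply/orP; left; apply/eqP; ring.
Qed.

(** Conjugating a mode negates both its time frequency ([sgz_if]) and its space frequency
    ([sg2]). *)
Definition sgz_if (b : bool) (k : int) : int := if b then - k else k.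
Definition sg2 (b : bool) (x : int * int) : int * int := if b then - x else x.

Definition phase (sg : 'I_3 -> bool) (x y z : int * int) : int :=
  sgz_if (sg ord0) (dot x x) + sgz_if (sg (inord 1)) (dot y y) + sgz_if (sg (inord 2)) (dot z z).

Definition resonant (sg : 'I_3 -> bool) (x y z : int * int) : bool :=
  sg2 (sg ord0) x + sg2 (sg (inord 1)) y + sg2 (sg (inord 2)) z == 0.

(** Equal signs lead to [tri_same]. If one sign differs, that frequency is the sum of the two
    others, so the phase is twice a scalar product up to sign; a permutation of the three functions
    leads to [tri_mixed]. *)
Lemma discrete_trilinear : exists2 C : R, 0 < C & forall (sg : 'I_3 -> bool) s a b c, uniq s ->
  (forall x, 0 <= a x) -> (forall x, 0 <= b x) -> (forall x, 0 <= c x) ->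
  \sum_(x <- s) \sum_(y <- s) \sum_(z <- s | resonant sg x y z)
     a x * b y * c z * ker (phase sg x y z) <= C * (l2 s a * l2 s b * l2 s c).
Proof.
have [C C0 hC] := tri_mixed_le; have [D D0 hD] := tri_same_le.
exists (C + D) => [|sg s a b c us a0 b0 c0]; first exact: addr_gt0.
have kerN k : ker (- k) = ker k by rewrite /ker normrN.
have ker2 k : ker (2 * k) <= ker k.
  rewrite lef_pV2 ?posrE ?ltr_pwDl ?ler0z// lerD2l ler_int normrM.
  by rewrite ler_peMl.
have L0 : 0 <= l2 s a * l2 s b * l2 s c by rewrite !mulr_ge0// l2_ge0.
have toC : forall X, X <= C * (l2 s a * l2 s b * l2 s c) -> X <= (C + D) * (l2 s a * l2 s b * l2 s c).
  by move=> X h; apply: le_trans h _; rewrite ler_wpM2r// lerDl ltW.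
have toD : forall X, X <= D * (l2 s a * l2 s b * l2 s c) -> X <= (C + D) * (l2 s a * l2 s b * l2 s c).
  by move=> X h; apply: le_trans h _; rewrite ler_wpM2r// lerDr ltW.
have S : \sum_(x <- s) \sum_(y <- s) \sum_(z <- s | z == - (x + y))
     a x * b y * c z * ker (dot x x + dot y y + dot z z) <= (C + D) * (l2 s a * l2 s b * l2 s c).
  by apply: toD; apply: hD.
have M3 : \sum_(x <- s) \sum_(y <- s) \sum_(z <- s | z == x + y)
     a x * b y * c z * ker (dot x x + dot y y - dot z z) <= (C + D) * (l2 s a * l2 s b * l2 s c).
  apply: toC; apply: le_trans (hC s a b c us a0 b0 c0).
  apply: ler_sum => x _; apply: ler_sum => y _; apply: ler_sum => z /eqP ->.
  rewrite ler_wpM2l ?mulr_ge0// -(kerN (_ - _)).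
  rewrite (_ : - _ = 2 * dot x y); first exact: ker2.
  by rewrite /dot /=; ring.
have M2 : \sum_(x <- s) \sum_(y <- s) \sum_(z <- s | y == x + z)
     a x * b y * c z * ker (dot x x - dot y y + dot z z) <= (C + D) * (l2 s a * l2 s b * l2 s c).
  apply: toC; rewrite mulrAC; apply: le_trans (hC s a c b us a0 c0 b0).
  apply: ler_sum => x _; rewrite (exchange_big_dep xpredT)//=.
  apply: ler_sum => z _; apply: ler_sum => y /eqP ->.
  rewrite [a x * _ * _]mulrAC ler_wpM2l ?mulr_ge0// -(kerN (_ + _)).
  rewrite (_ : - _ = 2 * dot x z); first exact: ker2.
  by rewrite /dot /=; ring.
have M1 : \sum_(x <- s) \sum_(y <- s) \sum_(z <- s | x == y + z)
     a x * b y * c z * ker (- dot x x + dot y y + dot z z) <= (C + D) * (l2 s a * l2 s b * l2 s c).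
  apply: toC; rewrite [l2 s a * _]mulrC mulrAC; apply: le_trans (hC s b c a us b0 c0 a0).
  rewrite exchange_big /=; apply: ler_sum => y _; rewrite (exchange_big_dep xpredT)//=.
  apply: ler_sum => z _; apply: ler_sum => x /eqP ->.
  rewrite [leLHS](_ : _ = b y * c z * a (y + z) * ker (- dot (y + z) (y + z) + dot y y + dot z z));
    last by ring.
  rewrite ler_wpM2l ?mulr_ge0// -(kerN (_ + _)).
  rewrite (_ : - _ = 2 * dot y z); first exact: ker2.
  by rewrite /dot /=; ring.
have eqV (x y : int * int) : (x == y) = (x.1 == y.1) && (x.2 == y.2).
  by case: x y => ? ? [].
(* The kernel is even, so a global change of sign of the phase is harmless and the eight sign
   patterns fall into four pairs. *)
have main (P : int * int -> int * int -> int * int -> bool) (Q : int * int -> int * int ->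
  int * int -> int) X :
    (forall x y z, resonant sg x y z = P x y z) ->
    (forall x y z, phase sg x y z = Q x y z \/ phase sg x y z = - Q x y z) ->
    \sum_(x <- s) \sum_(y <- s) \sum_(z <- s | P x y z) a x * b y * c z * ker (Q x y z) <= X ->
    \sum_(x <- s) \sum_(y <- s) \sum_(z <- s | resonant sg x y z)
     a x * b y * c z * ker (phase sg x y z) <= X.
  move=> hP hQ; apply: le_trans; apply: ler_sum => x _; apply: ler_sum => y _.
  under eq_bigl do rewrite hP.
  by apply: ler_sum => z _; case: (hQ x y z) => ->; rewrite ?kerN.
case e0 : (sg ord0); case e1 : (sg (inord 1)); case e2 : (sg (inord 2)).
- by apply: main S => -[x1 x2] [y1 y2] [z1 z2]; rewrite /resonant /phase e0 e1 e2 /= ?eqV /=; clear; lia.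
- by apply: main M3 => -[x1 x2] [y1 y2] [z1 z2]; rewrite /resonant /phase e0 e1 e2 /= ?eqV /=;
  clear; lia.
- by apply: main M2 => -[x1 x2] [y1 y2] [z1 z2]; rewrite /resonant /phase e0 e1 e2 /= ?eqV /=;
  clear; lia.
- by apply: main M1 => -[x1 x2] [y1 y2] [z1 z2]; rewrite /resonant /phase e0 e1 e2 /= ?eqV /=;
  clear; lia.
- by apply: main M1 => -[x1 x2] [y1 y2] [z1 z2]; rewrite /resonant /phase e0 e1 e2 /= ?eqV /=;
  clear; lia.
- by apply: main M2 => -[x1 x2] [y1 y2] [z1 z2]; rewrite /resonant /phase e0 e1 e2 /= ?eqV /=;
  clear; lia.
- by apply: main M3 => -[x1 x2] [y1 y2] [z1 z2]; rewrite /resonant /phase e0 e1 e2 /= ?eqV /=;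
  clear; lia.
- by apply: main S => -[x1 x2] [y1 y2] [z1 z2]; rewrite /resonant /phase e0 e1 e2 /= ?eqV /=; clear; lia.
Qed.

End finite_sums.

(** * Averaging operators on a finite measure space *)

Local Open Scope classical_set_scope.
Local Open Scope ring_scope.

(** * Sequences of extended reals tending to 0 *)

Section vanish.
Context {R : realType}.

(** A one-sided form of convergence to 0 for nonnegative sequences, chosen because it passes
    directly to smaller sequences; [cvg_vanish] and [vanish_cvg] relate it to limits. *)
Definition vanish (u : nat -> \bar R) : Prop :=
  forall e : R, 0 < e -> \forall n \near \oo, (u n <= e%:E)%E.

Lemma vanish_le (u v : nat -> \bar R) : (forall n, (u n <= v n)%E) -> vanish v -> vanish u.
Proof.
move=> uv hv e e0; near=> n; apply: le_trans (uv n) _; near: n; exact: hv.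
Unshelve. all: by end_near. Qed.

Lemma vanishD (u v : nat -> \bar R) : vanish u -> vanish v -> vanish (fun n => u n + v n)%E.
Proof.
move=> hu hv e e0; have e2 : 0 < e / 2 by rewrite divr_gt0.
near=> n; rewrite (splitr e) EFinD; apply: leeD; near: n; [exact: hu|exact: hv].
Unshelve. all: by end_near. Qed.

Lemma vanishZ (c : R) (u : nat -> \bar R) : 0 <= c -> vanish u -> vanish (fun n => c%:E * u n)%E.
Proof.
move=> c0 hu e e0.
have e2 : 0 < e / (c + 1) by rewrite divr_gt0// ltr_wpDl.
near=> n.
apply: (@le_trans _ _ (c%:E * (e / (c + 1))%:E)%E).
  by rewrite lee_wpmul2l ?lee_fin//; near: n; exact: hu.
rewrite -EFinM lee_fin mulrA ler_pdivrMr ?ltr_wpDl// mulrC ler_pM2l//.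
by rewrite lerDl.
Unshelve. all: by end_near. Qed.

Lemma cvg_vanish (u : nat -> \bar R) : u @ \oo --> 0%E -> vanish u.
Proof.
move=> /fine_cvgP[fu /cvgrPdist_le hu] e e0.
near=> n; have fn : u n \is a fin_num by near: n.
rewrite -(fineK fn) lee_fin (le_trans (ler_norm _))// -[X in `|X|]subr0 distrC.
by near: n; apply: hu.
Unshelve. all: by end_near. Qed.

End vanish.

Lemma measurable_patch d (T : measurableType d) (R : realType) (E : set T) (h : T -> \bar R) :
  measurable E -> measurable_fun setT h -> measurable_fun setT (h \_ E).
Proof.
by move=> mE mh; apply/(measurable_restrictT h mE); apply: measurable_funTS.
Qed.

(** * Tonelli's theorem on products of measurable sets *)

Section measurability.
Context d1 d2 (T1 : measurableType d1) (T2 : measurableType d2) (R : realType).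
Variables (m1 : {sigma_finite_measure set T1 -> \bar R})
          (m2 : {sigma_finite_measure set T2 -> \bar R}).
Variables (D1 : set T1) (D2 : set T2).
Hypotheses (mD1 : measurable D1) (mD2 : measurable D2).

Lemma measurable_integral_ge0 (h : T1 * T2 -> \bar R) : measurable_fun setT h ->
  (forall z, 0 <= h z)%E ->
  measurable_fun setT (fun x => \int[m2]_(y in D2) h (x, y))%E.
Proof.
move=> mh h0.
pose g := h \_ (setT `*` D2).
have mg : measurable_fun setT g.
  by apply: measurable_patch => //; apply: measurableX.
have g0 z : (0 <= g z)%E by rewrite /g patchE; case: ifP.
have := measurable_fun_fubini_tonelli_F (m2 := m2) g mg g0.
rewrite /fubini_F; congr (measurable_fun _ _); apply/funext => x.
rewrite [RHS]integral_mkcond; apply: eq_integral => y _.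
by rewrite /g !patchE in_setX in_setT.
Qed.

Lemma measurable_Rintegral (h : T1 * T2 -> R) : measurable_fun setT h ->
  measurable_fun setT (fun x => \int[m2]_(y in D2) h (x, y)).
Proof.
move=> mh; rewrite /Rintegral.
apply: measurableT_comp; first exact: fine_measurable.
rewrite (_ : (fun x => _) = fun x => (\int[m2]_(y in D2) ((EFin \o h)^\+ (x, y)) -
   \int[m2]_(y in D2) ((EFin \o h)^\- (x, y)))%E); last first.
  apply/funext => x; rewrite integralE; congr (_ - _)%E; apply: eq_integral => y _;
    by rewrite ?funeposE ?funenegE.
have me : measurable_fun setT (EFin \o h) by exact/measurable_EFinP.
apply: emeasurable_funB; apply: measurable_integral_ge0 => //.
  exact: measurable_funepos.
exact: measurable_funeneg.
Qed.

Lemma tonelli_on (h : T1 * T2 -> \bar R) : measurable_fun setT h ->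
  (forall z, 0 <= h z)%E ->
  (\int[m1]_(x in D1) \int[m2]_(y in D2) h (x, y) =
   \int[m2]_(y in D2) \int[m1]_(x in D1) h (x, y))%E.
Proof.
move=> mh h0.
pose g := h \_ (D1 `*` D2).
have mg : measurable_fun setT g.
  by apply: measurable_patch => //; apply: measurableX.
have g0 z : (0 <= g z)%E by rewrite /g patchE; case: ifP.
have := fubini_tonelli (m1 := m1) (m2 := m2) g mg g0.
have -> : (\int[m1]_x \int[m2]_y g (x, y) = \int[m1]_(x in D1) \int[m2]_(y in D2) h (x, y))%E.
  rewrite [RHS]integral_mkcond; apply: eq_integral => x _; rewrite patchE.
  case: ifPn => xD.
    rewrite [RHS]integral_mkcond; apply: eq_integral => y _.
    by rewrite /g !patchE in_setX xD.
  apply: integral0_eq => y _; rewrite /g patchE ifF//.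
  by apply/negbTE; apply: contra xD; rewrite !inE => -[].
move->; rewrite [RHS]integral_mkcond; apply: eq_integral => y _; rewrite patchE.
case: ifPn => yD.
  rewrite [RHS]integral_mkcond; apply: eq_integral => x _.
  by rewrite /g !patchE in_setX yD andbT.
apply: integral0_eq => x _; rewrite /g patchE ifF//.
by apply/negbTE; apply: contra yD; rewrite !inE => -[].
Qed.

Lemma tonelli_on1 (h : T1 * T2 -> \bar R) : measurable_fun setT h ->
  (forall z, 0 <= h z)%E ->
  (\int[m1 \x m2]_(z in D1 `*` D2) h z = \int[m1]_(x in D1) \int[m2]_(y in D2) h (x, y))%E.
Proof.
move=> mh h0.
pose g := h \_ (D1 `*` D2).
have mg : measurable_fun setT g.
  by apply: measurable_patch => //; apply: measurableX.
have g0 z : (0 <= g z)%E by rewrite /g patchE; case: ifP.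
rewrite integral_mkcond -/g (fubini_tonelli1 g mg g0) [RHS]integral_mkcond.
apply: eq_integral => x _; rewrite patchE /fubini_F.
case: ifPn => xD.
  rewrite [RHS]integral_mkcond; apply: eq_integral => y _.
  by rewrite /g !patchE in_setX xD.
apply: integral0_eq => y _; rewrite /g patchE ifF//.
by apply/negbTE; apply: contra xD; rewrite !inE => -[].
Qed.

End measurability.

(** * Moments and integrability *)

Section moments.
Context d (T : measurableType d) (R : realType) (mu : {measure set T -> \bar R}).
Variables (D : set T) (mD : measurable D).

(** The power [p] of the L^p norm; no root is taken, since only finiteness and smallness matter. *)
Definition moment (p : nat) (f : T -> R) : \bar R :=
  (\int[mu]_(x in D) (`|f x| ^+ p)%:E)%E.

Lemma moment_ge0 p f : (0 <= moment p f)%E.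
Proof. by apply: integral_ge0 => x _; rewrite lee_fin exprn_ge0. Qed.

Lemma measurable_normX p (f : T -> R) (E : set T) : measurable_fun setT f ->
  measurable_fun E (fun x => (`|f x| ^+ p)%:E).
Proof.
move=> mf; apply/measurable_EFinP; apply: measurable_funX.
by apply: measurable_funTS; apply: measurableT_comp.
Qed.

Let normX_ge0 p (f : T -> R) x : D x -> (0 <= (`|f x| ^+ p)%:E)%E.
Proof. by move=> _; rewrite lee_fin exprn_ge0. Qed.

Lemma moment_le p (f g : T -> R) : measurable_fun setT f -> measurable_fun setT g ->
  (forall x, D x -> `|f x| <= `|g x|) -> (moment p f <= moment p g)%E.
Proof.
move=> mf mg fg; apply: (ge0_le_integral mu mD) => [x|||x /fg h].
- exact: normX_ge0.
- exact: measurable_normX.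
- exact: measurable_normX.
- by rewrite lee_fin lerXn2r// nnegrE.
Qed.

(** From [|a + b| <= 2 max(|a|, |b|)]; a crude replacement for Minkowski's inequality. *)
Lemma normXD p (a b : R) : `|a + b| ^+ p <= 2 ^+ p * (`|a| ^+ p + `|b| ^+ p).
Proof.
wlog ab : a b / `|a| <= `|b|.
  move=> H; have [/H//|/ltW/H] := leP `|a| `|b|.
  by rewrite addrC [X in _ <= _ * X]addrC.
have h : `|a + b| <= 2 * `|b|.
  by rewrite (le_trans (ler_normD _ _))// mulr2n mulrDl mul1r lerD.
apply: le_trans (lerXn2r p _ _ h) _; rewrite ?nnegrE ?mulr_ge0//.
by rewrite exprMn ler_wpM2l ?exprn_ge0// lerDr exprn_ge0.
Qed.

Lemma momentD p (f g : T -> R) : measurable_fun setT f -> measurable_fun setT g ->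
  (moment p (fun x => f x + g x)%R <= (2 ^+ p)%:E * (moment p f + moment p g))%E.
Proof.
move=> mf mg; rewrite /moment -(ge0_integralD mu mD (@normX_ge0 p f) (@measurable_normX p f D mf)
  (@normX_ge0 p g) (@measurable_normX p g D mg)).
have mfg : measurable_fun D (fun x => (`|f x| ^+ p)%:E + (`|g x| ^+ p)%:E)%E.
  by apply: emeasurable_funD; apply: measurable_normX.
have fg0 x : D x -> (0 <= (`|f x| ^+ p)%:E + (`|g x| ^+ p)%:E)%E.
  by move=> _; rewrite -EFinD lee_fin addr_ge0// exprn_ge0.
rewrite -(ge0_integralZl mu mD mfg fg0); last by rewrite lee_fin exprn_ge0.
apply: (ge0_le_integral mu mD) => [x _|||x _].
- by rewrite lee_fin exprn_ge0.
- by apply: measurable_normX; apply: measurable_funD.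
- exact: measurable_funeM.
- by rewrite -EFinD -EFinM lee_fin normXD.
Qed.

Lemma momentZ p (c : R) (f : T -> R) : measurable_fun setT f ->
  (moment p (fun x => c * f x)%R = (`|c| ^+ p)%:E * moment p f)%E.
Proof.
move=> mf; rewrite /moment -(ge0_integralZl mu mD (@measurable_normX p f D mf) (@normX_ge0 p f)).
  by apply: eq_integral => x _; rewrite normrM exprMn.
by rewrite lee_fin exprn_ge0.
Qed.

Hypothesis muD : (mu D < +oo)%E.

Lemma moment_integrable p (f : T -> R) : measurable_fun setT f -> (moment p.+1 f < +oo)%E ->
  mu.-integrable D (EFin \o f).
Proof.
move=> mf fp; apply: (@le_integrable _ _ _ mu D mD _ (fun x => 1 + (`|f x| ^+ p.+1)%:E)%E).
- by apply/measurable_EFinP; apply: measurable_funTS.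
- move=> x _ /=; rewrite lee_fin [leRHS]ger0_norm ?addr_ge0 ?exprn_ge0//.
  have [f1|f1] := leP `|f x| 1; first by rewrite (le_trans f1)// lerDl exprn_ge0.
  by rewrite -[leLHS]add0r lerD// exprS ler_peMr// exprn_ege1// ltW.
- apply: integrableD => //.
    by apply/integrableP; split => //; under eq_integral do rewrite abse1; rewrite integral_cst// mul1e.
  apply/integrableP; split; first exact: measurable_normX.
  rewrite (le_lt_trans _ fp)// /moment le_eqVlt; apply/orP; left; apply/eqP.
  by apply: eq_integral => x _; rewrite gee0_abs// lee_fin exprn_ge0.
Qed.

Lemma moment_bounded p (f : T -> R) M : (forall x, D x -> `|f x| <= M) -> measurable_fun setT f ->
  (moment p f < +oo)%E.
Proof.
move=> fM mf; apply: (@le_lt_trans _ _ (\int[mu]_(x in D) (cst (M ^+ p)%:E x))%E).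
  apply: (ge0_le_integral mu mD) => [x _|||x /fM h] //.
  - exact: measurable_normX.
  - by rewrite lee_fin lerXn2r// ?nnegrE// (le_trans _ h).
by rewrite integral_cst// ltey_eq fin_numM// ge0_fin_numE.
Qed.

End moments.

(** * Contraction in L^p and convergence of averages *)

Section markov_operator.
Context d (T : measurableType d) (R : realType) (mu : {sigma_finite_measure set T -> \bar R}).
Variables (D : set T) (mD : measurable D) (muD : (mu D < +oo)%E).

(** The marginal in [y] makes [mop] an average, to which Jensen's inequality applies; the marginal
    in [x] makes it preserve integrals. Boundedness keeps [k (x, y) * f y] integrable for every
    integrable [f]. *)
Definition doubly_markov (k : T * T -> R) : Prop :=
  [/\ measurable_fun setT k, (forall z, 0 <= k z), (exists B, forall z, k z <= B),
      (forall x, \int[mu]_(y in D) (k (x, y))%:E = 1)%E &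
      (forall y, \int[mu]_(x in D) (k (x, y))%:E = 1)%E].

Definition mop (k : T * T -> R) (f : T -> R) (x : T) : R :=
  \int[mu]_(y in D) (k (x, y) * f y).

Section one_kernel.
Variables (k : T * T -> R) (kM : doubly_markov k).

Let mk1 x : measurable_fun setT (fun y => k (x, y)).
Proof. by case: kM => mk _ _ _ _; exact: measurableT_comp. Qed.

Lemma integrable_mop (f : T -> R) x : measurable_fun setT f ->
  mu.-integrable D (EFin \o f) -> mu.-integrable D (EFin \o (fun y => k (x, y) * f y)).
Proof.
case: (kM) => mk k0 [B kB] _ _ mf fi.
apply: (@le_integrable _ _ _ mu D mD _ (fun y => B%:E * (EFin \o f) y)%E).
- by apply/measurable_EFinP; apply: measurable_funTS; apply: measurable_funM.
- move=> y _ /=; rewrite lee_fin !normrM ler_wpM2r// ger0_norm//.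
  by apply: le_trans (kB (x, y)) _; apply: ler_norm.
- exact: integrableZl.
Qed.

Lemma measurable_mop (f : T -> R) : measurable_fun setT f -> measurable_fun setT (mop k f).
Proof.
case: (kM) => mk _ _ _ _ mf.
apply: (@measurable_Rintegral _ _ T T R mu D mD (fun z => k z * f z.2)).
by apply: measurable_funM => //; apply: measurableT_comp.
Qed.

Lemma mopD (f g : T -> R) : measurable_fun setT f -> measurable_fun setT g ->
  mu.-integrable D (EFin \o f) -> mu.-integrable D (EFin \o g) ->
  mop k (fun x => f x + g x) = (fun x => mop k f x + mop k g x).
Proof.
move=> mf mg fi gi; apply/funext => x; rewrite /mop -RintegralD//; try exact: integrable_mop.
by apply: eq_Rintegral => y _; rewrite mulrDr.
Qed.

Lemma mopZ c (f : T -> R) : measurable_fun setT f -> mu.-integrable D (EFin \o f) ->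
  mop k (fun x => c * f x) = (fun x => c * mop k f x).
Proof.
move=> mf fi; apply/funext => x; rewrite /mop -RintegralZl//; last exact: integrable_mop.
by apply: eq_Rintegral => y _; rewrite mulrCA.
Qed.

Lemma mop_cst c : mop k (fun=> c) = (fun=> c).
Proof.
case: (kM) => mk k0 _ k1 _; apply/funext => x; rewrite /mop.
have ki : mu.-integrable D (EFin \o (fun y => k (x, y))).
  apply/integrableP; split; first by apply/measurable_EFinP; apply: measurable_funTS.
  rewrite (_ : \int[mu]_(y in D) _ = 1)%E ?ltry// -[RHS](k1 x).
  by apply: eq_integral => y _ /=; rewrite ger0_norm.
by rewrite RintegralZr// /Rintegral k1 mul1r.
Qed.

(** The power function lies above its tangent at [m]. In the induction step the defect is
    [(p + 1) m^p (m - s)^2]. *)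
Lemma exprS_tangent p (m s : R) : 0 <= m -> 0 <= s ->
  p.+1%:R * m ^+ p * s - p%:R * m ^+ p.+1 <= s ^+ p.+1.
Proof.
move=> m0 s0; elim: p => [|p IH]; first by rewrite expr0 mulr1 mul1r mul0r subr0.
have := ler_wpM2r s0 IH; rewrite -exprSr; apply: le_trans.
rewrite -subr_ge0 -![in X in _ <= X]natr1 [X in _ <= X](_ : _ = p.+1%:R * m ^+ p * (m - s) ^+ 2).
  by rewrite mulr_ge0 ?sqr_ge0// mulr_ge0// exprn_ge0.
by rewrite -natr1 !exprS; ring.
Qed.

(** The tangent inequality at [m], the average of [|f|] against [k (x, .)], is integrated against
    the kernel; the linear terms combine to [m ^+ p.+1]. *)
Lemma mop_jensen p (f : T -> R) x : measurable_fun setT f -> (moment mu D p.+1 f < +oo)%E ->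
  ((`|mop k f x| ^+ p.+1)%:E <= \int[mu]_(y in D) (k (x, y) * `|f y| ^+ p.+1)%:E)%E.
Proof.
case: (kM) => mk k0 [B kB] k1 _ mf fp.
have fi := moment_integrable mD muD mf fp.
have mfa : measurable_fun setT (fun y => `|f y|) by exact: measurableT_comp.
have mfX : measurable_fun setT (fun y => `|f y| ^+ p.+1) by exact: measurable_funX.
have fai : mu.-integrable D (EFin \o (fun y => `|f y|)).
  by have := integrable_abse fi; congr (_.-integrable _ _).
have fXi : mu.-integrable D (EFin \o (fun y => `|f y| ^+ p.+1)).
  apply/integrableP; split; first by apply/measurable_EFinP; apply: measurable_funTS.
  rewrite (le_lt_trans _ fp)// /moment le_eqVlt; apply/orP; left; apply/eqP.
  by apply: eq_integral => y _ /=; rewrite ger0_norm// exprn_ge0.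
have ki := integrable_mop x mf fi.
pose m := \int[mu]_(y in D) (k (x, y) * `|f y|).
have m0 : 0 <= m by apply: Rintegral_ge0 => y _; rewrite mulr_ge0.
have lem : `|mop k f x| <= m.
  apply: le_trans (le_normr_Rintegral mD ki) _.
  by rewrite le_eqVlt; apply/orP; left; apply/eqP; apply: eq_Rintegral => y _; rewrite normrM ger0_norm.
have kXi := integrable_mop x mfX fXi.
have -> : (\int[mu]_(y in D) (k (x, y) * `|f y| ^+ p.+1)%:E =
   (\int[mu]_(y in D) (k (x, y) * `|f y| ^+ p.+1))%:E)%E.
  by rewrite /Rintegral fineK//; exact: integrable_fin_num kXi.
rewrite lee_fin; apply: (@le_trans _ _ (m ^+ p.+1)); first by rewrite lerXn2r ?nnegrE.
have kki : mu.-integrable D (EFin \o (fun y => k (x, y))).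
  apply/integrableP; split; first by apply/measurable_EFinP; apply: measurable_funTS.
  rewrite (_ : \int[mu]_(y in D) _ = 1)%E ?ltry// -[RHS](k1 x).
  by apply: eq_integral => y _ /=; rewrite ger0_norm.
have kai := integrable_mop x mfa fai.
have i1 : mu.-integrable D (EFin \o (fun y => (p.+1%:R * m ^+ p) * (k (x, y) * `|f y|))).
  by have := integrableZl mD (p.+1%:R * m ^+ p) kai; congr (_.-integrable _ _).
have i2 : mu.-integrable D (EFin \o (fun y => (p%:R * m ^+ p.+1) * k (x, y))).
  by have := integrableZl mD (p%:R * m ^+ p.+1) kki; congr (_.-integrable _ _).
have i3 : mu.-integrable D (EFin \o (fun y => (p.+1%:R * m ^+ p) * (k (x, y) * `|f y|) -
    (p%:R * m ^+ p.+1) * k (x, y))).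
  by have := integrableB mD i1 i2; congr (_.-integrable _ _).
apply: (@le_trans _ _ (\int[mu]_(y in D) ((p.+1%:R * m ^+ p) * (k (x, y) * `|f y|) -
    (p%:R * m ^+ p.+1) * k (x, y)))); last first.
  apply: le_Rintegral => // y _.
  have := ler_wpM2l (k0 (x, y)) (exprS_tangent p m0 (normr_ge0 (f y))).
  by apply: le_trans; rewrite le_eqVlt; apply/orP; left; apply/eqP; ring.
rewrite RintegralB// RintegralZl// RintegralZl// -/m /Rintegral k1 /=.
by rewrite le_eqVlt; apply/orP; left; apply/eqP; rewrite -natr1 exprS; ring.
Qed.

Lemma moment_mop p (f : T -> R) : measurable_fun setT f ->
  (moment mu D p.+1 (mop k f) <= moment mu D p.+1 f)%E.
Proof.
move=> mf; case: (ltP (moment mu D p.+1 f) +oo%E) => [fp|]; last first.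
  by rewrite leye_eq => /eqP ->; rewrite leey.
case: (kM) => mk k0 _ _ k2.
have mkf : measurable_fun setT (fun z : T * T => (k z * `|f z.2| ^+ p.+1)%:E).
  apply/measurable_EFinP; apply: measurable_funM => //; apply: measurable_funX.
  by do 2 apply: measurableT_comp => //.
have kf0 (z : T * T) : (0 <= (k z * `|f z.2| ^+ p.+1)%:E)%E.
  by rewrite lee_fin mulr_ge0// exprn_ge0.
apply: (@le_trans _ _ (\int[mu]_(x in D) \int[mu]_(y in D) (k (x, y) * `|f y| ^+ p.+1)%:E)%E).
  apply: (ge0_le_integral mu mD) => [x _|||x _].
  - by rewrite lee_fin exprn_ge0.
  - exact/measurable_normX/measurable_mop.
  - by apply: measurable_funTS; apply: (measurable_integral_ge0 mu mD mkf kf0).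
  - exact: mop_jensen.
rewrite (tonelli_on mu mu mD mD mkf kf0) /moment le_eqVlt; apply/orP; left; apply/eqP.
apply: eq_integral => y _ /=.
under eq_integral do rewrite EFinM.
rewrite ge0_integralZr//.
- by rewrite k2 mul1e.
- by apply/measurable_EFinP; apply: measurable_funTS; exact: measurableT_comp.
- by move=> x _; rewrite lee_fin.
Qed.

(** Averages preserve positivity and constants; both facts are applied to [M + f] and [M - f]. *)
Lemma mop_le_bound (f : T -> R) (M : R) x : measurable_fun setT f ->
  (forall y, `|f y| <= M) -> `|mop k f x| <= M.
Proof.
case: (kM) => mk k0 _ _ _ mf fM.
have fi : mu.-integrable D (EFin \o f).
  by apply: (moment_integrable (p := 0) mD muD mf); exact: (moment_bounded mD muD 1 (fun x _ => fM x)).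
have mcst (c : R) : measurable_fun setT (fun=> c : R) (T := T) by exact: measurable_cst.
have ci (c : R) : mu.-integrable D (EFin \o (fun=> c) : T -> \bar R).
  apply: (moment_integrable (p := 0) mD muD (mcst c)).
  exact: (moment_bounded mD muD 1 (M := `|c|)).
have nfi : mu.-integrable D (EFin \o (fun x => -1 * f x)).
  by have := integrableZl mD (-1) fi; congr (_.-integrable _ _).
have mnf : measurable_fun setT (fun x => -1 * f x) by exact: measurable_funM.
rewrite ler_norml; apply/andP; split.
  have : 0 <= mop k (fun x => M + f x) x.
    apply: Rintegral_ge0 => y _; rewrite mulr_ge0// -lerBlDl sub0r.
    by have := fM y; rewrite ler_norml => /andP[].
  by rewrite mopD// mop_cst -lerBlDl sub0r.
have : 0 <= mop k (fun x => M + -1 * f x) x.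
  apply: Rintegral_ge0 => y _; rewrite mulr_ge0// mulN1r subr_ge0.
  by have := fM y; rewrite ler_norml => /andP[].
by rewrite mopD// mop_cst mopZ// mulN1r subr_ge0.
Qed.

End one_kernel.

Section approximation.
Variables (k : nat -> T * T -> R) (kM : forall n, doubly_markov (k n)).

Definition approx p (f : T -> R) : Prop :=
  vanish (fun n => moment mu D p (fun x => mop (k n) f x - f x)).

Lemma approxD p (f g : T -> R) : measurable_fun setT f -> measurable_fun setT g ->
  mu.-integrable D (EFin \o f) -> mu.-integrable D (EFin \o g) ->
  approx p f -> approx p g -> approx p (fun x => f x + g x).
Proof.
move=> mf mg fi gi hf hg.
apply: (@vanish_le _ _ (fun n => (2 ^+ p)%:E * (moment mu D p (fun x => mop (k n) f x - f x)%R +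
   moment mu D p (fun x => mop (k n) g x - g x)%R))%E); last first.
  by apply: vanishZ; [rewrite exprn_ge0|exact: vanishD].
move=> n; rewrite mopD//.
rewrite (_ : (fun x => _) = (fun x => (mop (k n) f x - f x) + (mop (k n) g x - g x))); last first.
  by apply/funext => x; ring.
by apply: momentD => //; apply: measurable_funB => //; exact: measurable_mop.
Qed.

Lemma approxZ p c (f : T -> R) : measurable_fun setT f ->
  mu.-integrable D (EFin \o f) -> approx p f -> approx p (fun x => c * f x).
Proof.
move=> mf fi hf.
apply: (@vanish_le _ _ (fun n => (`|c| ^+ p)%:E * moment mu D p (fun x => mop (k n)
  f x - f x)%R)%E); last first.
  by apply: vanishZ => //; rewrite exprn_ge0.
move=> n; rewrite -(momentZ mu mD); last by apply: measurable_funB => //; exact: measurable_mop.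
rewrite mopZ// le_eqVlt; apply/orP; left; apply/eqP; congr moment.
by apply/funext => x; rewrite mulrBr.
Qed.

Lemma approx_cst p c : approx p.+1 (fun=> c).
Proof.
move=> e e0; near=> n; rewrite mop_cst// /moment.
under eq_integral do rewrite subrr normr0 expr0n.
by rewrite integral0 lee_fin ltW.
Unshelve. all: by end_near. Qed.

(** Decompose [mop f - f] as [mop (f - g) + (mop g - g) - (f - g)]; the first term is controlled by
    the contraction [moment_mop], uniformly in [n]. *)
Lemma approx_limit p (f : T -> R) : measurable_fun setT f -> mu.-integrable D (EFin \o f) ->
  (forall e, 0 < e -> exists g, [/\ measurable_fun setT g, mu.-integrable D (EFin \o g),
     approx p.+1 g & (moment mu D p.+1 (fun x => f x - g x)%R <= e%:E)%E]) ->
  approx p.+1 f.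
Proof.
move=> mf fi H e e0.
pose c : R := 2 ^+ p.+1.
have c0 : 0 < c by rewrite exprn_gt0.
(* Solves [c (e1 + c (e1 + e1)) = e], the total after two uses of [momentD] with constant [c]. *)
pose e1 := e / (c + c * (c + c)).
have e10 : 0 < e1 by rewrite divr_gt0// addr_gt0// mulr_gt0// addr_gt0.
have [g [mg gi ga fg]] := H _ e10.
have mfg : measurable_fun setT (fun x => f x - g x) by exact: measurable_funB.
have mgf : measurable_fun setT (fun x => -1 * (f x - g x)) by exact: measurable_funM.
have fgi : mu.-integrable D (EFin \o (fun x => f x - g x)).
  by have := integrableB mD fi gi; congr (_.-integrable _ _).
near=> n.
have gn : (moment mu D p.+1 (fun x => mop (k n) g x - g x)%R <= e1%:E)%E by near: n; exact: ga.
have mm h : measurable_fun setT h -> measurable_fun setT (mop (k n) h) by exact: measurable_mop.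
have E : (fun x => mop (k n) f x - f x) =
   (fun x => mop (k n) (fun x => f x - g x) x + ((mop (k n) g x - g x) + -1 * (f x - g x))).
  apply/funext => x.
  have -> : mop (k n) f x = mop (k n) (fun x => (f x - g x) + g x) x.
    by congr (mop _ _ x); apply/funext => y; rewrite subrK.
  by rewrite mopD//; ring.
rewrite E; apply: le_trans (momentD mu mD p.+1 (f := mop (k n) (fun x => f x - g x)) _ _) _.
- exact: mm.
- by apply: measurable_funD => //; apply: measurable_funB => //; exact: mm.
rewrite -/c.
apply: (@le_trans _ _ (c%:E * (e1%:E + c%:E * (e1%:E + e1%:E)))%E); last first.
  rewrite -[leLHS]/((c * (e1 + c * (e1 + e1)))%:E) lee_fin le_eqVlt; apply/orP; left; apply/eqP.
  by rewrite /e1; field; rewrite gt_eqF// addr_gt0// mulr_gt0// addr_gt0.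
apply: lee_wpmul2l; first by rewrite lee_fin ltW.
apply: leeD; first by apply: le_trans fg; apply: (moment_mop (kM n)).
apply: le_trans (momentD mu mD p.+1 (f := fun x => mop (k n) g x - g x) _ mgf) _.
- by apply: measurable_funB => //; exact: mm.
apply: lee_wpmul2l; first by rewrite lee_fin ltW.
apply: leeD => //.
by rewrite (momentZ mu mD _ _ mfg) normrN1 expr1n mul1e.
Unshelve. all: by end_near. Qed.

Let bint (f : T -> R) (M : R) : measurable_fun setT f -> (forall x, `|f x| <= M) ->
  mu.-integrable D (EFin \o f).
Proof.
move=> mf fM; apply: (moment_integrable (p := 0) mD muD mf).
exact: (moment_bounded mD muD 1 (fun x _ => fM x)).
Qed.

Lemma indic_norm_le1 (A : set T) x : `|\1_A x| <= 1 :> R.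
Proof. by rewrite indicE; case: (_ \in _); rewrite ?normr1 ?normr0. Qed.

Let mind (A : set T) : measurable A -> measurable_fun setT (\1_A : T -> R).
Proof. by move=> mA; exact: measurable_indic. Qed.

Let indint (A : set T) : measurable A -> mu.-integrable D (EFin \o (\1_A : T -> R)).
Proof. by move=> mA; apply: (@bint _ 1); [exact: mind|exact: indic_norm_le1]. Qed.

Lemma approx_sum p (I : Type) (s : seq I) (F : I -> T -> R) (M : I -> R) :
  (forall i, measurable_fun setT (F i)) -> (forall i x, `|F i x| <= M i) ->
  (forall i, approx p.+1 (F i)) -> approx p.+1 (fun x => \sum_(i <- s) F i x).
Proof.
move=> mF FM aF; elim: s => [|i s IH].
  by under eq_fun do rewrite big_nil; exact: approx_cst.
under eq_fun do rewrite big_cons.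
apply: approxD => //; first exact: measurable_sum.
  exact: (bint (mF i) (FM i)).
apply: (@bint _ (\sum_(j <- s) M j)); first exact: measurable_sum.
by move=> x; apply: le_trans (ler_norm_sum _ _ _) _; apply: ler_sum.
Qed.

Section generated.
Variable G : set (set T).
Hypotheses (mG : @measurable _ T = <<s G >>) (GI : setI_closed G).
Hypothesis GA : forall A, G A -> approx 1 (\1_A).

(** Dynkin's pi-lambda theorem: complements come from linearity, and a disjoint union is the L^1
    limit of its finite partial sums by dominated convergence. *)
Lemma approx_indic A : measurable A -> approx 1 (\1_A).
Proof.
move=> mA; apply: (@dynkin_induction _ T G (fun A => approx 1 (\1_A)) mG GI) => //.
- by rewrite indicT; exact: approx_cst.
- move=> S mS aS; rewrite (_ : \1_(~` S) = fun x => 1 + -1 * \1_S x); last first.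
    apply/funext => x; rewrite !indicE in_setC; case: (_ \in _) => /=; ring.
  have m1 : measurable_fun setT (fun x => -1 * \1_S x : R) by apply: measurable_funM => //; exact: mind.
  have mc : measurable_fun setT (fun _ : T => 1 : R) by exact: measurable_cst.
  apply: approxD => //.
  + by apply: (@bint _ 1) => // x; rewrite normr1.
  + by apply: (@bint _ 1) => // x; rewrite mulN1r normrN indic_norm_le1.
  + exact: approx_cst.
  + by apply: approxZ; [exact: mind|exact: indint|exact: aS].
- move=> F mF tF aF.
  have mU : measurable (\bigcup_k F k) by exact: bigcupT_measurable.
  apply: approx_limit; [exact: mind|exact: indint|] => e e0.
  pose s N x : R := \sum_(i < N) \1_(F i) x.
  have ms N : measurable_fun setT (s N) by apply: measurable_sum => i; exact: mind.
  have sb N x : `|s N x| <= N%:R.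
    apply: le_trans (ler_norm_sum _ _ _) _; apply:
      le_trans (ler_sum _ (fun i _ => indic_norm_le1 _ _)) _.
    by rewrite sumr_const card_ord.
  have sE N x : s N x = (x \in \bigcup_(i < N) F i)%:R.
    rewrite /s; case: (boolP (x \in _)) => [|xN].
      rewrite inE => -[i /= iN Fix].
      rewrite (bigD1 (Ordinal iN))//= indicE mem_set// big1 ?addr0// => j ji.
      rewrite indicE memNset// => Fjx; move/eqP: ji; apply; apply/val_inj => /=.
      by apply: (tF j i) => //; exists x.
    rewrite big1// => i _; rewrite indicE memNset// => Fix.
    by move/negP: xN; apply; rewrite inE; exists i => /=.
  have : vanish (fun N => moment mu D 1 (fun x => \1_(\bigcup_k F k) x - s N x)%R).
    apply: cvg_vanish.
    have [] := @dominated_convergence _ T R mu D mD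
      (fun N x => (`|\1_(\bigcup_k F k) x - s N x| ^+ 1)%:E) (fun=> 0%E) (fun=> 2%:E).
    - by move=> N; apply: measurable_normX; apply: measurable_funB => //; exact: mind.
    - exact: measurable_cst.
    - apply: aeW => x _; apply: cvg_near_cst.
      case: (pselect ((\bigcup_k F k) x)) => [[i _ Fix]|nx].
        exists i.+1 => // N /= iN; rewrite sE indicE !mem_set//.
        + by rewrite subrr normr0.
        + by exists i.
        + by exists i.
      near=> N; rewrite sE indicE !memNset ?subrr ?normr0//.
      by move=> [i _ Fix]; apply: nx; exists i.
    - by apply: (@bint (fun=> 2) 2) => // x; rewrite ger0_norm.
    - apply: aeW => x N _; rewrite gee0_abs ?lee_fin ?exprn_ge0// expr1.
      rewrite (le_trans (ler_normB _ _))// (_ : 2 = 1 + 1)// lerD ?indic_norm_le1//.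
      by rewrite sE; case: (_ \in _); rewrite ?normr1 ?normr0.
    by move=> _ _; rewrite integral0.
  move=> /(_ e e0) [N _ /(_ N (leqnn N)) hN].
  exists (s N); split => //.
  + exact: (bint (ms N) (sb N)).
  + apply: (@approx_sum 0 _ (index_enum _) (fun i : 'I_N => \1_(F i)) (fun=> 1)) => //.
    by move=> i x; exact: indic_norm_le1.
- by rewrite -mG.
Unshelve. all: by end_near. Qed.

(** The sum counts the integers from 1 to [m] that are at most [y]: the integer part of [y], capped
    at [m]. *)
Lemma layer_count (m : nat) (y : R) : 0 <= y ->
  [/\ \sum_(i < m) (i.+1%:R <= y)%R%:R <= y, \sum_(i < m) (i.+1%:R <= y)%R%:R <= m%:R :> R &
      Num.min m%:R (y - 1) <= \sum_(i < m) (i.+1%:R <= y)%R%:R].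
Proof.
move=> y0; elim: m => [|m [h1 h2 h3]].
  by rewrite big_ord0; split => //; rewrite ge_min lexx.
rewrite big_ord_recr /=; case: (leP m.+1%:R y) => my.
  have h3' : m%:R <= \sum_(i < m) (i.+1%:R <= y)%R%:R :> R.
    by apply: le_trans h3; rewrite le_min lexx lerBrDr natr1.
  split.
  - by apply: le_trans my; rewrite -natr1 lerD2r.
  - by rewrite -natr1 lerD2r.
  - by rewrite ge_min -natr1 lerD2r h3'.
rewrite addr0; split => //; first by apply: le_trans h2 _; rewrite ler_nat.
apply: le_trans h3; rewrite le_min !ge_min lexx orbT andbT.
by rewrite lerBlDr natr1 (ltW my) orbT.
Qed.

(** The layer sum [m.+1^-1] times the number of levels [i.+1 / m.+1] that [g] reaches is within
    [m.+1^-1] of [g] everywhere, and it is a combination of indicators. *)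
Lemma approx_unit (g : T -> R) : measurable_fun setT g -> (forall x, 0 <= g x <= 1) -> approx 1 g.
Proof.
move=> mg g01.
have gb x : `|g x| <= 1 by have /andP[g0 g1] := g01 x; rewrite ger0_norm.
apply: approx_limit => //; first exact: (bint mg gb).
move=> e e0.
have [m me] : exists m : nat, fine (mu D) <= e * m.+1%:R.
  exists (Num.bound (fine (mu D) / e)).
  rewrite mulrC -ler_pdivrMr//.
  have h : 0 <= fine (mu D) / e by rewrite divr_ge0 ?fine_ge0// ltW.
  by apply: le_trans (ltW (archi_boundP h)) _; rewrite ler_nat.
pose A (i : 'I_m.+1) := [set x | i.+1%:R <= m.+1%:R * g x].
have mA i : measurable (A i).
  rewrite (_ : A i = (fun x => m.+1%:R * g x) @^-1` `[i.+1%:R, +oo[).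
    rewrite -[X in measurable X]setTI; apply: (measurable_funM _ _ _) => //.
  by apply/seteqP; split => x /=; rewrite in_itv /= andbT.
pose s x : R := m.+1%:R^-1 * \sum_(i < m.+1) \1_(A i) x.
have ms : measurable_fun setT s.
  by apply: measurable_funM => //; apply: measurable_sum => i; exact: mind.
have sE x : s x = m.+1%:R^-1 * \sum_(i < m.+1) (i.+1%:R <= m.+1%:R * g x)%R%:R.
  rewrite /s; congr (_ * _); apply: eq_bigr => i _; rewrite indicE; congr ((nat_of_bool _)%:R).
  by apply/idP/idP; rewrite inE.
have gs x : `|g x - s x| <= m.+1%:R^-1.
  have /andP[g0 g1] := g01 x.
  have y0 : 0 <= m.+1%:R * g x by rewrite mulr_ge0.
  have [h1 _ h3] := layer_count m.+1 y0.
  have m0 : 0 < m.+1%:R :> R by rewrite ltr0n.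
  have -> : g x - s x = m.+1%:R^-1 * (m.+1%:R * g x - \sum_(i < m.+1) (i.+1%:R <= m.+1%:R * g x)%R%:R).
    by rewrite sE mulrBr mulrA mulVf ?mul1r// gt_eqF.
  rewrite normrM gtr0_norm ?invr_gt0// ler_piMr ?invr_ge0 ?(ltW m0)//.
  rewrite ger0_norm ?subr_ge0// lerBlDr.
  have := h3; rewrite (_ : Num.min _ _ = m.+1%:R * g x - 1); first by rewrite lerBlDl.
  apply/min_idPr; rewrite lerBlDr (@le_trans _ _ (m.+1%:R))// ?lerDl//.
  by rewrite ler_piMr// ltW.
have sb x : `|s x| <= 2.
  have -> : s x = g x - (g x - s x) by ring.
  apply: le_trans (ler_normB _ _) _; rewrite (_ : 2 = 1 + 1)// lerD// (le_trans (gs x))//.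
  by rewrite invf_le1// ler1n.
exists s; split => //.
- exact: (bint ms sb).
- apply: approxZ.
  + by apply: measurable_sum => i; exact: mind.
  + apply: (@bint _ (\sum_(i < m.+1) 1)); first by apply: measurable_sum => i; exact: mind.
    move=> x; apply: le_trans (ler_norm_sum _ _ _) _; apply: ler_sum => i _; exact: indic_norm_le1.
  + apply: (@approx_sum 0 _ (index_enum _) (fun i : 'I_m.+1 => \1_(A i)) (fun=> 1)).
    * by move=> i; exact: mind.
    * by move=> i x; exact: indic_norm_le1.
    * by move=> i; exact: approx_indic.
- apply: (@le_trans _ _ (\int[mu]_(x in D) (cst (m.+1%:R^-1)%:E x))%E).
    apply: (ge0_le_integral mu mD) => [x _|||x _].
    + by rewrite lee_fin exprn_ge0.
    + by apply: measurable_normX; exact: measurable_funB.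
    + exact: measurable_cst.
    + by rewrite lee_fin expr1.
  have muf : mu D \is a fin_num by rewrite ge0_fin_numE.
  rewrite integral_cst//= -[X in (_ * X)%E](fineK muf).
  by rewrite -EFinM lee_fin mulrC ler_pdivrMr// ltr0n.
Qed.

(** An affine change of values reduces exponent 1 to [approx_unit]. Higher exponents follow, as
    [|mop f - f| <= 2 M] bounds the extra powers. *)
Lemma approx_bounded p (f : T -> R) (M : R) : measurable_fun setT f -> (forall x, `|f x| <= M) ->
  approx p.+1 f.
Proof.
move=> mf fM.
wlog M0 : M fM / 0 < M.
  move=> H; apply: (H (`|M| + 1)); last by rewrite ltr_wpDl.
  by move=> x; apply: le_trans (fM x) _; rewrite (le_trans (ler_norm _))// lerDl.
have a1 : approx 1 f.
  pose g x := (2 * M)^-1 * (f x + M).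
  have mg : measurable_fun setT g by apply: measurable_funM => //; exact: measurable_funD.
  have g01 x : 0 <= g x <= 1.
    have := fM x; rewrite ler_norml => /andP[f1 f2]; apply/andP; split.
      by rewrite mulr_ge0 ?invr_ge0 ?mulr_ge0 ?(ltW M0)// -lerBlDr sub0r.
    by rewrite /g mulrC ler_pdivrMr ?mulr_gt0// mul1r mulr2n mulrDl mul1r lerD2r.
  rewrite (_ : f = fun x => (2 * M) * g x + - M); last first.
    by apply/funext => x; rewrite /g mulrA divff ?mul1r ?addrK// gt_eqF// mulr_gt0.
  have gb x : `|g x| <= 1 by have /andP[g0 g1] := g01 x; rewrite ger0_norm.
  have m2g : measurable_fun setT (fun x => 2 * M * g x) by exact: measurable_funM.
  apply: approxD => //.
  - apply: (@bint _ (2 * M)) => // x; rewrite normrM ger0_norm ?mulr_ge0 ?(ltW M0)//.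
    by rewrite ler_piMr// mulr_ge0// ltW.
  - by apply: (@bint _ M) => // x; rewrite normrN gtr0_norm.
  - by apply: approxZ => //; [exact: (bint mg gb)|exact: approx_unit].
  - exact: approx_cst.
apply: (@vanish_le _ _ (fun n => ((2 * M) ^+ p)%:E * moment mu D 1 (fun x => mop (k n)
  f x - f x)%R)%E); last first.
  by apply: vanishZ => //; rewrite exprn_ge0// mulr_ge0// ltW.
move=> n; have md : measurable_fun setT (fun x => mop (k n) f x - f x).
  by apply: measurable_funB => //; exact: measurable_mop.
rewrite /moment -ge0_integralZl//; last 2 first.
- exact: measurable_normX.
- by rewrite lee_fin exprn_ge0// mulr_ge0// ltW.
apply: (ge0_le_integral mu mD) => [x _|||x _].
- by rewrite lee_fin exprn_ge0.
- exact: measurable_normX.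
- by apply: measurable_funeM; exact: measurable_normX.
- rewrite -EFinM lee_fin expr1 exprSr ler_wpM2r//.
  apply: lerXn2r; rewrite ?nnegrE ?mulr_ge0// ?(ltW M0)//.
  apply: le_trans (ler_normB _ _) _; rewrite mulr2n mulrDl mul1r lerD//.
  exact: mop_le_bound.
Qed.

(** The truncations of [f] at height [M] converge to [f] in the moment of order [p + 1] by dominated
    convergence, and [approx_limit] transfers the bounded case. *)
Theorem approx_Lp p (f : T -> R) : measurable_fun setT f -> (moment mu D p.+1 f < +oo)%E ->
  approx p.+1 f.
Proof.
move=> mf fp; have fi := moment_integrable mD muD mf fp.
apply: approx_limit => // e e0.
pose t (M : nat) x := Num.max (- M%:R) (Num.min (f x) M%:R).
have mt M : measurable_fun setT (t M).
  by apply: measurable_maxr => //; apply: measurable_minr.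
have tb M x : `|t M x| <= M%:R.
  by rewrite ler_norml /t le_max lexx /= ge_max ge_min lexx orbT andbT (@le_trans _ _ 0)// oppr_le0.
have ft M x : `|f x - t M x| <= `|f x|.
  rewrite /t; have M0 : 0 <= M%:R :> R by [].
  case: (leP (f x) M%:R) => h1; case: (leP (- M%:R) _) => h2 //.
  - by rewrite subrr normr0.
  - have f0 : f x <= 0 by rewrite (le_trans (ltW h2))// oppr_le0.
    rewrite opprK [in leRHS]ler0_norm// ler0_norm; last by rewrite -lerBrDr sub0r ltW.
    by rewrite opprD gerDl oppr_le0.
  - rewrite ger0_norm ?subr_ge0 ?(ltW h1)// ger0_norm ?gerBl//.
    by rewrite (le_trans M0)// ltW.
  - by move: h2; rewrite ltNge (@le_trans _ _ 0)// oppr_le0.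
have fXi : mu.-integrable D (fun x => (`|f x| ^+ p.+1)%:E).
  apply/integrableP; split; first exact: measurable_normX.
  rewrite (le_lt_trans _ fp)// /moment le_eqVlt; apply/orP; left; apply/eqP.
  by apply: eq_integral => y _ /=; rewrite ger0_norm// exprn_ge0.
have : vanish (fun N => moment mu D p.+1 (fun x => f x - t N x)%R).
  apply: cvg_vanish.
  have [] := @dominated_convergence _ T R mu D mD
    (fun N x => (`|f x - t N x| ^+ p.+1)%:E) (fun=> 0%E) (fun x => (`|f x| ^+ p.+1)%:E).
  - by move=> N; apply: measurable_normX; exact: measurable_funB.
  - exact: measurable_cst.
  - apply: aeW => x _; apply: cvg_near_cst.
    exists (Num.bound `|f x|) => // N /= hN.
    have fN : `|f x| <= N%:R.
      by rewrite (le_trans (ltW (archi_boundP (normr_ge0 _))))// ler_nat.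
    move: fN; rewrite ler_norml => /andP[f1 f2].
    by rewrite /t (min_idPl f2) (max_idPr f1) subrr normr0 expr0n.
  - exact: fXi.
  - apply: aeW => x N _; rewrite gee0_abs ?lee_fin ?exprn_ge0//.
    by apply: lerXn2r; rewrite ?nnegrE.
  by move=> _ _; rewrite integral0.
move=> /(_ e e0) [N _ /(_ N (leqnn N)) hN].
exists (t N); split => //.
- exact: (bint (mt N) (tb N)).
- exact: (@approx_bounded p (t N) N%:R).
Qed.

End generated.
End approximation.
End markov_operator.

(** * The de la Vallee-Poussin kernel on the torus *)

Local Open Scope complex_scope.

(** * Integrals of sines and cosines over the unit interval *)

Section trigonometric_integrals.
Context {R : realType}.
Local Notation leb1 := (@lebesgue_measure R).
Local Notation mR := (measurableTypeR R).

Lemma continuous_integrable01 (f : R -> R) : continuous f ->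
  leb1.-integrable (unit_itv (R := R)) (EFin \o f).
Proof.
move=> cf; apply: continuous_compact_integrable; first exact: segment_compact.
exact: continuous_subspaceT.
Qed.

Lemma Rintegral01_FTC (f F : R -> R) : continuous f ->
  (forall x : R, is_derive x 1 F (f x)) ->
  \int[leb1]_(x in unit_itv (R := R)) f x = F 1 - F 0.
Proof.
move=> cf dF; rewrite /Rintegral /unit_itv.
have cF : continuous F.
  by move=> x; apply: differentiable_continuous; apply/derivable1_diffP; have [] := dF x.
rewrite (@continuous_FTC2 _ f F 0 1)//.
- exact: continuous_subspaceT.
- split => //.
  + by apply: cvg_at_right_filter; exact: cF.
  + by apply: cvg_at_left_filter; exact: cF.
- by move=> x _; rewrite derive1E derive_val.
Qed.

Lemma is_derive_affine (a c x : R) : is_derive x 1 (fun t => a * t + c) a.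
Proof.
have h := is_deriveD (is_deriveM (is_derive_cst a x 1) (is_derive_id x 1)) (is_derive_cst c x 1).
by apply: (is_derive_eq h); rewrite scaler0 !addr0 /= /GRing.scale /= mulr1.
Qed.

Lemma is_derive_cos_affine (a c x : R) :
  is_derive x 1 (fun t => cos (a * t + c)) (- a * sin (a * x + c)).
Proof.
have h := @is_derive1_comp _ cos (fun t => a * t + c) x _ _ (is_derive_cos _) (is_derive_affine a c x).
by apply: (is_derive_eq h); rewrite mulrC mulrN mulNr.
Qed.

Lemma is_derive_sin_affine (a c x : R) :
  is_derive x 1 (fun t => sin (a * t + c)) (a * cos (a * x + c)).
Proof.
have h := @is_derive1_comp _ sin (fun t => a * t + c) x _ _ (is_derive_sin _) (is_derive_affine a c x).
by apply: (is_derive_eq h); rewrite mulrC.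
Qed.

Lemma continuous_cos_affine (a c : R) : continuous (fun t => cos (a * t + c)).
Proof.
move=> x; apply: differentiable_continuous; apply/derivable1_diffP.
by have [] := is_derive_cos_affine a c x.
Qed.

Lemma continuous_mul_cos_affine (b a c : R) : continuous (fun t => b * cos (a * t + c)).
Proof.
move=> t; apply: (@continuousM _ _ (fun=> b) (fun t => cos (a * t + c))); first exact: cst_continuous.
exact: continuous_cos_affine.
Qed.

Lemma continuous_sin_affine (a c : R) : continuous (fun t => sin (a * t + c)).
Proof.
move=> x; apply: differentiable_continuous; apply/derivable1_diffP.
by have [] := is_derive_sin_affine a c x.
Qed.

Lemma Rintegral_cos_affine (a c : R) : a != 0 ->
  \int[leb1]_(t in unit_itv (R := R)) cos (a * t + c) = (sin (a + c) - sin c) / a.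
Proof.
move=> a0.
have dF (x : R) : is_derive x 1 (fun t => sin (a * t + c) * a^-1) (cos (a * x + c)).
  have h := is_deriveM (is_derive_sin_affine a c x) (is_derive_cst (a^-1) x 1).
  by apply: (is_derive_eq h); rewrite scaler0 add0r /= /GRing.scale /= mulrA mulVf// mul1r.
rewrite (Rintegral01_FTC (@continuous_cos_affine a c) dF).
by rewrite mulr1 mulr0 add0r mulrBl.
Qed.

Lemma Rintegral_sin_affine (a c : R) : a != 0 ->
  \int[leb1]_(t in unit_itv (R := R)) sin (a * t + c) = (cos c - cos (a + c)) / a.
Proof.
move=> a0.
have dF (x : R) : is_derive x 1 (fun t => cos (a * t + c) * (- a^-1)) (sin (a * x + c)).
  have h := is_deriveM (is_derive_cos_affine a c x) (is_derive_cst (- a^-1) x 1).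
  by apply: (is_derive_eq h); rewrite scaler0 add0r /= /GRing.scale /= mulrA mulrNN mulVf// mul1r.
rewrite (Rintegral01_FTC (@continuous_sin_affine a c) dF).
by rewrite mulr1 mulr0 add0r; ring.
Qed.

Lemma cos_2pi_nat (n : nat) (x : R) : cos (n%:R * (2 * pi) + x) = cos x.
Proof.
elim: n x => [|n IH] x; first by rewrite mul0r add0r.
rewrite -natr1 mulrDl mul1r -addrA IH.
by rewrite addrC [2 * pi]mulr_natl cosD2pi.
Qed.

Lemma sin_2pi_nat (n : nat) (x : R) : sin (n%:R * (2 * pi) + x) = sin x.
Proof.
elim: n x => [|n IH] x; first by rewrite mul0r add0r.
rewrite -natr1 mulrDl mul1r -addrA IH.
by rewrite addrC [2 * pi]mulr_natl sinD2pi.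
Qed.

Lemma cos_2pi_int (m : int) (x : R) : cos (m%:~R * (2 * pi) + x) = cos x.
Proof.
case: m => n; first exact: cos_2pi_nat.
rewrite -(cos_2pi_nat n.+1) NegzE rmorphN /= -pmulrn.
by congr cos; ring.
Qed.

Lemma sin_2pi_int (m : int) (x : R) : sin (m%:~R * (2 * pi) + x) = sin x.
Proof.
case: m => n; first exact: sin_2pi_nat.
rewrite -(sin_2pi_nat n.+1) NegzE rmorphN /= -pmulrn.
by congr sin; ring.
Qed.

Lemma lebesgue_unit_itv : leb1 (unit_itv (R := R)) = 1%E.
Proof. by rewrite lebesgue_measure_itv /= lte_fin ltr01 -EFinB subr0. Qed.

Lemma measurable_unit_itv : measurable (unit_itv (R := R) : set mR).
Proof. exact: measurable_itv. Qed.

Lemma Rintegral01_cst (c : R) : \int[leb1]_(t in unit_itv (R := R)) c = c.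
Proof.
rewrite Rintegral_cst; last exact: measurable_itv.
transitivity (c * fine (1%E : \bar R)); last by rewrite mulr1.
by congr (_ * fine _); exact: lebesgue_unit_itv.
Qed.

Lemma Rintegral_cos_period (m : int) (c : R) :
  \int[leb1]_(t in unit_itv (R := R)) cos ((m%:~R * (2 * pi)) * t + c) = (m == 0)%:R * cos c.
Proof.
have [->|m0] := eqVneq m 0.
  under eq_Rintegral do rewrite !mul0r add0r.
  by rewrite Rintegral01_cst mul1r.
rewrite Rintegral_cos_affine ?sin_2pi_int ?subrr ?mul0r//.
by rewrite mulf_neq0 ?intr_eq0// mulf_neq0// gt_eqF// pi_gt0.
Qed.

Lemma Rintegral_sum d (T : measurableType d) (mu : {measure set T -> \bar R}) (D : set T)
    (I : Type) (s : seq I) (P : pred I) (F : I -> T -> R) : measurable D ->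
  (forall i, P i -> mu.-integrable D (EFin \o F i)) ->
  mu.-integrable D (EFin \o (fun x => \sum_(i <- s | P i) F i x)) /\
  \int[mu]_(x in D) (\sum_(i <- s | P i) F i x) = \sum_(i <- s | P i) \int[mu]_(x in D) F i x.
Proof.
move=> mD iF; elim: s => [|i s [IH1 IH2]].
  rewrite big_nil; split.
    rewrite (_ : _ \o _ = cst 0%E); first exact: integrable0.
    by apply/funext => x /=; rewrite big_nil.
  under eq_Rintegral do rewrite big_nil.
  by rewrite /Rintegral integral0.
rewrite big_cons; case: ifP => Pi.
  have e : (fun x => \sum_(j <- i :: s | P j) F j x) = (fun x => F i x + \sum_(j <- s | P j) F j x).
    by apply/funext => x; rewrite big_cons Pi.
  split.
    by rewrite e; have := integrableD mD (iF _ Pi) IH1; congr (_.-integrable _ _).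
  by rewrite e RintegralD// ?IH2//; exact: iF.
have e : (fun x => \sum_(j <- i :: s | P j) F j x) = (fun x => \sum_(j <- s | P j) F j x).
  by apply/funext => x; rewrite big_cons Pi.
by rewrite e.
Qed.

End trigonometric_integrals.

Section cis.
Context {R : realType}.

Definition cis (t : R) : R[i] := cos t +i* sin t.

Lemma cis0 : cis 0 = 1.
Proof. by rewrite /cis cos0 sin0. Qed.

Lemma cisD a b : cis (a + b) = cis a * cis b.
Proof. by rewrite /cis cosD sinD; simpc; congr (_ +i* _); ring. Qed.

Lemma cisX a n : cis a ^+ n = cis (n%:R * a).
Proof.
elim: n => [|n IH]; first by rewrite expr0 mul0r cis0.
by rewrite exprS IH -cisD -natr1; congr cis; ring.
Qed.

Lemma cis_conj a : (cis a)^* = cis (- a).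
Proof. by rewrite /cis cosN sinN. Qed.

Lemma cis_norm a : cmod (cis a) = 1.
Proof. by rewrite /cmod /cis /= cos2Dsin2 sqrtr1. Qed.

End cis.

Section vallee_poussin.
Context {R : realType}.

Definition vp_coef (n i : nat) : R := 'C(2 * n, i)%:R / 'C(2 * n, n)%:R.

(** Expanding [2 cos (pi t)] as a sum of two exponentials gives a trigonometric polynomial of period
    1 by the binomial formula; the divisor is its constant coefficient, so the mean is 1. The even
    power makes it nonnegative. *)
Definition vp (n : nat) (t : R) : R := (2 * cos (pi * t)) ^+ (2 * n) / 'C(2 * n, n)%:R.

Lemma central_binomial_gt0 n : 0 < 'C(2 * n, n)%:R :> R.
Proof. by rewrite ltr0n bin_gt0 leq_pmull. Qed.

Lemma vp_cis n t : (vp n t)%:C =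
  \sum_(i < (2 * n).+1) (vp_coef n i)%:C * cis ((i%:Z - n%:Z)%:~R * (2 * pi) * t).
Proof.
have e : (2 * cos (pi * t))%:C = cis (- (pi * t)) + cis (pi * t).
  by rewrite /cis cosN sinN; simpc; congr (_ +i* _); ring.
rewrite /vp rmorphM rmorphXn /= e exprDn mulr_suml; apply: eq_bigr => i _.
have i2n : (i <= 2 * n)%N by rewrite -ltnS.
rewrite !cisX -cisD -mulr_natr.
have -> : (vp_coef n i)%:C = 'C(2 * n, i)%:R * ('C(2 * n, n)%:R^-1)%:C.
  by rewrite /vp_coef rmorphM rmorph_nat.
rewrite [RHS]mulrC [RHS]mulrA; congr (_ * _ * _); congr cis.
by rewrite natrB// natrM rmorphB /= -!pmulrn; ring.
Qed.

Lemma vp_cos n t : vp n t =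
  \sum_(i < (2 * n).+1) vp_coef n i * cos ((i%:Z - n%:Z)%:~R * (2 * pi) * t).
Proof.
have := congr1 (@complex.Re R) (vp_cis n t); rewrite /= => ->.
rewrite (@raddf_sum _ _ (@complex.Re R)) /=; apply: eq_bigr => i _.
by rewrite mul0r subr0.
Qed.

Lemma vp_ge0 n t : 0 <= vp n t.
Proof. by rewrite divr_ge0// exprM exprn_ge0// sqr_ge0. Qed.

Lemma continuous_vp n : continuous (vp n).
Proof.
have -> : vp n = fun t => (2 * cos (pi * t + 0)) ^+ (2 * n) / 'C(2 * n, n)%:R.
  by apply/funext => t; rewrite addr0.
move=> t; apply: (@continuousM _ _ (fun t => (2 * cos (pi * t + 0)) ^+ (2 * n)) (fun=> _));
  last exact: cst_continuous.
apply: (@continuous_comp _ _ _ (fun t => 2 * cos (pi * t + 0)) (fun x : R => x ^+ (2 * n)));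
  last exact: exprn_continuous.
by apply: (@continuousM _ _ (fun=> 2) (fun t => cos (pi * t + 0)));
  [exact: cst_continuous|exact: continuous_cos_affine].
Qed.

(** By the recurrence [(n + 1) C(2n + 2, n + 1) = 2 (2n + 1) C(2n, n)]. It keeps the normalisation
    of [vp] from costing more than a factor [2 n + 1]. *)
Lemma le_central_binomial n : (4 ^ n <= (2 * n).+1 * 'C(2 * n, n))%N.
Proof.
elim: n => [|n IH]; first by rewrite bin0.
have e1 : (n.+1 * 'C(2 * n.+1, n.+1) = 2 * (n.+1 * 'C((2 * n).+1, n)))%N.
  rewrite (_ : 2 * n.+1 = (2 * n).+2)%N; last by lia.
  rewrite -(mul_bin_diag (2 * n).+2) /=; lia.
have e2 : (n.+1 * 'C((2 * n).+1, n) = (2 * n).+1 * 'C(2 * n, n))%N.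
  have := mul_bin_down (2 * n).+1 n; rewrite /= => h.
  have -> : (n.+1 = (2 * n).+1 - n)%N by lia.
  by rewrite -h.
rewrite -(leq_pmul2l (ltn0Sn n)).
have -> : (n.+1 * ((2 * n.+1).+1 * 'C(2 * n.+1, n.+1)) = 2 * (2 * n.+1).+1 * ((2 * n).+1 * 'C(2 * n,
  n)))%N.
  by rewrite mulnCA e1 e2; ring.
apply: leq_trans (leq_mul (leqnn _) IH); rewrite expnS mulnA leq_mul2r; apply/orP; right; lia.
Qed.

Lemma vp_le n t (q : R) : cos (pi * t) ^+ 2 <= q -> vp n t <= (2 * n).+1%:R * q ^+ n.
Proof.
move=> hq; rewrite /vp exprMn [X in X * _](_ : _ = 4 ^+ n * (cos (pi * t) ^+ 2) ^+ n); last first.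
  by rewrite -!exprM exprM (_ : 2 ^+ 2 = 4)//; rewrite expr2 -natrM.
rewrite mulrAC; apply: ler_pM.
- by rewrite divr_ge0// exprn_ge0.
- by rewrite exprn_ge0// sqr_ge0.
- rewrite ler_pdivrMr ?central_binomial_gt0// -natrX -natrM ler_nat.
  exact: le_central_binomial.
- by apply: lerXn2r; rewrite ?nnegrE ?sqr_ge0// (le_trans _ hq)// sqr_ge0.
Qed.

Lemma vp_bounded n : exists B, forall t, vp n t <= B.
Proof.
exists ((2 * n).+1%:R * 1 ^+ n) => t; apply: vp_le.
by rewrite -real_normK ?num_real// exprn_ile1// cos_max.
Qed.

(** Monotonicity on the half period puts [cos (pi |t|)] between [cos (pi (1 - de)) = - cos (pi de)]
    and [cos (pi de)]. *)
Lemma cos_sqr_le (de t : R) : 0 < de -> de <= `|t| <= 1 - de ->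
  cos (pi * t) ^+ 2 <= cos (pi * de) ^+ 2.
Proof.
move=> d0 /andP[t1 t2].
have p0 : 0 < pi :> R := pi_gt0 R.
have d2 : de <= 2^-1 by lra.
have le_cos (a b : R) : 0 <= a -> a <= b -> b <= 1 -> cos (pi * b) <= cos (pi * a).
  move=> a0; rewrite le_eqVlt => /orP[/eqP -> //|ab] b1.
  have ipi (u : R) : 0 <= u -> u <= 1 -> pi * u \in `[0, pi]%R.
    by move=> u0 u1; rewrite in_itv /= mulr_ge0 ?(ltW p0)//= ler_piMr// ltW.
  by rewrite ltW// ltr_cos ?ipi ?ltr_pM2l//; lra.
have ct : cos (pi * t) ^+ 2 = cos (pi * `|t|) ^+ 2.
  by rewrite -[pi in RHS]gtr0_norm// -normrM cos_norm.
rewrite ct.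
have h1 : cos (pi * `|t|) <= cos (pi * de) by apply: le_cos; lra.
have h2 : cos (pi * (1 - de)) <= cos (pi * `|t|) by apply: le_cos; lra.
have h3 : cos (pi * (1 - de)) = - cos (pi * de).
  by rewrite mulrBr mulr1 -cosN opprB -[LHS]opprK -cosDpi subrK.
have c0 : 0 <= cos (pi * de) by move: (le_trans h2 h1); rewrite h3; lra.
rewrite -real_normK ?num_real// -[leRHS]real_normK ?num_real//.
apply: lerXn2r; rewrite ?nnegrE// [leRHS]ger0_norm// ler_norml -h3 h2 h1//.
Qed.

Lemma cos_sqr_lt1 (de : R) : 0 < de < 1 -> 0 <= cos (pi * de) ^+ 2 < 1.
Proof.
move=> /andP[d0 d1]; rewrite sqr_ge0 /=.
have p0 : 0 < pi :> R := pi_gt0 R.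
rewrite -(cos2Dsin2 (pi * de)) ltrDl exprn_gt0// sin_gt0_pi// mulr_gt0//=.
by rewrite gtr_pMr.
Qed.

End vallee_poussin.

(** * The kernel on the circle *)

Section circle_kernel.
Context {R : realType}.
Local Notation leb1 := (@lebesgue_measure R).
Local Notation mR := (measurableTypeR R).
Local Notation I01 := (unit_itv (R := R)).

Definition vpk (n : nat) (z : mR * mR) : R := vp n (z.1 - z.2).

Lemma measurable_vp n : measurable_fun setT (vp n : mR -> R).
Proof. exact: (@continuous_measurable_fun R (vp n) (@continuous_vp R n)). Qed.

(** The slopes 1 and -1 are those of [x - y] in each of its variables, so this gives both marginals.
    Only the term [i = n] survives, with coefficient 1. *)
Lemma Rintegral_vp n (a b : R) : (a = 1 \/ a = -1) ->
  \int[leb1]_(t in I01) vp n (a * t + b) = 1.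
Proof.
move=> a1.
pose F (i : 'I_(2 * n).+1) t : R := vp_coef n i * cos (((i%:Z - n%:Z)%:~R * (2 * pi) * a) * t +
   (i%:Z - n%:Z)%:~R * (2 * pi) * b).
have cF i : continuous (F i).
  exact: continuous_mul_cos_affine.
have iF i : leb1.-integrable I01 (EFin \o F i) by apply: continuous_integrable01.
have mI : measurable (I01 : set mR) := measurable_unit_itv.
have [_ sF] := Rintegral_sum (index_enum _) (P := xpredT) mI (fun i _ => iF i).
transitivity (\int[leb1]_(t in I01) \sum_i F i t).
  apply: eq_Rintegral => t _; rewrite vp_cos; apply: eq_bigr => i _.
  by rewrite /F; congr (_ * cos _); ring.
rewrite sF; have n2n : (n < (2 * n).+1)%N by rewrite ltnS leq_pmull.
rewrite (bigD1 (Ordinal n2n))//= big1 ?addr0.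
  rewrite /F /= subrr !mul0r; under eq_Rintegral do rewrite mul0r addr0 cos0 mulr1.
  rewrite Rintegral01_cst /vp_coef divff// gt_eqF// central_binomial_gt0//.
move=> i ni; rewrite /F.
have [m mE m0] : exists2 m : int, (i%:Z - n%:Z)%:~R * (2 * pi) * a = m%:~R * (2 * pi) :> R & m != 0.
  have n0 : i%:Z - n%:Z != 0.
    by rewrite subr_eq0; apply: contra ni => /eqP[ni]; apply/eqP/val_inj.
  case: a1 => ->; first by exists (i%:Z - n%:Z) => //; rewrite mulr1.
  by exists (- (i%:Z - n%:Z)); rewrite ?oppr_eq0// rmorphN /=; ring.
rewrite mE RintegralZl//; last first.
  by apply: (continuous_integrable01 (f := fun t => cos (_ * t + _))); exact: continuous_cos_affine.
by rewrite Rintegral_cos_period (negbTE m0) mul0r mulr0.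
Qed.

Lemma integral_vp n (a b : R) : (a = 1 \/ a = -1) ->
  (\int[leb1]_(t in I01) (vp n (a * t + b))%:E = 1)%E.
Proof.
move=> a1; have := Rintegral_vp n b a1; rewrite /Rintegral => h.
have c : continuous (fun t => vp n (a * t + b)).
  move=> t; apply: (@continuous_comp _ _ _ (fun t => a * t + b) (vp n)); last exact: continuous_vp.
  by apply: differentiable_continuous; apply/derivable1_diffP; have [] := is_derive_affine a b t.
have := integrable_fin_num measurable_unit_itv (continuous_integrable01 c).
by move=> /fineK <-; rewrite h.
Qed.

Lemma doubly_markov_vpk n : doubly_markov leb1 I01 (vpk n).
Proof.
split.
- apply: (measurableT_comp (measurable_vp n)); apply: measurable_funB;
  [exact: measurable_fst|exact: measurable_snd].
- by move=> z; exact: vp_ge0.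
- by have [B hB] := vp_bounded (R := R) n; exists B => z; exact: hB.
- move=> x; rewrite -[RHS](integral_vp n x (or_intror (erefl (-1)))).
  by apply: eq_integral => y _; rewrite /vpk /= mulN1r addrC.
- move=> y; rewrite -[RHS](integral_vp n (- y) (or_introl (erefl 1))).
  by apply: eq_integral => x _; rewrite /vpk /= mul1r.
Qed.

(** Since [(n + 1)^2 q^n] is bounded, the left side is [O(1 / n)]. *)
Lemma poly_geom_vanish (q : R) : 0 <= q < 1 -> forall e, 0 < e ->
  \forall n \near \oo, (2 * n).+1%:R * q ^+ n <= e.
Proof.
move=> /andP[q0 q1] e e0.
wlog qp : q q0 q1 / 0 < q.
  move=> H; move: q0; rewrite le_eqVlt => /orP[/eqP <-|qp]; last by apply: H => //; exact: ltW.
  by exists 1%N => // -[//|n] _ /=; rewrite exprS mul0r mulr0 ltW.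
have [|C hC] := @poly_geometric_bounded R 2 q; first by rewrite qp.
have C0 : 0 <= C by apply: le_trans (hC 0%N); rewrite mulr_ge0 ?exprn_ge0.
have h0 : 0 <= 2 * C / e by rewrite divr_ge0 ?mulr_ge0// ltW.
exists (Num.bound (2 * C / e)) => // n /= hn.
have n1 : 2 * C / e <= n.+1%:R.
  by apply: le_trans (ltW (archi_boundP h0)) _; rewrite ler_nat leqW.
have np : 0 < n.+1%:R :> R by rewrite ltr0n.
rewrite -(ler_pM2r np) -(ler_pM2l (ltr0n _ 1 : 0 < 1 :> R)) !mul1r.
apply: (@le_trans _ _ (2 * C)); last by rewrite [leRHS]mulrC -ler_pdivrMr.
apply: (@le_trans _ _ (2 * (n.+1%:R ^+ 2 * q ^+ n))); last by rewrite ler_wpM2l.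
rewrite [leLHS](_ : _ = ((2 * n).+1%:R * n.+1%:R) * q ^+ n); last by ring.
rewrite mulrA ler_wpM2r ?exprn_ge0// expr2 mulrA ler_wpM2r//.
by rewrite -natrM ler_nat; lia.
Qed.

(** The constant [\1_A x] is moved under the average; the integrand then lives on the [y] of the
    other side of [A]. These stay at distance [de] from [x] on the circle, where the kernel is at
    most [(2 n + 1) q^n] with [q < 1]. *)
Lemma mop_vpk_pointwise (A : set mR) (x : R) (de : R) : measurable A -> 0 < de -> de < 1 ->
  (forall y, I01 y -> (x \in A) != (y \in A) -> de <= `|x - y| <= 1 - de) ->
  forall e, 0 < e -> \forall n \near \oo, `|mop leb1 I01 (vpk n) \1_A x - \1_A x| <= e.
Proof.
move=> mA d0 d1 H e e0.
have q01 := @cos_sqr_lt1 R de; rewrite d0 d1 in q01.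
have := poly_geom_vanish (q01 isT) e0; apply: filterS => n hn.
have mI : measurable (I01 : set mR) := measurable_unit_itv.
have fI : (leb1 I01 < +oo)%E by rewrite lebesgue_unit_itv ltry.
have kM := doubly_markov_vpk n.
have m1 : measurable_fun setT (\1_A : mR -> R) by exact: measurable_indic.
have m2 : measurable_fun setT (fun _ : mR => - \1_A x : R) by exact: measurable_cst.
have bi (f : mR -> R) M : measurable_fun setT f -> (forall x, `|f x|
  <= M) -> leb1.-integrable I01 (EFin \o f).
  move=> mf fM; apply: (moment_integrable (p := 0) mI fI mf).
  exact: (moment_bounded mI fI 1 (fun x _ => fM x)).
have -> : mop leb1 I01 (vpk n) \1_A x - \1_A x = mop leb1 I01 (vpk n) (fun y => \1_A y + - \1_A x) x.
  rewrite mopD// ?mop_cst//.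
  - exact: (bi _ 1 m1 (@indic_norm_le1 _ _ _ A)).
  - by apply: (bi _ 1 m2) => y; rewrite normrN indic_norm_le1.
have m3 : measurable_fun setT (fun y : mR => \1_A y + - \1_A x : R) by exact: measurable_funD.
have i3 : leb1.-integrable I01 (EFin \o (fun y => vpk n (x, y) * (\1_A y + - \1_A x))).
  apply: integrable_mop => //; apply: (bi _ 2) => // y.
  by apply: le_trans (ler_normB _ _) _; rewrite (_ : 2 = 1 + 1)// lerD ?indic_norm_le1.
apply: le_trans (le_normr_Rintegral mI i3) _.
rewrite -[leRHS](Rintegral01_cst e); apply: le_Rintegral => //.
- by have := integrable_abse i3; congr (_.-integrable _ _).
- by apply: (bi (fun=> e) `|e|).
move=> y Iy; rewrite normrM ger0_norm ?vp_ge0// !indicE.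
case: (boolP ((x \in A) == (y \in A))) => [/eqP ->|xy].
  by rewrite subrr normr0 mulr0 ltW.
apply: (@le_trans _ _ (vpk n (x, y))).
  rewrite ler_piMr ?vp_ge0//.
  by case: (y \in A); case: (x \in A); rewrite ?subrr ?subr0 ?sub0r ?normrN ?normr1 ?normr0.
apply: le_trans hn; apply: vp_le; apply: cos_sqr_le => //; exact: H.
Qed.

Lemma approx_vpk_ocitv (a b : R) : approx leb1 I01 vpk 1 (\1_(`]a, b] : set mR)).
Proof.
set A : set mR := `]a, b]%classic.
have mI : measurable (I01 : set mR) := measurable_unit_itv.
have fI : (leb1 I01 < +oo)%E by rewrite lebesgue_unit_itv ltry.
have mA : measurable A by exact: measurable_itv.
have m1 : measurable_fun setT (\1_A : mR -> R) by exact: measurable_indic.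
apply: cvg_vanish.
have [] := @dominated_convergence _ mR R leb1 I01 mI
  (fun n x => (`|mop leb1 I01 (vpk n) \1_A x - \1_A x| ^+ 1)%:E) (fun=> 0%E) (fun=> 2%:E).
- move=> n; apply: measurable_normX; apply: measurable_funB => //.
  exact: (measurable_mop mI (doubly_markov_vpk n)).
- exact: measurable_cst.
(* The null set where pointwise convergence is not claimed. It contains 0 and 1 because the kernel
   has period 1: near one end of the unit interval it also charges the other end. *)
- exists [set 0; 1; a; b]; split.
  + by apply: countable_measurable => //; exact: finite_set_countable.
  + by apply: countable_lebesgue_measure0; exact: finite_set_countable.
  + move=> x /= nx; apply: contrapT => xS; apply: nx => Ix.
    have [x0 x1 xa xb] : [/\ x != 0, x != 1, x != a & x != b].
      by split; apply/eqP => xE; apply: xS; rewrite xE; [left; left; left|left; left; right|left;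
        right|right].
    move: Ix; rewrite /unit_itv /= in_itv /= => /andP[xg xl].
    pose de := Num.min (Num.min x (1 - x)) (Num.min `|x - a| `|x - b|).
    have d0 : 0 < de.
      by rewrite /de !lt_min !normr_gt0 !subr_eq0 xa xb !lt_def xg subr_ge0 xl x0 subr_eq0 eq_sym x1.
    have [dx d1x da db] : [/\ de <= x, de <= 1 - x, de <= `|x - a| & de <= `|x - b|].
      by split; rewrite /de !ge_min lexx ?orbT.
    have d1 : de < 1 by rewrite (le_lt_trans d1x)// gtrBl lt_def x0.
    have H (y : R) : I01 y -> (x \in A) != (y \in A) -> de <= `|x - y| <= 1 - de.
      rewrite /unit_itv /= in_itv /= => /andP[y0 y1].
      rewrite !mem_setE !in_itv /= => xy.
      apply/andP; split; last by rewrite ler_norml; apply/andP; split; lra.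
      move: xy da db; rewrite !ltNge.
      case: (lerP x a) => h1; case: (lerP x b) => h2; case: (lerP y a) => h3;
        case: (lerP y b) => h4 //= _;
      rewrite ?[`|x - a|]ger0_norm ?[`|x - a|]ler0_norm ?[`|x - b|]ger0_norm ?[`|x - b|]ler0_norm ?subr_ge0 ?subr_le0 ?(ltW h1) ?(ltW h2)// => g1 g2; rewrite ler_normr; apply/orP; (left; lra) || (right; lra).
    apply: (cvg_EFin (a := 0)); first by exists 0%N.
    apply/cvgrPdist_le => e e0; have := mop_vpk_pointwise mA d0 d1 H e0.
    by apply: filterS => n hn; rewrite sub0r normrN /= expr1 normr_id.
- by apply: (moment_integrable (p := 0) mI fI);
  [exact: measurable_cst|exact: (moment_bounded mI fI 1 (M := `|2|))].
- apply: aeW => x n _; rewrite gee0_abs ?lee_fin ?exprn_ge0// expr1.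
  rewrite (le_trans (ler_normB _ _))// (_ : 2 = 1 + 1)// lerD ?indic_norm_le1//.
  apply: (mop_le_bound mI fI (doubly_markov_vpk n) _ m1) => y; exact: indic_norm_le1.
by move=> _ _; rewrite integral0.
Qed.

Lemma approx_vpk_indic (A : set mR) : measurable A -> approx leb1 I01 vpk 1 (\1_A).
Proof.
have mI : measurable (I01 : set mR) := measurable_unit_itv.
have fI : (leb1 I01 < +oo)%E by rewrite lebesgue_unit_itv ltry.
apply: (approx_indic mI fI doubly_markov_vpk (G := @ocitv R)) => //.
- exact: ocitvI.
- move=> _ [[a b] _ <-]; exact: approx_vpk_ocitv.
Qed.

End circle_kernel.

(** * The product kernel on the torus *)

Section torus_kernel.
Context {R : realType}.
Local Notation leb1 := (@lebesgue_measure R).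
Local Notation leb2 := (leb1 \x leb1)%E.
Local Notation mR := (measurableTypeR R).
Local Notation I01 := (unit_itv (R := R)).
Local Notation Q := (unit_square (R := R)).

Let mI : measurable (I01 : set mR). Proof. exact: measurable_unit_itv. Qed.

Let fI : (leb1 I01 < +oo)%E. Proof. by rewrite lebesgue_unit_itv ltry. Qed.

Lemma measurable_unit_square : measurable (Q : set (mR * mR)).
Proof. exact: measurableX. Qed.

Lemma lebesgue_unit_square : leb2 (Q : set (mR * mR)) = 1%E.
Proof.
transitivity (leb1 (I01 : set mR) * leb1 (I01 : set mR))%E; first exact: product_measure1E.
by transitivity (1 * 1 : \bar R)%E; [congr (_ * _)%E; exact: lebesgue_unit_itv|rewrite mule1].
Qed.

Lemma sigma_finite_leb2 : sigma_finite setT leb2.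
Proof.
have /sigma_finiteP[F [TF ndF Foo]] := sigma_finiteT leb1.
exists (fun n => F n `*` F n).
  rewrite -setXTT TF predeqE => -[x y]; split.
    move=> [/= [n _ Fnx] [k _ Gky]]; exists (maxn n k) => //; split.
    - by move: x Fnx; exact/subsetPset/ndF/leq_maxl.
    - by move: y Gky; exact/subsetPset/ndF/leq_maxr.
  by move=> [n _ []/= ? ?]; split; exists n.
move=> k; have [? ?] := Foo k.
split; first exact: measurableX.
by rewrite product_measure1E// lte_mul_pinfty// ge0_fin_numE.
Qed.

(* The canonical sigma-finite structure on [\x] is shadowed by the one for
   subprobabilities, so that it has to be built by hand. *)
Definition leb2sf : {sigma_finite_measure set (mR * mR)%type -> \bar R} :=
  HB.pack leb2 (Measure_isSigmaFinite.Build _ _ _ leb2 sigma_finite_leb2).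

Lemma integral_prod_ge0 (f g : mR -> R) : measurable_fun setT f -> measurable_fun setT g ->
  (forall x, 0 <= f x) -> (forall x, 0 <= g x) ->
  (\int[leb2]_(z in Q) (f z.1 * g z.2)%:E =
   \int[leb1]_(x in I01) (f x)%:E * \int[leb1]_(x in I01) (g x)%:E)%E.
Proof.
move=> mf mg f0 g0.
rewrite /unit_square (@tonelli_on1 _ _ mR mR R leb1 leb1 I01 I01 mI mI (fun z => (f z.1 * g z.2)%:E)); last 2 first.
- apply/measurable_EFinP; apply: measurable_funM; apply: measurableT_comp => //.
- by move=> z; rewrite lee_fin mulr_ge0.
have mf' : measurable_fun (I01 : set mR) (fun x => (f x)%:E) by apply/measurable_EFinP;
  exact: measurable_funTS.
have mg' : measurable_fun (I01 : set mR) (fun x => (g x)%:E) by apply/measurable_EFinP;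
  exact: measurable_funTS.
rewrite -ge0_integralZr//.
- apply: eq_integral => x _ /=; under eq_integral do rewrite EFinM.
  by rewrite ge0_integralZl// => *; rewrite lee_fin.
- by move=> x _; rewrite lee_fin.
- by apply: integral_ge0 => x _; rewrite lee_fin.
Qed.

Definition vpk2 (n : nat) (z : (mR * mR) * (mR * mR)) : R :=
  vpk n (z.1.1, z.2.1) * vpk n (z.1.2, z.2.2).

Lemma doubly_markov_vpk2 n : doubly_markov leb2sf Q (vpk2 n).
Proof.
have [mk k0 [B kB] k1 k2] := doubly_markov_vpk (R := R) n.
split.
- apply: measurable_funM; apply: (measurableT_comp mk); apply: measurable_fun_pair.
  + exact: (measurableT_comp measurable_fst measurable_fst).
  + exact: (measurableT_comp measurable_fst measurable_snd).
  + exact: (measurableT_comp measurable_snd measurable_fst).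
  + exact: (measurableT_comp measurable_snd measurable_snd).
- by move=> z; rewrite mulr_ge0.
- by exists (B * B) => z; apply: ler_pM.
- move=> x; rewrite (integral_prod_ge0 (f := fun t => vpk n (x.1, t)) (g := fun t => vpk n (x.2, t)))//.
  + by rewrite !k1 mule1.
  + exact: measurableT_comp.
  + exact: measurableT_comp.
- move=> y; rewrite (integral_prod_ge0 (f := fun t => vpk n (t, y.1)) (g := fun t => vpk n (t, y.2)))//.
  + by rewrite !k2 mule1.
  + exact: measurableT_comp.
  + exact: measurableT_comp.
Qed.

Lemma mop_vpk2_rect n (A B : set mR) (x : mR * mR) : measurable A -> measurable B ->
  mop leb2sf Q (vpk2 n) \1_(A `*` B) x = mop leb1 I01 (vpk n) \1_A x.1 * mop leb1 I01 (vpk n) \1_B x.2.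
Proof.
move=> mA mB; have kM := doubly_markov_vpk (R := R) n.
have [mk k0 _ _ _] := kM.
have mi (C : set mR) t : measurable C -> measurable_fun setT (fun y => vpk n (t, y) * \1_C y).
  move=> mC; apply: measurable_funM; last exact: measurable_indic.
  exact: measurableT_comp.
have nn (C : set mR) t y : 0 <= vpk n (t, y) * \1_C y by rewrite mulr_ge0// indicE.
have ii (C : set mR) t : measurable C -> leb1.-integrable I01 (EFin \o (fun y => vpk n (t, y) * \1_C y)).
  move=> mC; have m1 : measurable_fun setT (\1_C : mR -> R) by exact: measurable_indic.
  apply: (integrable_mop mI kM) => //.
  apply: (moment_integrable (p := 0) mI fI m1).
  apply: (moment_bounded mI fI 1 (M := 1)) => // y _; exact: indic_norm_le1.
rewrite /mop /Rintegral -fineM; [|exact: integrable_fin_num (ii A _ mA)|exact: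
  integrable_fin_num (ii B _ mB)].
rewrite -(integral_prod_ge0 (mi A x.1 mA) (mi B x.2 mB))//; congr fine.
apply: eq_integral => y _; congr EFin; rewrite /vpk2 /= !indicE in_setX.
by case: (y.1 \in A); case: (y.2 \in B); rewrite /= ?mulr1 ?mulr0 ?mul0r.
Qed.

Lemma approx_vpk2_rect (A B : set mR) : measurable A -> measurable B ->
  approx leb2sf Q vpk2 1 (\1_(A `*` B)).
Proof.
move=> mA mB.
have mu1 (C : set mR) : measurable C -> measurable_fun setT (\1_C : mR -> R) by move=> mC;
  exact: measurable_indic.
apply: (vanish_le _ (vanishD (approx_vpk_indic mA) (approx_vpk_indic mB))) => n.
have kM := doubly_markov_vpk (R := R) n.
pose u C t : R := `|mop leb1 I01 (vpk n) \1_C t - \1_C t|.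
have mu (C : set mR) : measurable C -> measurable_fun setT (u C).
  move=> mC; apply: measurableT_comp => //; apply: measurable_funB; last exact: mu1.
  exact: (measurable_mop mI kM (mu1 _ mC)).
have u0 C t : 0 <= u C t by exact: normr_ge0.
have mE (C : set mR) : measurable C ->
    moment leb1 I01 1 (fun x => mop leb1 I01 (vpk n) \1_C x - \1_C x)%R = (\int[leb1]_(x in I01)
      (u C x)%:E)%E.
  by move=> mC; apply: eq_integral => x _; rewrite expr1.
have c1 : measurable_fun setT (fun _ : mR => 1 : R) by exact: measurable_cst.
have i1 : (\int[leb1]_(x in I01) 1%:E = 1)%E by rewrite integral_cst// mul1e; exact: lebesgue_unit_itv.
have eA : (\int[leb1]_(x in I01) (u A x)%:E = \int[leb2]_(z in Q) (u A z.1)%:E)%E.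
  rewrite -[LHS]mule1 -i1 -(integral_prod_ge0 (mu A mA) c1)//.
  by apply: eq_integral => z _; rewrite mulr1.
have eB : (\int[leb1]_(x in I01) (u B x)%:E = \int[leb2]_(z in Q) (u B z.2)%:E)%E.
  rewrite -[LHS]mul1e -i1 -(integral_prod_ge0 c1 (mu B mB))//.
  by apply: eq_integral => z _; rewrite mul1r.
rewrite !mE// eA eB.
have mu2 (g : mR -> R) : measurable_fun setT g -> measurable_fun (Q : set (mR * mR)) (fun z :
  mR * mR => (g z.1)%:E).
  by move=> mg; apply/measurable_EFinP; apply: measurable_funTS; apply: measurableT_comp.
have mu3 (g : mR -> R) : measurable_fun setT g -> measurable_fun (Q : set (mR * mR)) (fun z :
  mR * mR => (g z.2)%:E).
  by move=> mg; apply/measurable_EFinP; apply: measurable_funTS; apply: measurableT_comp.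
have mQ := measurable_unit_square.
rewrite -ge0_integralD//; [|by move=> z _; rewrite lee_fin|exact: mu2 (mu A mA)|by move=> z _;
  rewrite lee_fin|exact: mu3 (mu B mB)].
apply: (ge0_le_integral _ mQ) => [z _|||z _].
- by rewrite lee_fin exprn_ge0.
- apply: measurable_normX; apply: measurable_funB; last by apply: measurable_indic; exact: measurableX.
  apply: (measurable_mop mQ (doubly_markov_vpk2 n)); apply: measurable_indic; exact: measurableX.
- by apply: emeasurable_funD; [exact: mu2 (mu A mA)|exact: mu3 (mu B mB)].
rewrite -EFinD lee_fin expr1 mop_vpk2_rect//.
have -> : \1_(A `*` B) z = \1_A z.1 * \1_B z.2 :> R.
  by rewrite !indicE in_setX -natrM mulnb.
set p := mop _ _ _ _ _; set q := mop _ _ _ _ _.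
(* With all four factors at most 1 in absolute value, the error on a rectangle is at most the sum of
   the one-dimensional errors. *)
have -> : p * q - \1_A z.1 * \1_B z.2 = (p - \1_A z.1) * q + \1_A z.1 * (q - \1_B z.2) by ring.
apply: le_trans (ler_normD _ _) _; rewrite !normrM lerD//.
  rewrite ler_piMr// (mop_le_bound mI fI kM _ (mu1 _ mB))// => y; exact: indic_norm_le1.
by rewrite ler_piMl// indic_norm_le1.
Qed.

Theorem approx_vpk2_Lp p (f : mR * mR -> R) : measurable_fun setT f ->
  (moment leb2sf Q p.+1 f < +oo)%E -> approx leb2sf Q vpk2 p.+1 f.
Proof.
have fQ : (leb2sf (Q : set (mR * mR)) < +oo)%E.
  apply: (@le_lt_trans _ _ (1 : \bar R)%E); last exact: ltry.
  by rewrite le_eqVlt; apply/orP; left; apply/eqP; exact: lebesgue_unit_square.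
apply: (approx_Lp measurable_unit_square fQ doubly_markov_vpk2 (measurable_prod_measurableType mR mR)).
- move=> _ _ [A mA [B mB <-]] [C mC [D mD <-]]; exists (A `&` C); first exact: measurableI.
  exists (B `&` D); first exact: measurableI.
  by rewrite setXI.
- by move=> _ [A mA [B mB <-]]; exact: approx_vpk2_rect.
Qed.

End torus_kernel.

(** * Complex integrals and Fourier coefficients *)

Section cmod_theory.
Context {R : realType}.
Implicit Types z w : R[i].
Local Notation Re := (@complex.Re R).
Local Notation Im := (@complex.Im R).

Lemma cReD z w : Re (z + w) = Re z + Re w.
Proof. by case: z => a b; case: w. Qed.

Lemma cImD z w : Im (z + w) = Im z + Im w.
Proof. by case: z => a b; case: w. Qed.

Lemma cReM z w : Re (z * w) = Re z * Re w - Im z * Im w.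
Proof. by case: z => a b; case: w. Qed.

Lemma cImM z w : Im (z * w) = Re z * Im w + Im z * Re w.
Proof. by case: z => a b; case: w => c d /=. Qed.

Lemma complex_eq z w : Re z = Re w -> Im z = Im w -> z = w.
Proof. by case: z => a b; case: w => c d /= -> ->. Qed.

Lemma cmod_ge0 z : 0 <= cmod z.
Proof. by case: z => a b; rewrite /cmod /= sqrtr_ge0. Qed.

Lemma cmodE z : cmod z ^+ 2 = Re z ^+ 2 + Im z ^+ 2.
Proof. by case: z => a b; rewrite /cmod /= sqr_sqrtr// addr_ge0// sqr_ge0. Qed.

Lemma cmodM z w : cmod (z * w) = cmod z * cmod w.
Proof. exact: Normc.normcM. Qed.

Lemma cmodD z w : cmod (z + w) <= cmod z + cmod w.
Proof. exact: le_normcD. Qed.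

Lemma cmodN z : cmod (- z) = cmod z.
Proof. exact: normcN. Qed.

Lemma cmod0 : cmod (0 : R[i]) = 0.
Proof. exact: Normc.normc0. Qed.

Lemma cmod1 : cmod (1 : R[i]) = 1.
Proof. exact: Normc.normc1. Qed.

Lemma cmod_real (a : R) : cmod a%:C = `|a|.
Proof. by rewrite /cmod /= expr0n addr0 sqrtr_sqr. Qed.

Lemma cmod_conj z : cmod z^*%C = cmod z.
Proof. by case: z => a b; rewrite /cmod /= sqrrN. Qed.

Lemma Re_le_cmod z : `|Re z| <= cmod z.
Proof.
rewrite -(ler_pXn2r (n := 2)) ?nnegrE ?cmod_ge0// cmodE real_normK ?num_real//.
by rewrite lerDl sqr_ge0.
Qed.

Lemma Im_le_cmod z : `|Im z| <= cmod z.
Proof.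
rewrite -(ler_pXn2r (n := 2)) ?nnegrE ?cmod_ge0// cmodE real_normK ?num_real//.
by rewrite lerDr sqr_ge0.
Qed.

Lemma cmod_le z : cmod z <= `|Re z| + `|Im z|.
Proof.
rewrite -(ler_pXn2r (n := 2)) ?nnegrE ?cmod_ge0 ?addr_ge0// cmodE sqrrD !real_normK ?num_real//.
by rewrite -addrA lerD2l lerDr mulrn_wge0// mulr_ge0.
Qed.

Lemma mul_conj z : z * z^*%C = (cmod z ^+ 2)%:C.
Proof. by rewrite cmodE; case: z => a b; simpc; congr (_ +i* _); ring. Qed.

Lemma Re_mul_conj_le z w : 2 * Re (z * w^*%C) <= cmod z ^+ 2 + Re (w * w^*%C).
Proof.
rewrite mul_conj /= !cmodE; case: z => a b; case: w => c d /=.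
have := sqr_ge0 (a - c); have := sqr_ge0 (b - d); nra.
Qed.

Lemma cmod_sum (I : Type) (s : seq I) (P : pred I) (F : I -> R[i]) :
  cmod (\sum_(i <- s | P i) F i) <= \sum_(i <- s | P i) cmod (F i).
Proof.
elim/big_rec2: _ => [|i y z _ h]; first by rewrite cmod0.
by apply: le_trans (cmodD _ _) _; rewrite lerD2l.
Qed.

Lemma conjD z w : (z + w)^*%C = z^*%C + w^*%C.
Proof. by case: z => a b; case: w => c d; apply: complex_eq => //=; rewrite opprD. Qed.

Lemma conjM z w : (z * w)^*%C = z^*%C * w^*%C.
Proof. by case: z => a b; case: w => c d; simpc; congr (_ +i* _); ring. Qed.

Lemma conj_sum (I : Type) (s : seq I) (P : pred I) (F : I -> R[i]) :
  (\sum_(i <- s | P i) F i)^*%C = \sum_(i <- s | P i) (F i)^*%C.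
Proof. by apply: (big_morph (@conjc R)) => [z w|]; [exact: conjD|rewrite conjc0]. Qed.

Lemma starM b z w : star b (z * w) = star b z * star b w.
Proof. by case: b => //=; exact: conjM. Qed.

Lemma star_sum b (I : Type) (s : seq I) (P : pred I) (F : I -> R[i]) :
  star b (\sum_(i <- s | P i) F i) = \sum_(i <- s | P i) star b (F i).
Proof. by case: b => //=; exact: conj_sum. Qed.

Lemma cmod_star b z : cmod (star b z) = cmod z.
Proof. by case: b => //=; exact: cmod_conj. Qed.

End cmod_theory.

Section complex_measurability.
Context d (T : measurableType d) (R : realType).
Implicit Types f g : T -> R[i].

Lemma cmeasurable_cst (c : R[i]) : cmeasurable (fun _ : T => c).
Proof. by split; exact: measurable_cst. Qed.

Lemma cmeasurable_real (f : T -> R) : measurable_fun setT f -> cmeasurable (fun x => (f x)%:C).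
Proof. by move=> mf; split=> //=; exact: measurable_cst. Qed.

Lemma cmeasurableD f g : cmeasurable f -> cmeasurable g -> cmeasurable (fun x => f x + g x).
Proof.
move=> [f1 f2] [g1 g2]; split.
  by under eq_fun do rewrite cReD; exact: measurable_funD.
by under eq_fun do rewrite cImD; exact: measurable_funD.
Qed.

Lemma cmeasurableM f g : cmeasurable f -> cmeasurable g -> cmeasurable (fun x => f x * g x).
Proof.
move=> [f1 f2] [g1 g2]; split.
  by under eq_fun do rewrite cReM; apply: measurable_funB; exact: measurable_funM.
by under eq_fun do rewrite cImM; apply: measurable_funD; exact: measurable_funM.
Qed.

Lemma cmeasurableZ (c : R[i]) f : cmeasurable f -> cmeasurable (fun x => c * f x).
Proof. by apply: cmeasurableM; exact: cmeasurable_cst. Qed.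

Lemma cmeasurable_conj f : cmeasurable f -> cmeasurable (fun x => (f x)^*%C).
Proof.
move=> [f1 f2]; split.
  by rewrite (_ : (fun x => _) = (fun x => complex.Re (f x)))//; apply/funext => x; case: (f x).
rewrite (_ : (fun x => _) = (fun x => - complex.Im (f x))); last by apply/funext => x; case: (f x).
exact: measurableT_comp.
Qed.

Lemma cmeasurable_star b f : cmeasurable f -> cmeasurable (fun x => star b (f x)).
Proof. by case: b => //=; exact: cmeasurable_conj. Qed.

Lemma cmeasurable_sum (I : Type) (s : seq I) (P : pred I) (F : I -> T -> R[i]) :
  (forall i, cmeasurable (F i)) -> cmeasurable (fun x => \sum_(i <- s | P i) F i x).
Proof.
move=> mF; elim: s => [|i s IH].
  by under eq_fun do rewrite big_nil; exact: cmeasurable_cst.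
under eq_fun do rewrite big_cons.
by case: (P i) => //; exact: cmeasurableD.
Qed.

Lemma cmeasurable_comp d' (S : measurableType d') (f : T -> R[i]) (h : S -> T) :
  measurable_fun setT h -> cmeasurable f -> cmeasurable (f \o h).
Proof. by move=> mh [f1 f2]; split; [exact: (measurableT_comp f1)|exact: (measurableT_comp f2)]. Qed.

Lemma measurable_cmod f : cmeasurable f -> measurable_fun setT (fun x => cmod (f x)).
Proof.
move=> [f1 f2].
rewrite (_ : (fun x => _) = (fun x => Num.sqrt (complex.Re (f x) ^+ 2 + complex.Im (f x) ^+ 2))).
  apply: (measurableT_comp (f := @Num.sqrt R)).
    apply: (@continuous_measurable_fun R (@Num.sqrt R)); exact: sqrt_continuous.
  by apply: measurable_funD; exact: measurable_funX.
by apply/funext => x; rewrite -cmodE sqrtr_sqr ger0_norm ?cmod_ge0.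
Qed.

End complex_measurability.

Section complex_integral.
Context d (T : measurableType d) (R : realType) (mu : {measure set T -> \bar R}).
Variables (D : set T) (mD : measurable D).
Implicit Types f g : T -> R[i].

Definition cintegrable f : Prop :=
  mu.-integrable D (EFin \o (fun x => complex.Re (f x))) /\
  mu.-integrable D (EFin \o (fun x => complex.Im (f x))).

Lemma eq_cintegral f g : (forall x, D x -> f x = g x) ->
  cintegral mu D f = cintegral mu D g.
Proof.
move=> fg; congr (_ +i* _); apply: eq_Rintegral => x /set_mem /fg -> //.
Qed.

Lemma Rintegral_comb (a b : R) (f g : T -> R) :
  mu.-integrable D (EFin \o f) -> mu.-integrable D (EFin \o g) ->
  mu.-integrable D (EFin \o (fun x => a * f x + b * g x)) /\
  \int[mu]_(x in D) (a * f x + b * g x) = a * \int[mu]_(x in D) f x + b * \int[mu]_(x in D) g x.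
Proof.
move=> fi gi.
have fa : mu.-integrable D (EFin \o (fun x => a * f x)).
  apply: (eq_integrable mD (fun x => (a%:E * (EFin \o f) x)%E)) => //.
  exact: integrableZl.
have gb : mu.-integrable D (EFin \o (fun x => b * g x)).
  apply: (eq_integrable mD (fun x => (b%:E * (EFin \o g) x)%E)) => //.
  exact: integrableZl.
split; first exact: (integrableD mD fa gb).
by rewrite RintegralD// !RintegralZl.
Qed.

Lemma cintegralD f g : cintegrable f -> cintegrable g ->
  cintegrable (fun x => f x + g x) /\
  cintegral mu D (fun x => f x + g x) = cintegral mu D f + cintegral mu D g.
Proof.
move=> [f1 f2] [g1 g2].
have [h1 e1] := Rintegral_comb 1 1 f1 g1; have [h2 e2] := Rintegral_comb 1 1 f2 g2.
have r1 : (fun x => complex.Re (f x + g x)) = fun x => 1 * complex.Re (f x) + 1 * complex.Re (g x).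
  by apply/funext => x; rewrite cReD !mul1r.
have r2 : (fun x => complex.Im (f x + g x)) = fun x => 1 * complex.Im (f x) + 1 * complex.Im (g x).
  by apply/funext => x; rewrite cImD !mul1r.
split; first by split; rewrite ?r1 ?r2.
by rewrite {1}/cintegral r1 r2 e1 e2 !mul1r.
Qed.

Lemma cintegralZ c f : cintegrable f ->
  cintegrable (fun x => c * f x) /\
  cintegral mu D (fun x => c * f x) = c * cintegral mu D f.
Proof.
move=> [f1 f2].
have [h1 e1] := Rintegral_comb (complex.Re c) (- complex.Im c) f1 f2.
have [h2 e2] := Rintegral_comb (complex.Im c) (complex.Re c) f1 f2.
have r1 : (fun x => complex.Re (c * f x)) =
    fun x => complex.Re c * complex.Re (f x) + - complex.Im c * complex.Im (f x).
  by apply/funext => x; rewrite cReM mulNr.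
have r2 : (fun x => complex.Im (c * f x)) =
    fun x => complex.Im c * complex.Re (f x) + complex.Re c * complex.Im (f x).
  by apply/funext => x; rewrite cImM addrC.
split; first by split; rewrite ?r1 ?r2.
rewrite {1}/cintegral r1 r2 e1 e2; case: (c) => a b; rewrite /cintegral /=; simpc.
by congr (_ +i* _); ring.
Qed.

Lemma cintegrable0 : cintegrable (fun=> 0).
Proof. by split=> /=; exact: integrable0. Qed.

Lemma cintegral0 : cintegral mu D (fun=> 0) = 0.
Proof. by rewrite /cintegral /= /Rintegral integral0 /=. Qed.

Lemma cintegral_sum (I : Type) (s : seq I) (P : pred I) (F : I -> T -> R[i]) :
  (forall i, cintegrable (F i)) ->
  cintegrable (fun x => \sum_(i <- s | P i) F i x) /\
  cintegral mu D (fun x => \sum_(i <- s | P i) F i x) =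
    \sum_(i <- s | P i) cintegral mu D (F i).
Proof.
move=> Fi; elim: s => [|i s [IH1 IH2]].
  under eq_fun do rewrite big_nil; rewrite big_nil cintegral0; split=> //; exact: cintegrable0.
under eq_fun do rewrite big_cons; rewrite big_cons; case: (P i) => //.
by have [h1 h2] := cintegralD (Fi i) IH1; rewrite -IH2.
Qed.

Lemma cintegralB f g : cintegrable f -> cintegrable g ->
  cintegrable (fun x => f x - g x) /\
  cintegral mu D (fun x => f x - g x) = cintegral mu D f - cintegral mu D g.
Proof.
move=> fi gi; have [h1 e1] := cintegralZ (-1) gi; have [h2 e2] := cintegralD fi h1.
have e : (fun x => f x - g x) = fun x => f x + -1 * g x by apply/funext => x; rewrite mulN1r.
by rewrite e; split=> //; rewrite e2 e1 mulN1r.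
Qed.

Lemma cintegrable_le f (g : T -> R) : cmeasurable f ->
  mu.-integrable D (EFin \o g) -> (forall x, D x -> cmod (f x) <= g x) -> cintegrable f.
Proof.
move=> [f1 f2] gi fg.
have m1 : measurable_fun D (EFin \o (fun x => complex.Re (f x))).
  by apply/measurable_EFinP; exact: measurable_funTS.
have m2 : measurable_fun D (EFin \o (fun x => complex.Im (f x))).
  by apply/measurable_EFinP; exact: measurable_funTS.
split; [apply: (le_integrable mD m1 _ gi)|apply: (le_integrable mD m2 _ gi)] => x Dx.
  by rewrite /= lee_fin (le_trans (Re_le_cmod _))// (le_trans (fg x Dx))// ler_norm.
by rewrite /= lee_fin (le_trans (Im_le_cmod _))// (le_trans (fg x Dx))// ler_norm.
Qed.

(** The factor 2 comes from bounding the real and imaginary parts separately. *)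
Lemma cmod_cintegral_le f M : cmeasurable f ->
  (\int[mu]_(x in D) (cmod (f x))%:E <= M%:E)%E -> cmod (cintegral mu D f) <= 2 * M.
Proof.
move=> mf fM; have [f1 f2] := mf.
have R1 (g : T -> R) : measurable_fun setT g -> (forall x, `|g x| <= cmod (f x)) ->
    `|\int[mu]_(x in D) g x| <= M.
  move=> mg gf; rewrite /Rintegral.
  have h : (`|\int[mu]_(x in D) (g x)%:E| <= M%:E)%E.
    apply: le_trans (le_abse_integral mu mD _) _.
      by apply/measurable_EFinP; exact: measurable_funTS.
    apply: le_trans fM; apply: (ge0_le_integral mu mD) => [x _|||x _].
    - exact: abse_ge0.
    - by apply: measurableT_comp => //; apply/measurable_EFinP; exact: measurable_funTS.
    - by apply/measurable_EFinP; apply: measurable_funTS; exact: measurable_cmod.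
    - by rewrite lee_fin.
  have fn : (\int[mu]_(x in D) (g x)%:E)%E \is a fin_num by rewrite fin_num_abs (le_lt_trans h)// ltry.
  by rewrite -lee_fin -abse_EFin fineK.
apply: le_trans (cmod_le _) _; rewrite mulr_natl mulr2n; apply: lerD; apply: R1 => // x.
  exact: Re_le_cmod.
exact: Im_le_cmod.
Qed.

End complex_integral.

Section fubini_real.
Context d1 d2 (T1 : measurableType d1) (T2 : measurableType d2) (R : realType).
Variables (m1 : {sigma_finite_measure set T1 -> \bar R})
          (m2 : {sigma_finite_measure set T2 -> \bar R}).
Variables (D1 : set T1) (D2 : set T2).
Hypotheses (mD1 : measurable D1) (mD2 : measurable D2).

(** The inner integrals are finite only almost everywhere, and [fine] replaces infinite values by 0;
    the real and extended inner integrals are therefore identified up to a null set. *)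
Lemma Rintegral_fubini (h : T1 * T2 -> R) : measurable_fun setT h ->
  (m1 \x m2)%E.-integrable (D1 `*` D2) (EFin \o h) ->
  m1.-integrable D1 (EFin \o (fun x => \int[m2]_(y in D2) h (x, y))) /\
  \int[(m1 \x m2)%E]_(z in D1 `*` D2) h z = \int[m1]_(x in D1) \int[m2]_(y in D2) h (x, y).
Proof.
move=> mh hi.
have mD : measurable (D1 `*` D2) by exact: measurableX.
pose g := (EFin \o h) \_ (D1 `*` D2).
have gi : (m1 \x m2)%E.-integrable setT g by exact/(integrable_mkcond (EFin \o h) mD).
have gF x : fubini_F m2 g x = ((fun x => \int[m2]_(y in D2) (h (x, y))%:E)%E \_ D1) x.
  rewrite patchE /fubini_F; case: ifPn => xD.
    rewrite [RHS]integral_mkcond; apply: eq_integral => y _.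
    by rewrite /g !patchE in_setX xD.
  apply: integral0_eq => y _; rewrite /g patchE ifF//.
  by apply/negbTE; apply: contra xD; rewrite !inE => -[].
have Fi : m1.-integrable D1 (fun x => \int[m2]_(y in D2) (h (x, y))%:E)%E.
  apply/(integrable_mkcond _ mD1).
  by apply: eq_integrable (integrable_fubini_F gi) => // x _; rewrite gF.
have mF : measurable_fun D1 (EFin \o (fun x => \int[m2]_(y in D2) h (x, y))).
  by apply/measurable_EFinP; apply: measurable_funTS; exact: measurable_Rintegral.
have ae : ae_eq m1 D1 (EFin \o (fun x => \int[m2]_(y in D2) h (x, y)))
    (fun x => \int[m2]_(y in D2) (h (x, y))%:E)%E.
  apply: filterS (integrable_ae mD1 Fi) => x h1 Dx.
  by rewrite /= /Rintegral fineK// h1.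
split.
  apply: (le_integrable mD1 mF _ Fi) => x Dx /=.
  rewrite /Rintegral /=; case: (integral _ _ _) => [r||] //=; exact: leey.
rewrite {1}/Rintegral integral_mkcond -/g -(integral12_prod_meas1 gi).
rewrite /Rintegral; congr fine.
rewrite (eq_integral _ _ (fun x _ => gF x)) -integral_mkcond; apply/esym/ae_eq_integral => //.
exact: measurable_int Fi.
Qed.

End fubini_real.

(** * Fourier analysis on the unit square *)

Section torus_integrals.
Context {R : realType}.
Local Notation leb1 := (@lebesgue_measure R).
Local Notation leb2 := (leb1 \x leb1)%E.
Local Notation mR := (measurableTypeR R).
Local Notation I01 := (unit_itv (R := R)).
Local Notation Q := (unit_square (R := R)).

(** An open set is the union of the countably many boxes with rational centre and radius
    [1 / (n + 1)] that it contains; boxes are measurable for the product sigma-algebra. *)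
Lemma measurable_open2 (U : set (R * R)) : open U -> measurable (U : set (mR * mR)%type).
Proof.
move=> oU.
pose box (q : rat * rat * nat) : set (mR * mR)%type :=
  ball (ratr q.1.1 : R) (q.2.+1%:R^-1) `*` ball (ratr q.1.2 : R) (q.2.+1%:R^-1).
pose F q := [set x | box q `<=` U /\ box q x].
rewrite (_ : (U : set (mR * mR)%type) = \bigcup_q F q).
  apply: countable_bigcupT_measurable => [|q]; first exact: countableP.
  have [bU|nbU] := pselect (box q `<=` U); last first.
    by rewrite (_ : F q = set0)//; apply/seteqP; split=> // x [].
  rewrite (_ : F q = box q); last by apply/seteqP; split=> x // -[].
  by apply: measurableX; exact: measurable_ball.
apply/seteqP; split=> [x Ux|x [q _] [bU bx]]; last exact: bU.
have /nbhs_ballP[e /= e0 xeU] : nbhs (x : R * R) U by apply: open_nbhs_nbhs.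
have [n en] : exists n : nat, n.+1%:R^-1 < e / 2.
  have e2 : 0 < e / 2 by rewrite divr_gt0.
  have [N _ HN] := near_infty_natSinv_lt (PosNum e2).
  by exists N; exact: HN (leqnn N).
have n0 : 0 < n.+1%:R^-1 :> R by rewrite invr_gt0.
have Q1 (a : R) : exists q : rat, `|ratr q - a| < n.+1%:R^-1.
  have [q] : exists q : rat, ratr q \in `]a - n.+1%:R^-1, a + n.+1%:R^-1[.
    by apply: rat_in_itvoo; rewrite ltrD2l gtrN.
  by rewrite in_itv /= => qa; exists q; rewrite ltr_distl.
have [q1 h1] := Q1 x.1; have [q2 h2] := Q1 x.2.
exists (q1, q2, n) => //; split; last by split; rewrite /= /ball /= ?h1 ?h2.
move=> y [y1 y2]; apply: xeU; move: y1 y2; rewrite /ball /= => y1 y2.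
have tri (a b c : R) : `|c - a| < n.+1%:R^-1 -> `|c - b| < n.+1%:R^-1 -> `|a - b| < e.
  move=> ha hb; rewrite (_ : a - b = (c - b) - (c - a)); last by ring.
  apply: le_lt_trans (ler_normB _ _) _; rewrite (splitr e); apply: ltrD; exact: lt_trans en.
by split; rewrite /ball_ /=; [apply: tri h1 y1|apply: tri h2 y2].
Qed.

Lemma continuous2_measurable (f : R * R -> R) : continuous f ->
  measurable_fun setT (f : (mR * mR)%type -> R).
Proof.
move=> cf; apply: (measurability _ (RGenOpens.measurableE R)).
move=> _ [_ [a [b ->]] <-]; rewrite setTI.
apply: measurable_open2; apply: open_comp; first by move=> x _; exact: cf.
exact: interval_open.
Qed.

Lemma continuous2_bounded (f : R * R -> R) : continuous f ->
  exists M, forall x, Q x -> `|f x| <= M.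
Proof.
move=> cf.
have cQ : compact (Q : set (R * R)) by apply: compact_setX; exact: segment_compact.
have : compact [set f x | x in Q] by apply: continuous_compact cQ; exact: continuous_subspaceT.
move=> /compact_bounded[M [_ HM]]; exists (M + 1) => x Qx.
by apply: (HM (M + 1)); [rewrite ltrDl|exists x].
Qed.

Lemma lebesgue_unit_itv_fin : (leb1 (I01 : set mR) < +oo)%E.
Proof. by apply: (@le_lt_trans _ _ (1%E : \bar R)); rewrite ?ltry// le_eqVlt; apply/orP; left;
  apply/eqP; exact: lebesgue_unit_itv. Qed.

Lemma lebesgue_unit_square_fin : (leb2 (Q : set (mR * mR)%type) < +oo)%E.
Proof. by apply: (@le_lt_trans _ _ (1%E : \bar R)); rewrite ?ltry// le_eqVlt; apply/orP; left;
  apply/eqP; exact: lebesgue_unit_square. Qed.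

Lemma integrable_bounded_square (f : (mR * mR)%type -> R) M : measurable_fun setT f ->
  (forall x, Q x -> `|f x| <= M) -> leb2.-integrable Q (EFin \o f).
Proof.
move=> mf fM.
apply: (moment_integrable measurable_unit_square lebesgue_unit_square_fin (p := 0) mf).
exact: (moment_bounded measurable_unit_square lebesgue_unit_square_fin 1 fM mf).
Qed.

Lemma continuous2_integrable (f : R * R -> R) : continuous f ->
  leb2.-integrable Q (EFin \o f).
Proof.
move=> cf; have [M fM] := continuous2_bounded cf.
exact: integrable_bounded_square (continuous2_measurable cf) fM.
Qed.

Lemma Rintegral_square_eq0 (f : (mR * mR)%type -> R) M : measurable_fun setT f ->
  (forall x, Q x -> `|f x| <= M) ->
  (forall x2, I01 x2 -> \int[leb1]_(x1 in I01) f (x1, x2) = 0) \/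
  (forall x1, I01 x1 -> \int[leb1]_(x2 in I01) f (x1, x2) = 0) ->
  \int[leb2]_(x in Q) f x = 0.
Proof.
move=> mf fM f0.
have mI : measurable (I01 : set mR) := measurable_unit_itv.
have fi := integrable_bounded_square mf fM.
(* Adding [M] makes the function nonnegative on the square, so that Tonelli's theorem applies in
   either order; the maximum ensures positivity off the square too. *)
pose h (x : (mR * mR)%type) : \bar R := (Num.max (f x + M) 0)%:E.
have mh : measurable_fun setT h.
  apply/measurable_EFinP; apply: measurable_maxr => //.
  by apply: measurable_funD.
have h0 z : (0 <= h z)%E by rewrite lee_fin le_max lexx orbT.
have hE x : Q x -> h x = (f x + M)%:E.
  by move=> /fM; rewrite ler_norml => /andP[a _]; rewrite /h (max_l _)// -lerBlDr sub0r.
have c1 : (\int[leb1]_(x in I01) (cst M%:E x) = M%:E)%E.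
  rewrite integral_cst//= (_ : lebesgue_measure _ = 1%E) ?mule1//; exact: lebesgue_unit_itv.
have slice (g : mR -> R) : measurable_fun setT g -> (forall x, I01 x -> `|g x| <= M) ->
    \int[leb1]_(x in I01) g x = 0 -> (\int[leb1]_(x in I01) (g x + M)%:E = M%:E)%E.
  move=> mg gM g0.
  have gi : leb1.-integrable I01 (EFin \o g).
    apply: (moment_integrable mI lebesgue_unit_itv_fin (p := 0) mg).
    exact: (moment_bounded mI lebesgue_unit_itv_fin 1 gM mg).
  under eq_integral do rewrite EFinD.
  rewrite (integralD mI gi) ?c1; last first.
    exact: continuous_integrable01 (@cst_continuous _ _ M).
  by rewrite -(fineK (integrable_fin_num mI gi)) -/(Rintegral _ _ _) g0 add0e.
have hM : (\int[leb2]_(x in Q) h x = M%:E)%E.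
  case: f0 => f0.
    have := tonelli_on leb1 leb1 mI mI mh h0.
    rewrite -(tonelli_on1 leb1 leb1 mI mI mh h0) => ->.
    rewrite -[RHS]c1; apply: eq_integral => y /set_mem Iy /=.
    rewrite -(slice (fun x => f (x, y)))//; last 2 first.
      by move=> x Ix; apply: fM.
      exact: f0.
      by apply: eq_integral => x /set_mem Ix; rewrite hE.
    exact: measurableT_comp mf _.
  rewrite (tonelli_on1 leb1 leb1 mI mI mh h0).
  rewrite -[RHS]c1; apply: eq_integral => x /set_mem Ix /=.
  rewrite -(slice (fun y => f (x, y)))//; last 2 first.
    by move=> y Iy; apply: fM.
    exact: f0.
    by apply: eq_integral => y /set_mem Iy; rewrite hE.
  exact: measurableT_comp mf _.
have : (\int[leb2]_(x in Q) h x = \int[leb2]_(x in Q) (f x)%:E + M%:E)%E.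
  transitivity (\int[leb2]_(x in Q) ((f x)%:E + M%:E))%E.
    by apply: eq_integral => x /set_mem Qx; rewrite hE.
  rewrite (integralD measurable_unit_square fi); last first.
    exact: continuous2_integrable (@cst_continuous _ _ M).
  congr (_ + _)%E; rewrite integral_cst//=; last exact: measurable_unit_square.
  by transitivity (M%:E * 1)%E; [congr (_ * _)%E; exact: lebesgue_unit_square|rewrite mule1].
rewrite hM -(fineK (integrable_fin_num measurable_unit_square fi)) -/(Rintegral _ _ _).
by rewrite -EFinD => -[] /(congr1 (fun y => y - M)); rewrite addrK subrr => <-.
Qed.

Definition angle (k : int * int) (x : R * R) : R :=
  k.1%:~R * (2 * pi) * x.1 + k.2%:~R * (2 * pi) * x.2.

Definition chr (k : int * int) (x : R * R) : R[i] := cis (angle k x).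

Lemma angleD k l x : angle (k + l) x = angle k x + angle l x.
Proof. by rewrite /angle /= !rmorphD /=; ring. Qed.

Lemma angleN k x : angle (- k) x = - angle k x.
Proof. by rewrite /angle /= !rmorphN /=; ring. Qed.

Lemma chrD k l x : chr (k + l) x = chr k x * chr l x.
Proof. by rewrite /chr angleD cisD. Qed.

Lemma star_chr b k x : star b (chr k x) = chr (sg2 b k) x.
Proof. by case: b; rewrite /star /sg2 /chr // angleN -cis_conj. Qed.

Lemma cmod_chr k x : cmod (chr k x) = 1.
Proof. exact: cis_norm. Qed.

Lemma measurable_angle k : measurable_fun setT (angle k : (mR * mR)%type -> R).
Proof.
by apply: measurable_funD; apply: measurable_funM.
Qed.

Lemma measurable_cos : measurable_fun setT (cos : mR -> R).
Proof. exact: (continuous_measurable_fun (@continuous_cos R)). Qed.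

Lemma measurable_sin : measurable_fun setT (sin : mR -> R).
Proof. exact: (continuous_measurable_fun (@continuous_sin R)). Qed.

Lemma cmeasurable_cis d (T : measurableType d) (a : T -> R) : measurable_fun setT a ->
  cmeasurable (fun x => cis (a x)).
Proof. by move=> ma; split; [exact: measurableT_comp measurable_cos ma|exact:
  measurableT_comp measurable_sin ma]. Qed.

Lemma cmeasurable_chr k : cmeasurable (chr k : (mR * mR)%type -> R[i]).
Proof. exact: cmeasurable_cis (measurable_angle k). Qed.

Lemma Rintegral_cos_angle k c : \int[leb2]_(x in Q) cos (angle k x + c) = (k == 0)%:R * cos c.
Proof.
have mf : measurable_fun setT (fun x : (mR * mR)%type => cos (angle k x + c)).
  apply: (measurableT_comp measurable_cos); apply: measurable_funD => //; exact: measurable_angle.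
have fM (x : R * R) : Q x -> `|cos (angle k x + c)| <= 1 by rewrite cos_max.
have [->|k0] := eqVneq k 0.
  rewrite mul1r; under eq_Rintegral do rewrite /angle /= !mul0r !add0r.
  rewrite Rintegral_cst; last exact: measurable_unit_square.
  transitivity (cos c * fine (1%E : \bar R)); last by rewrite mulr1.
  by congr (_ * fine _); exact: lebesgue_unit_square.
rewrite mul0r; apply: (Rintegral_square_eq0 mf fM).
move: k0; rewrite -pair_eqE negb_and /= => /orP[k0|k0]; [left=> x2 _|right=> x1 _].
  have := Rintegral_cos_period k.1 (k.2%:~R * (2 * pi) * x2 + c); rewrite (negbTE k0) mul0r => e.
  by rewrite -[RHS]e; apply: eq_Rintegral => t _; rewrite /angle /= addrA.
have := Rintegral_cos_period k.2 (k.1%:~R * (2 * pi) * x1 + c); rewrite (negbTE k0) mul0r => e.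
rewrite -[RHS]e; apply: eq_Rintegral => t _; congr cos; rewrite /angle /=; ring.
Qed.

Lemma cintegral_chr k : cintegral leb2 Q (chr k) = (k == 0)%:R.
Proof.
rewrite /cintegral /chr /cis /=.
have e1 : \int[leb2]_(x in Q) cos (angle k x) = (k == 0)%:R.
  transitivity ((k == 0)%:R * cos 0 : R); last by rewrite cos0 mulr1.
  rewrite -Rintegral_cos_angle.
  by apply: eq_Rintegral => x _; rewrite addr0.
have e2 : \int[leb2]_(x in Q) sin (angle k x) = 0.
  transitivity ((k == 0)%:R * cos (- (pi / 2)) : R); last by rewrite cosN cos_pihalf mulr0.
  rewrite -Rintegral_cos_angle.
  by apply: eq_Rintegral => x _; rewrite cosBpihalf.
rewrite e1 e2; by case: (k == 0).
Qed.

Lemma cintegrable_mul d (T : measurableType d) (mu : {measure set T -> \bar R}) (D : set T)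
    (f g : T -> R[i]) (M : R) : measurable D -> cmeasurable f -> cmeasurable g ->
  cintegrable mu D f -> (forall x, D x -> cmod (g x) <= M) -> cintegrable mu D (fun x => f x * g x).
Proof.
move=> mD mf mg [f1 f2] gM.
have a1 := integrable_norm f1; have a2 := integrable_norm f2.
have [h _] := Rintegral_comb mD M M a1 a2.
apply: (cintegrable_le mD (cmeasurableM mf mg) h) => x Dx.
rewrite cmodM mulrC -mulrDr; apply: ler_pM; rewrite ?cmod_ge0 ?gM//.
exact: cmod_le.
Qed.

Lemma cintegrable_bounded (f : (mR * mR)%type -> R[i]) M : cmeasurable f ->
  (forall x, Q x -> cmod (f x) <= M) -> cintegrable leb2 Q f.
Proof.
move=> mf fM; apply: (cintegrable_le measurable_unit_square mf _ fM).
exact: (continuous2_integrable (@cst_continuous _ _ M)).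
Qed.

Lemma cintegrable_chr k : cintegrable leb2 Q (chr k).
Proof.
apply: (cintegrable_bounded (M := 1)) => [|x _]; first exact: cmeasurable_chr.
by rewrite cmod_chr.
Qed.

Lemma cintegral_trig (I : Type) (s : seq I) (P : pred I) (a : I -> R[i]) (k : I -> int * int) :
  cintegral leb2 Q (fun x => \sum_(i <- s | P i) a i * chr (k i) x) =
  \sum_(i <- s | P i) a i * (k i == 0)%:R.
Proof.
have mQ := @measurable_unit_square R.
have [_ ->] := @cintegral_sum _ _ _ leb2 Q mQ I s P (fun i x => a i * chr (k i) x)
  (fun i => (cintegralZ mQ (a i) (cintegrable_chr (k i))).1).
by apply: eq_bigr => i _; rewrite (cintegralZ mQ (a i) (cintegrable_chr (k i))).2 cintegral_chr.
Qed.

Definition coef (f : R * R -> R[i]) (k : int * int) : R[i] :=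
  cintegral leb2 Q (fun x => f x * chr (- k) x).

Lemma cintegrable_coef (f : (mR * mR)%type -> R[i]) k : cmeasurable f -> cintegrable leb2 Q f ->
  cintegrable leb2 Q (fun x => f x * chr k x).
Proof.
move=> mf fi; apply: (cintegrable_mul (M := 1) measurable_unit_square mf _ fi).
  exact: cmeasurable_chr.
by move=> x _; rewrite cmod_chr.
Qed.

Lemma bessel (f : (mR * mR)%type -> R[i]) (s : seq (int * int)) : uniq s -> cmeasurable f ->
  cintegrable leb2 Q f -> leb2.-integrable Q (EFin \o (fun x => cmod (f x) ^+ 2)) ->
  \sum_(k <- s) cmod (coef f k) ^+ 2 <= \int[leb2]_(x in Q) (cmod (f x) ^+ 2).
Proof.
move=> us mf fi f2i.
have mQ := @measurable_unit_square R.
set S := \sum_(k <- s) _.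
pose g (x : R * R) : R[i] := \sum_(k <- s) coef f k * chr k x.
have mg : cmeasurable (g : (mR * mR)%type -> R[i]).
  by apply: cmeasurable_sum => k; apply: cmeasurableZ; exact: cmeasurable_chr.
have gg x : g x * (g x)^*%C =
    \sum_(p <- [seq (k, l) | k <- s, l <- s]) (coef f p.1 * (coef f p.2)^*%C) * chr (p.1 - p.2) x.
  rewrite /g conj_sum mulr_suml big_allpairs; apply: eq_bigr => k _.
  rewrite mulr_sumr; apply: eq_bigr => l _.
  by rewrite conjM chrD -[chr (- l) x](star_chr true) /star /=; ring.
have Igg : cintegral leb2 Q (fun x => g x * (g x)^*%C) = S%:C.
  rewrite (eq_cintegral leb2 (fun x _ => gg x)) cintegral_trig big_allpairs /S rmorph_sum /=.
  apply: eq_big_seq => k ks; rewrite (bigD1_seq k)//= subrr eqxx mulr1 mul_conj big1 ?addr0// => l kl.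
  by rewrite subr_eq0 eq_sym (negbTE kl) mulr0.
have fg x : f x * (g x)^*%C = \sum_(k <- s) (coef f k)^*%C * (f x * chr (- k) x).
  rewrite /g conj_sum mulr_sumr; apply: eq_bigr => k _.
  by rewrite conjM -[chr (- k) x](star_chr true) /star; ring.
have hk k : cintegrable leb2 Q (fun x => (coef f k)^*%C * (f x * chr (- k) x)).
  exact: (cintegralZ mQ _ (cintegrable_coef _ mf fi)).1.
have [fgi Ifg0] := @cintegral_sum _ _ _ leb2 Q mQ _ s xpredT _ hk.
have Ifg : cintegral leb2 Q (fun x => f x * (g x)^*%C) = S%:C.
  rewrite (eq_cintegral leb2 (fun x _ => fg x)) Ifg0 /S rmorph_sum /=; apply: eq_bigr => k _.
  by rewrite (cintegralZ mQ _ (cintegrable_coef _ mf fi)).2 mulrC mul_conj.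
have := congr1 (@complex.Re R) Igg; have := congr1 (@complex.Re R) Ifg; rewrite /= => e1 e2.
have ggi : cintegrable leb2 Q (fun x => g x * (g x)^*%C).
  rewrite (funext gg).
  exact: (@cintegral_sum _ _ _ leb2 Q mQ _ _ xpredT (fun (p : (int * int) * (int * int)) x =>
    (coef f p.1 * (coef f p.2)^*%C) * chr (p.1 - p.2) x)
    (fun p => (cintegralZ mQ _ (cintegrable_chr (p.1 - p.2))).1)).1.
have fgi' : cintegrable leb2 Q (fun x => f x * (g x)^*%C) by rewrite (funext fg).
have [i1 _] := fgi'; have [i2 _] := ggi.
have [h1 E1] := Rintegral_comb mQ 2 0 i1 i1; have [h2 E2] := Rintegral_comb mQ 1 1 f2i i2.
have : \int[leb2]_(x in Q) (2 * complex.Re (f x * (g x)^*%C) + 0 * complex.Re (f x * (g x)^*%C)) <=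
       \int[leb2]_(x in Q) (1 * cmod (f x) ^+ 2 + 1 * complex.Re (g x * (g x)^*%C)).
  by apply: le_Rintegral => // x _; rewrite mul0r addr0 !mul1r; exact: Re_mul_conj_le.
by rewrite E1 E2 e1 e2 !mul1r mul0r addr0 -lerBlDr mulr_natl mulr2n addrK.
Qed.

Definition freqs (n : nat) : seq (int * int) :=
  [seq (i%:Z - n%:Z, j%:Z - n%:Z) | i <- iota 0 (2 * n).+1, j <- iota 0 (2 * n).+1].

(** The Fourier coefficients of the product kernel. For [k] in [freqs n] the shift by [n] is
    nonnegative, so [absz] just recovers the binomial index. *)
Definition freq_weight (n : nat) (k : int * int) : R :=
  vp_coef n (absz (k.1 + n%:Z)) * vp_coef n (absz (k.2 + n%:Z)).

Lemma uniq_freqs n : uniq (freqs n).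
Proof.
apply: allpairs_uniq; rewrite ?iota_uniq// => -[i j] [k l] _ _ /= [e1 e2].
by congr (_, _); lia.
Qed.

Lemma freq_weight_ge0 n k : 0 <= freq_weight n k.
Proof. by rewrite mulr_ge0// divr_ge0. Qed.

(** Below the middle the coefficients increase, by induction on the distance to [n]; symmetry covers
    the upper half. It makes the multipliers of [proj] at most 1. *)
Lemma bin_le_central n i : ('C(2 * n, i) <= 'C(2 * n, n))%N.
Proof.
have up j : (j <= n)%N -> ('C(2 * n, j) <= 'C(2 * n, n))%N.
  move=> jn; rewrite -(subKn jn); elim: (n - j)%N (leq_subr j n) => [|m IH] mn; first by rewrite subn0.
  apply: leq_trans (IH (ltnW mn)).
  have e := mul_bin_left (2 * n) (n - m.+1); have e' : (n - m.+1).+1 = (n - m)%N by lia.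
  rewrite e' in e; rewrite -(@leq_pmul2l (n - m)) ?subn_gt0// e leq_mul2r.
  by apply/orP; right; clear -mn; lia.
have [/up//|ni] := leqP i n.
have [i2n|i2n] := leqP i (2 * n); last by rewrite bin_small.
by rewrite -bin_sub//; apply: up; lia.
Qed.

Lemma freq_weight_le1 n k : freq_weight n k <= 1.
Proof.
have h i : 0 <= (vp_coef n i : R) <= 1.
  rewrite divr_ge0//= ler_pdivrMr ?mul1r ?ler_nat ?bin_le_central//.
  exact: central_binomial_gt0.
by rewrite -[leRHS]mulr1; apply: ler_pM; have /andP[] := h (absz (k.1 + n%:Z));
  have /andP[] := h (absz (k.2 + n%:Z)).
Qed.

Lemma vpk2_chr n (x y : R * R) : (vpk2 n (x, y))%:C =
  \sum_(k <- freqs n) (freq_weight n k)%:C * (chr k x * chr (- k) y).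
Proof.
rewrite /freqs big_allpairs_dep rmorphM /= /vpk !vp_cis.
rewrite -!(big_mkord xpredT (fun i => (vp_coef n i)%:C * cis ((i%:Z - n%:Z)%:~R * (2 * pi) * _))).
rewrite /index_iota subn0 mulr_suml; apply: eq_bigr => i _.
rewrite mulr_sumr; apply: eq_bigr => j _.
have -> : (freq_weight n (i%:Z - n%:Z, j%:Z - n%:Z))%:C = (vp_coef n i)%:C * (vp_coef n j)%:C.
  by rewrite /freq_weight /= !subrK !absz_nat; simpc.
rewrite mulrACA; congr (_ * _).
rewrite /chr -!cisD; congr cis; rewrite angleN /angle /=; ring.
Qed.

Definition proj (n : nat) (f : R * R -> R[i]) (x : R * R) : R[i] :=
  \sum_(k <- freqs n) (freq_weight n k)%:C * coef f k * chr k x.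

(** The two faces of the averages: a Fourier multiplier, which commutes with the evolution, and a
    positive kernel, which converges in L^p. *)
Lemma proj_mop n (f : (mR * mR)%type -> R[i]) x : cmeasurable f -> cintegrable leb2 Q f ->
  proj n f x = mop leb2sf Q (vpk2 n) (fun y => complex.Re (f y)) x
            +i* mop leb2sf Q (vpk2 n) (fun y => complex.Im (f y)) x.
Proof.
move=> mf fi; have mQ := @measurable_unit_square R.
transitivity (cintegral leb2 Q (fun y => (vpk2 n (x, y))%:C * f y)); last first.
  have e1 : (fun y => complex.Re ((vpk2 n (x, y))%:C * f y)) = fun y => vpk2 n (x, y) * complex.Re (f y).
    by apply/funext => y; rewrite cReM /= mul0r subr0.
  have e2 : (fun y => complex.Im ((vpk2 n (x, y))%:C * f y)) = fun y => vpk2 n (x, y) * complex.Im (f y).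
    by apply/funext => y; rewrite cImM /= mul0r addr0.
  by rewrite /cintegral e1 e2.
have e y : (vpk2 n (x, y))%:C * f y =
    \sum_(k <- freqs n) ((freq_weight n k)%:C * chr k x) * (f y * chr (- k) y).
  by rewrite vpk2_chr mulr_suml; apply: eq_bigr => k _; ring.
rewrite (eq_cintegral leb2 (fun y _ => e y)).
have hk k : cintegrable leb2 Q (fun y => (freq_weight n k)%:C * chr k x * (f y * chr (- k) y)).
  exact: (cintegralZ mQ _ (cintegrable_coef _ mf fi)).1.
have [_ ->] := @cintegral_sum _ _ _ leb2 Q mQ _ (freqs n) xpredT _ hk.
apply: eq_bigr => k _.
by rewrite (cintegralZ mQ _ (cintegrable_coef _ mf fi)).2 mulrAC.
Qed.

End torus_integrals.

(** * Evolution of the Fourier modes *)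

Section waves.
Context {R : realType}.
Local Notation leb1 := (@lebesgue_measure R).
Local Notation leb2 := (leb1 \x leb1)%E.
Local Notation I01 := (unit_itv (R := R)).
Local Notation Q := (unit_square (R := R)).
Implicit Types (f psi : R * R -> R) (k : int * int).

Lemma derive_fst_quotient f (x1 x2 : R) :
  (fun h : R => h^-1 *: ((f \o shift (x1, x2)) (h *: ((1 : R), (0 : R))) - f (x1, x2))) =
  (fun h : R => h^-1 *: (((fun s => f (s, x2)) \o shift x1) (h *: (1 : R)) - f (x1, x2))).
Proof.
apply/funext => h; congr (_ *: (f _ - _)); rewrite /shift /=.
by rewrite (_ : h *: (1, 0) + (x1, x2) = (h *: 1 + x1, h *: 0 + x2))// scaler0 add0r.
Qed.

Lemma derive_snd_quotient f (x1 x2 : R) :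
  (fun h : R => h^-1 *: ((f \o shift (x1, x2)) (h *: ((0 : R), (1 : R))) - f (x1, x2))) =
  (fun h : R => h^-1 *: (((fun s => f (x1, s)) \o shift x2) (h *: (1 : R)) - f (x1, x2))).
Proof.
apply/funext => h; congr (_ *: (f _ - _)); rewrite /shift /=.
by rewrite (_ : h *: (0, 1) + (x1, x2) = (h *: 0 + x1, h *: 1 + x2))// scaler0 add0r.
Qed.

Lemma is_derive_fst f x d : is_derive x.1 (1 : R) (fun s => f (s, x.2)) d ->
  derivable f x (1, 0) /\ dx1 f x = d.
Proof.
case: x => x1 x2 /= [df <-]; split.
  by rewrite /derivable derive_fst_quotient; exact: df.
by rewrite /dx1 /derive derive_fst_quotient.
Qed.

Lemma is_derive_snd f x d : is_derive x.2 (1 : R) (fun s => f (x.1, s)) d ->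
  derivable f x (0, 1) /\ dx2 f x = d.
Proof.
case: x => x1 x2 /= [df <-]; split.
  by rewrite /derivable derive_snd_quotient; exact: df.
by rewrite /dx2 /derive derive_snd_quotient.
Qed.

Lemma derivable_fst f (x1 x2 : R) : derivable f (x1, x2) (1, 0) ->
  is_derive x1 (1 : R) (fun s => f (s, x2)) (dx1 f (x1, x2)).
Proof.
move=> df; split; last by rewrite /dx1 /derive derive_fst_quotient.
by rewrite /derivable -derive_fst_quotient.
Qed.

Lemma derivable_snd f (x1 x2 : R) : derivable f (x1, x2) (0, 1) ->
  is_derive x2 (1 : R) (fun s => f (x1, s)) (dx2 f (x1, x2)).
Proof.
move=> df; split; last by rewrite /dx2 /derive derive_snd_quotient.
by rewrite /derivable -derive_snd_quotient.
Qed.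

Lemma periodic2_derive f (v : R * R) : periodic2 f -> periodic2 (fun x => 'D_v f x).
Proof.
move=> pf; have E (e x : R * R) : (forall y, f (y + e) = f y) -> 'D_v f (x + e) = 'D_v f x.
  move=> fe; rewrite /derive.
  have e1 : (fun h : R => h^-1 *: ((f \o shift (x + e)) (h *: v) - f (x + e))) =
            (fun h : R => h^-1 *: ((f \o shift x) (h *: v) - f x)).
    by apply/funext => h; rewrite /shift /= addrA !fe.
  by rewrite e1.
have s1 (y : R * R) : (y.1 + 1, y.2) = y + (1, 0) by case: y => a b /=; rewrite -[X in (_, X)](addr0 b).
have s2 (y : R * R) : (y.1, y.2 + 1) = y + (0, 1) by case: y => a b /=; rewrite -[X in (X, _)](addr0 a).
move=> x; split; rewrite ?s1 ?s2; apply: E => y; rewrite -?s1 -?s2; first by have [] := pf y.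
by have [] := pf y.
Qed.

(** Differentiation only changes the amplitude and shifts the phase by [pi / 2], so the class is
    closed under [dx1] and [dx2]. The phases 0 and [- (pi / 2)] give the real and imaginary parts of
    [chr k]. *)
Definition wave (A : R) k (c : R) : R * R -> R := fun x => A * cos (angle k x + c).

Lemma continuous_wave A k c : continuous (wave A k c).
Proof.
move=> x; rewrite /wave.
apply: (@continuousM _ _ (fun=> A) (fun x => cos (angle k x + c))); first exact: cst_continuous.
apply: (@continuous_comp _ _ _ (fun x => angle k x + c) cos); last exact: continuous_cos.
apply: (@continuousD _ _ _ (angle k) (fun=> c)); last exact: cst_continuous.
apply: (@continuousD _ _ _ (fun x : R * R => k.1%:~R * (2 * pi) * x.1)
  (fun x : R * R => k.2%:~R * (2 * pi) * x.2)).
  apply: (@continuousM _ _ (fun=> k.1%:~R * (2 * pi)) fst); first exact: cst_continuous.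
  exact: cvg_fst.
apply: (@continuousM _ _ (fun=> k.2%:~R * (2 * pi)) snd); first exact: cst_continuous.
exact: cvg_snd.
Qed.

Lemma wave_dx1 A k c : (forall x, derivable (wave A k c) x (1, 0)) /\
  dx1 (wave A k c) = wave (A * (k.1%:~R * (2 * pi))) k (c + pi / 2).
Proof.
suff h x : derivable (wave A k c) x (1, 0) /\
    dx1 (wave A k c) x = wave (A * (k.1%:~R * (2 * pi))) k (c + pi / 2) x.
  by split=> [x|]; [exact: (h x).1|apply/funext => x; exact: (h x).2].
apply: is_derive_fst.
have h := is_deriveZ A (is_derive_cos_affine (k.1%:~R * (2 * pi)) (k.2%:~R * (2 * pi) * x.2 + c) x.1).
have e s : k.1%:~R * (2 * pi) * s + (k.2%:~R * (2 * pi) * x.2 + c) = angle k (s, x.2) + c.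
  by rewrite /angle /=; ring.
rewrite (_ : (fun s => _) = (A *: (fun t => cos (k.1%:~R * (2 * pi) * t + (k.2%:~R * (2 * pi)
  * x.2 + c))))).
  by apply: (is_derive_eq h); rewrite e /wave (addrA (angle k x)) cosDpihalf /GRing.scale /=
    -surjective_pairing; ring.
by apply/funext => s; rewrite /wave -e.
Qed.

Lemma wave_dx2 A k c : (forall x, derivable (wave A k c) x (0, 1)) /\
  dx2 (wave A k c) = wave (A * (k.2%:~R * (2 * pi))) k (c + pi / 2).
Proof.
suff h x : derivable (wave A k c) x (0, 1) /\
    dx2 (wave A k c) x = wave (A * (k.2%:~R * (2 * pi))) k (c + pi / 2) x.
  by split=> [x|]; [exact: (h x).1|apply/funext => x; exact: (h x).2].
apply: is_derive_snd.
have h := is_deriveZ A (is_derive_cos_affine (k.2%:~R * (2 * pi)) (k.1%:~R * (2 * pi) * x.1 + c) x.2).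
have e s : k.2%:~R * (2 * pi) * s + (k.1%:~R * (2 * pi) * x.1 + c) = angle k (x.1, s) + c.
  by rewrite /angle /=; ring.
rewrite (_ : (fun s => _) = (A *: (fun t => cos (k.2%:~R * (2 * pi) * t + (k.1%:~R * (2 * pi)
  * x.1 + c))))).
  by apply: (is_derive_eq h); rewrite e /wave (addrA (angle k x)) cosDpihalf /GRing.scale /=
    -surjective_pairing; ring.
by apply/funext => s; rewrite /wave -e.
Qed.

Lemma cis_2pi_int (m : int) (a : R) : cis (m%:~R * (2 * pi) + a) = cis a.
Proof. by rewrite /cis cos_2pi_int sin_2pi_int. Qed.

Lemma angle_period1 k (x : R * R) : angle k (x.1 + 1, x.2) = k.1%:~R * (2 * pi) + angle k x.
Proof. by rewrite /angle /=; ring. Qed.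

Lemma angle_period2 k (x : R * R) : angle k (x.1, x.2 + 1) = k.2%:~R * (2 * pi) + angle k x.
Proof. by rewrite /angle /=; ring. Qed.

Lemma test_fun_wave A k c : test_fun (wave A k c).
Proof.
split=> [x|n].
  by rewrite /wave angle_period1 angle_period2 -!addrA !cos_2pi_int.
elim: n A c => [|n IH] A c; first by split=> //; exact: continuous_wave.
split; first exact: continuous_wave.
have [d1 e1] := wave_dx1 A k c; have [d2 e2] := wave_dx2 A k c.
by split=> //; rewrite ?e1 ?e2; exact: IH.
Qed.

Definition eigen k : R := - (4 * pi ^+ 2 * (dot k k)%:~R).

Lemma laplacian_wave k c : laplacian (wave 1 k c) = fun x => eigen k * wave 1 k c x.
Proof.
apply/funext => x; rewrite /laplacian.
rewrite (wave_dx1 1 k c).2 (wave_dx1 _ k _).2 (wave_dx2 1 k c).2 (wave_dx2 _ k _).2.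
rewrite /wave !addrA !cosDpihalf sinDpihalf /eigen /dot rmorphD !rmorphM /=; ring.
Qed.

(** With [a] for [2 pi m], the integrand is the derivative of [H t = cos (a t + c) g' t + a sin (a t
    + c) g t], which takes equal values at 0 and 1. *)
Lemma by_parts_period (g g' g'' : R -> R) (m : int) c :
  (forall t : R, is_derive t 1 g (g' t)) -> (forall t : R, is_derive t 1 g' (g'' t)) ->
  continuous g'' -> g 1 = g 0 -> g' 1 = g' 0 ->
  \int[leb1]_(t in I01) (cos (m%:~R * (2 * pi) * t + c) * (g'' t + (m%:~R * (2 * pi)) ^+ 2 * g t)) = 0.
Proof.
move=> dg dg' cg'' g1 g1'; set a := m%:~R * (2 * pi).
have cg : continuous g.
  by move=> t; apply: differentiable_continuous; apply/derivable1_diffP; have [] := dg t.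
pose H (t : R) := cos (a * t + c) * g' t + (a * sin (a * t + c)) * g t.
have cH : continuous (fun t => cos (a * t + c) * (g'' t + a ^+ 2 * g t)).
  move=> t; apply: (@continuousM _ _ (fun t => cos (a * t + c)) (fun t => g'' t + a ^+ 2 * g t)).
    exact: continuous_cos_affine.
  apply: (@continuousD _ _ _ g'' (fun t => a ^+ 2 * g t)); first exact: cg''.
  apply: (@continuousM _ _ (fun=> a ^+ 2) g); first exact: cst_continuous.
  exact: cg.
have dH (t : R) : is_derive t 1 H (cos (a * t + c) * (g'' t + a ^+ 2 * g t)).
  have h1 := is_deriveM (is_derive_cos_affine a c t) (dg' t).
  have h2 := is_deriveM (is_deriveZ a (is_derive_sin_affine a c t)) (dg t).
  apply: (is_derive_eq (is_deriveD h1 h2)); rewrite /GRing.scale /=.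
  rewrite (_ : a *: sin (a * t + c) = a * sin (a * t + c))//; ring.
rewrite (Rintegral01_FTC cH dH) /H g1 g1' mulr1 mulr0 add0r.
have -> : cos (a + c) = cos c by exact: cos_2pi_int.
have -> : sin (a + c) = sin c by exact: sin_2pi_int.
by rewrite subrr.
Qed.

Lemma continuous_fst_slice f (x2 : R) : continuous f -> continuous (fun s : R => f (s, x2)).
Proof.
move=> cf s; apply: (@continuous_comp _ _ _ (fun s : R => (s, x2)) f); last exact: cf.
apply: (@cvg_pair _ _ _ (nbhs s) (nbhs s) (nbhs x2) _ _ _ (fun s => s) (fun=> x2)); first exact: cvg_id.
exact: cvg_cst.
Qed.

Lemma continuous_snd_slice f (x1 : R) : continuous f -> continuous (fun s : R => f (x1, s)).
Proof.
move=> cf s; apply: (@continuous_comp _ _ _ (fun s : R => (x1, s)) f); last exact: cf.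
apply: (@cvg_pair _ _ _ (nbhs s) (nbhs x1) (nbhs s) _ _ _ (fun=> x1) (fun s => s)); last exact: cvg_id.
exact: cvg_cst.
Qed.

Lemma continuous_cos_angle k c : continuous (fun x : R * R => cos (angle k x + c)).
Proof.
have := @continuous_wave 1 k c; rewrite (_ : wave 1 k c = fun x => cos (angle k x + c))//.
by apply/funext => x; rewrite /wave mul1r.
Qed.

Lemma continuous_cos_angle_mul k (c : R) f : continuous f ->
  continuous (fun x : R * R => cos (angle k x + c) * f x).
Proof.
move=> cf x; apply: (@continuousM _ _ (fun x => cos (angle k x + c)) f); last exact: cf.
exact: continuous_cos_angle.
Qed.

Lemma test_fun_continuous psi : test_fun psi -> continuous psi.
Proof. by case=> _ /(_ 0) []. Qed.

Lemma Rintegral_by_parts1 psi k c : test_fun psi ->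
  \int[leb2]_(x in Q) (cos (angle k x + c) * (dx1 (dx1 psi) x + (k.1%:~R * (2 * pi)) ^+ 2 * psi x)) = 0.
Proof.
move=> tpsi; have cpsi := test_fun_continuous tpsi.
have [pp /(_ 2) /= [_ [d1 _ [_ [d11 _ [c11 _] _]] _]]] := tpsi.
have pd : periodic2 (dx1 psi) := periodic2_derive (1, 0) pp.
have cA : continuous (fun x => cos (angle k x + c) * (dx1 (dx1 psi) x + (k.1%:~R * (2 * pi)) ^+
  2 * psi x)).
  apply: continuous_cos_angle_mul => x.
  apply: (@continuousD _ _ _ (dx1 (dx1 psi)) (fun x => (k.1%:~R * (2 * pi)) ^+ 2 * psi x));
    first exact: c11.
  apply: (@continuousM _ _ (fun=> (k.1%:~R * (2 * pi)) ^+ 2) psi); first exact: cst_continuous.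
  exact: cpsi.
have [M HM] := continuous2_bounded cA.
apply: (Rintegral_square_eq0 (continuous2_measurable cA) HM); left=> x2 _.
have p1 (h : R * R -> R) : periodic2 h -> h (1, x2) = h (0, x2).
  by move=> /(_ (0, x2)) [+ _]; rewrite /= add0r.
rewrite -[RHS](@by_parts_period (fun s => psi (s, x2)) (fun s => dx1 psi (s, x2))
  (fun s => dx1 (dx1 psi) (s, x2)) k.1 (k.2%:~R * (2 * pi) * x2 + c)).
- by apply: eq_Rintegral => t _; rewrite /angle /= addrA.
- by move=> t; apply: derivable_fst.
- by move=> t; apply: derivable_fst.
- exact: continuous_fst_slice.
- exact: p1.
- exact: p1.
Qed.

Lemma Rintegral_by_parts2 psi k c : test_fun psi ->
  \int[leb2]_(x in Q) (cos (angle k x + c) * (dx2 (dx2 psi) x + (k.2%:~R * (2 * pi)) ^+ 2 * psi x)) = 0.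
Proof.
move=> tpsi; have cpsi := test_fun_continuous tpsi.
have [pp /(_ 2) /= [_ [_ d2 _ [_ [_ d22 _ [c22 _]]]]]] := tpsi.
have pd : periodic2 (dx2 psi) := periodic2_derive (0, 1) pp.
have cA : continuous (fun x => cos (angle k x + c) * (dx2 (dx2 psi) x + (k.2%:~R * (2 * pi)) ^+
  2 * psi x)).
  apply: continuous_cos_angle_mul => x.
  apply: (@continuousD _ _ _ (dx2 (dx2 psi)) (fun x => (k.2%:~R * (2 * pi)) ^+ 2 * psi x));
    first exact: c22.
  apply: (@continuousM _ _ (fun=> (k.2%:~R * (2 * pi)) ^+ 2) psi); first exact: cst_continuous.
  exact: cpsi.
have [M HM] := continuous2_bounded cA.
apply: (Rintegral_square_eq0 (continuous2_measurable cA) HM); right=> x1 _.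
have p1 (h : R * R -> R) : periodic2 h -> h (x1, 1) = h (x1, 0).
  by move=> /(_ (x1, 0)) [_ +]; rewrite /= add0r.
rewrite -[RHS](@by_parts_period (fun s => psi (x1, s)) (fun s => dx2 psi (x1, s))
  (fun s => dx2 (dx2 psi) (x1, s)) k.2 (k.1%:~R * (2 * pi) * x1 + c)).
- by apply: eq_Rintegral => t _; congr (cos _ * _); rewrite /angle /=; ring.
- by move=> t; apply: derivable_snd.
- by move=> t; apply: derivable_snd.
- exact: continuous_snd_slice.
- exact: p1.
- exact: p1.
Qed.

Lemma test_fun_laplacian_continuous psi : test_fun psi -> continuous (laplacian psi).
Proof.
move=> [_ /(_ 2) /= [_ [_ _ [_ [_ _ [c11 _] _]] [_ [_ _ _ [c22 _]]]]]] x.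
by apply: (@continuousD _ _ _ (dx1 (dx1 psi)) (dx2 (dx2 psi))); [exact: c11|exact: c22].
Qed.

Lemma Rintegral_by_parts psi k c : test_fun psi ->
  \int[leb2]_(x in Q) (cos (angle k x + c) * laplacian psi x) =
  eigen k * \int[leb2]_(x in Q) (cos (angle k x + c) * psi x).
Proof.
have key (a b X Y Z : R) : 0 = 1 * X + a * Z -> 0 = 1 * Y + b * Z -> 1 * X + 1 * Y = - (a + b) * Z.
  by move=> h1 h2; lra.
move=> tpsi; have cpsi := test_fun_continuous tpsi.
have [_ /(_ 2) /= [_ [_ _ [_ [_ _ [c11 _] _]] [_ [_ _ _ [c22 _]]]]]] := tpsi.
have mQ := @measurable_unit_square R.
have i1 := continuous2_integrable (@continuous_cos_angle_mul k c _ c11).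
have i2 := continuous2_integrable (@continuous_cos_angle_mul k c _ c22).
have i0 := continuous2_integrable (@continuous_cos_angle_mul k c _ cpsi).
have [_ e1] := Rintegral_comb mQ 1 ((k.1%:~R * (2 * pi)) ^+ 2) i1 i0.
have [_ e2] := Rintegral_comb mQ 1 ((k.2%:~R * (2 * pi)) ^+ 2) i2 i0.
have [_ e3] := Rintegral_comb mQ 1 1 i1 i2.
have f1 := Rintegral_by_parts1 k c tpsi; have f2 := Rintegral_by_parts2 k c tpsi.
have -> : (fun x => cos (angle k x + c) * laplacian psi x) =
  (fun x => 1 * (cos (angle k x + c) * dx1 (dx1 psi) x) + 1 * (cos (angle k x + c) * dx2 (dx2 psi) x)).
  by apply/funext => x; rewrite /laplacian; ring.
rewrite e3; move: e1 e2.
rewrite (_ : (fun x => _) = fun x => cos (angle k x + c) * (dx1 (dx1 psi) x + (k.1%:~R * (2 * pi))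
  ^+ 2 * psi x)); last first.
  by apply/funext => x; ring.
rewrite f1 => e1'.
rewrite (_ : (fun x => 1 * _ + _) = fun x => cos (angle k x + c) * (dx2 (dx2 psi) x +
  (k.2%:~R * (2 * pi)) ^+ 2 * psi x)); last first.
  by apply/funext => x; ring.
rewrite f2 => e2'.
rewrite (key _ _ _ _ _ e1' e2'); congr (_ * _).
rewrite /eigen /dot rmorphD !rmorphM /=; ring.
Qed.

Lemma pairing_chr_laplacian psi k : test_fun psi ->
  pairing (chr k) (laplacian psi) = (eigen k)%:C * pairing (chr k) psi.
Proof.
move=> tpsi.
have E (h : R * R -> R) : pairing (chr k) h =
    (\int[leb2]_(x in Q) (cos (angle k x + 0) * h x)) +i* (\int[leb2]_(x in Q)
      (cos (angle k x - pi / 2) * h x)).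
  rewrite /pairing /cintegral; congr (_ +i* _); apply: eq_Rintegral => x _.
    by rewrite cReM /= mulr0 subr0 addr0.
  by rewrite cImM /= mulr0 add0r cosBpihalf.
by rewrite !E !Rintegral_by_parts//; simpc.
Qed.

End waves.

(** * Solutions, their Fourier coefficients and their linear combinations *)

Section evolution.
Context {R : realType}.
Local Notation leb1 := (@lebesgue_measure R).
Local Notation leb2 := (leb1 \x leb1)%E.
Local Notation mR := (measurableTypeR R).
Local Notation I01 := (unit_itv (R := R)).
Local Notation Q := (unit_square (R := R)).
Implicit Types (phi : R * R -> R[i]) (psi : R * R -> R) (k : int * int).

(** The equation says [p' = i l p]; [q1] and [q2] are the real and imaginary parts of [p t] rotated
    back by the angle [l t], and both have zero derivative. *)
Lemma complex_ode (p : R -> R[i]) (l : R) :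
  (forall t, exists2 v, is_cderive p t v & 'i%C * v + l%:C * p t = 0) ->
  forall t, p t = cis (l * t) * p 0.
Proof.
move=> hp.
pose a t := complex.Re (p t); pose b t := complex.Im (p t).
have dp (t : R) : is_derive t 1 a (- l * b t) /\ is_derive t 1 b (l * a t).
  have [v [d1 d2] e] := hp t.
  suff [e1 e2] : complex.Re v = - l * b t /\ complex.Im v = l * a t by rewrite -e1 -e2.
  move: e; rewrite /a /b; case: v {d1 d2} => v1 v2; case: (p t) => x y; simpc => -[e1 e2] /=.
  by split; lra.
pose q1 t := cos (l * t + 0) * a t + sin (l * t + 0) * b t.
pose q2 t := cos (l * t + 0) * b t - sin (l * t + 0) * a t.
have c1 t : q1 t = a 0.
  have d1 (x : R) : is_derive x 1 q1 0.
    have [da db] := dp x.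
    have h1 := is_deriveM (is_derive_cos_affine l 0 x) da.
    have h2 := is_deriveM (is_derive_sin_affine l 0 x) db.
    by apply: (is_derive_eq (is_deriveD h1 h2)); rewrite /GRing.scale /=; ring.
  by rewrite (is_derive_0_is_cst t 0 d1) /q1 mulr0 add0r cos0 sin0 mul1r mul0r addr0.
have c2 t : q2 t = b 0.
  have d2 (x : R) : is_derive x 1 q2 0.
    have [da db] := dp x.
    have h1 := is_deriveM (is_derive_cos_affine l 0 x) db.
    have h2 := is_deriveM (is_derive_sin_affine l 0 x) da.
    by apply: (is_derive_eq (is_deriveB h1 h2)); rewrite /GRing.scale /=; ring.
  by rewrite (is_derive_0_is_cst t 0 d2) /q2 mulr0 add0r cos0 sin0 mul1r mul0r subr0.
move=> t; have e1 := c1 t; have e2 := c2 t; move: e1 e2; rewrite /q1 /q2 addr0 => e1 e2.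
have cs := cos2Dsin2 (l * t).
have -> : p 0 = a 0 +i* b 0 by rewrite /a /b; case: (p 0).
rewrite /cis -e1 -e2; apply: complex_eq; rewrite ?cReM ?cImM /=.
  rewrite -/(a t) -[LHS]mul1r -cs; ring.
rewrite -/(b t) -[LHS]mul1r -cs; ring.
Qed.

Lemma ae_leb2S (P P' : (mR * mR)%type -> Prop) : (forall x, P x -> P' x) ->
  {ae leb2, forall x, P x} -> {ae leb2, forall x, P' x}.
Proof. by move=> PP'; apply: negligibleS; apply: subsetC => x; exact: PP'. Qed.

Lemma L2T_integrable phi : L2T phi -> cintegrable leb2 Q phi.
Proof.
move=> [_ mphi f2]; have mQ := @measurable_unit_square R.
have i : leb2.-integrable Q (EFin \o (fun x => cmod (phi x))).
  apply: (moment_integrable mQ lebesgue_unit_square_fin (p := 1) (measurable_cmod mphi)).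
  apply: le_lt_trans f2; rewrite le_eqVlt; apply/orP; left; apply/eqP.
  by apply: eq_integral => x _; rewrite ger0_norm ?cmod_ge0.
exact: (cintegrable_le mQ mphi i).
Qed.

Lemma L2T_pairing phi psi : L2T phi -> continuous psi ->
  cintegrable leb2 Q (fun x => phi x * (psi x)%:C).
Proof.
move=> Lphi cpsi; have [M HM] := continuous2_bounded cpsi.
have [_ mphi _] := Lphi.
apply: (cintegrable_mul (@measurable_unit_square R) mphi _ (L2T_integrable Lphi) (M := M)).
  apply: cmeasurable_real; exact: continuous2_measurable.
by move=> x Qx; rewrite cmod_real HM.
Qed.

Lemma pairingZr phi psi (c : R) : L2T phi -> continuous psi ->
  pairing phi (fun x => c * psi x) = c%:C * pairing phi psi.
Proof.
move=> Lphi cpsi.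
have e x : phi x * (c * psi x)%:C = c%:C * (phi x * (psi x)%:C).
  by rewrite rmorphM /=; ring.
rewrite /pairing (eq_cintegral leb2 (fun x _ => e x)).
by rewrite (cintegralZ (@measurable_unit_square R) _ (L2T_pairing Lphi cpsi)).2.
Qed.

Lemma coef_pairing phi k : L2T phi ->
  coef phi k = pairing phi (wave 1 k 0) - 'i%C * pairing phi (wave 1 k (- (pi / 2))).
Proof.
move=> Lphi; have mQ := @measurable_unit_square R.
have i1 := L2T_pairing Lphi (@continuous_wave _ 1 k 0).
have i2 := L2T_pairing Lphi (@continuous_wave _ 1 k (- (pi / 2))).
have [i3 e3] := cintegralZ mQ 'i%C i2.
have [_ e4] := cintegralB mQ i1 i3.
rewrite /pairing -e3 -e4 /coef; apply: eq_cintegral => x _.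
rewrite /chr angleN /wave addr0 !mul1r cosBpihalf /cis cosN sinN.
by case: (phi x) => a b; simpc; congr (_ +i* _); ring.
Qed.

(** The two real waves that make up a character are admissible test functions and eigenfunctions of
    the Laplacian, so their pairings with [u t] obey [complex_ode]. Any solution, whatever its
    origin, thus has the expected coefficients. *)
Lemma solution_coef phi u k t : L2T phi -> schrodinger_solution phi u ->
  coef (u t) k = cis (eigen k * t) * coef phi k.
Proof.
move=> Lphi [mu Lu u0 eu].
have ev c : forall t, pairing (u t) (wave 1 k c) = cis (eigen k * t) * pairing (u 0) (wave 1 k c).
  apply: (complex_ode (p := fun t => pairing (u t) (wave 1 k c))) => s.
  have [v dv ev] := eu _ (test_fun_wave 1 k c) s; exists v => //.
  by rewrite -pairingZr ?laplacian_wave in ev *; [|exact: Lu|exact: continuous_wave].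
have e0 : coef (u 0) k = coef phi k.
  have [_ mu0 _] := Lu 0; have [_ mphi _] := Lphi.
  have mw : cmeasurable (chr (- k) : (mR * mR)%type -> R[i]) by exact: cmeasurable_chr.
  have [a1 a2] := cmeasurableM mu0 mw; have [b1 b2] := cmeasurableM mphi mw.
  have mQ := @measurable_unit_square R.
  rewrite /coef /cintegral; congr (_ +i* _); rewrite /Rintegral; congr fine;
    apply: ae_eq_integral => //; try by [apply/measurable_EFinP; exact: measurable_funTS].
    by apply: ae_leb2S u0 => x -> _.
  by apply: ae_leb2S u0 => x -> _.
by rewrite -e0 !coef_pairing// (ev 0 t) (ev (- (pi / 2)) t) mulrBr mulrCA.
Qed.

Definition m3 := (leb1 \x (leb2sf (R := R)))%E.
Definition cylinder : set (mR * (mR * mR))%type := I01 `*` Q.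

Lemma measurable_cylinder : measurable cylinder.
Proof. by apply: measurableX; [exact: measurable_unit_itv|exact: measurable_unit_square]. Qed.

Lemma lebesgue_cylinder_fin : (m3 cylinder < +oo)%E.
Proof.
rewrite (_ : m3 cylinder = leb1 (I01 : set mR) * leb2sf (Q : set (mR * mR)%type))%E; last first.
  apply: product_measure1E; [exact: measurable_unit_itv|exact: measurable_unit_square].
rewrite lte_mul_pinfty//; last exact: lebesgue_unit_square_fin.
by rewrite ge0_fin_numE//; exact: lebesgue_unit_itv_fin.
Qed.

(** The combination [f + c g] covers sums, differences and, as in [L2T_scale], multiples at once. *)
Lemma moment_comb d (T : measurableType d) (mu : {measure set T -> \bar R}) (D : set T) p
    (f g : T -> R[i]) (c : R[i]) : measurable D -> cmeasurable f -> cmeasurable g ->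
  (moment mu D p (fun x => cmod (f x + c * g x)%R) <=
   (2 ^+ p)%:E * (moment mu D p (fun x => cmod (f x)) + (cmod c ^+
     p)%:E * moment mu D p (fun x => cmod (g x))))%E.
Proof.
move=> mD mf mg; have cf := measurable_cmod mf; have cg := measurable_cmod mg.
have ccg : measurable_fun setT (fun x => cmod c * cmod (g x)) by exact: measurable_funM.
have -> : ((cmod c ^+ p)%:E * moment mu D p (fun x => cmod (g x)) =
    moment mu D p (fun x => (cmod c * cmod (g x))%R))%E.
  by rewrite momentZ// ger0_norm ?cmod_ge0.
apply: le_trans (momentD mu mD p cf ccg).
apply: moment_le => //.
- by apply: measurable_cmod; apply: cmeasurableD => //; exact: cmeasurableZ.
- exact: measurable_funD.
move=> x _; rewrite !ger0_norm ?addr_ge0 ?mulr_ge0 ?cmod_ge0//.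
by rewrite -cmodM; exact: cmodD.
Qed.

Lemma moment_comb_fin d (T : measurableType d) (mu : {measure set T -> \bar R}) (D : set T) p
    (f g : T -> R[i]) (c : R[i]) : measurable D -> cmeasurable f -> cmeasurable g ->
  (moment mu D p (fun x => cmod (f x)) < +oo)%E -> (moment mu D p (fun x => cmod (g x)) < +oo)%E ->
  (moment mu D p (fun x => cmod (f x + c * g x)%R) < +oo)%E.
Proof.
move=> mD mf mg fo go; apply: le_lt_trans (moment_comb mu p c mD mf mg) _.
rewrite -(@fineK _ (moment mu D p (fun x => cmod (f x)))) ?ge0_fin_numE ?moment_ge0//.
rewrite -(@fineK _ (moment mu D p (fun x => cmod (g x)))) ?ge0_fin_numE ?moment_ge0//.
by rewrite -!EFinM ltry.
Qed.

Lemma L2T_moment (f : (mR * mR)%type -> R[i]) :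
  (\int[leb2]_(x in Q) ((cmod (f x) ^+ 2)%R)%:E = moment leb2 Q 2 (fun x => cmod (f x)))%E.
Proof. by apply: eq_integral => x _; rewrite ger0_norm ?cmod_ge0. Qed.

Lemma L3_moment (u : R -> R * R -> R[i]) :
  cmeasurable (fun z : mR * (mR * mR) => u z.1 z.2) ->
  (\int[leb1]_(t in I01) \int[leb2]_(x in Q) ((cmod (u t x) ^+ 3)%R)%:E =
   moment m3 cylinder 3 (fun z => cmod (u z.1 z.2)))%E.
Proof.
move=> mu; rewrite /moment /m3 /cylinder.
rewrite (tonelli_on1 leb1 leb2sf measurable_unit_itv measurable_unit_square).
- by apply: eq_integral => t _; apply: eq_integral => x _; rewrite /= ger0_norm ?cmod_ge0.
- exact: (measurable_normX 3 (measurable_cmod mu)).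
- by move=> z; rewrite lee_fin exprn_ge0.
Qed.

Lemma L2T_comb (f g : R * R -> R[i]) c : L2T f -> L2T g -> L2T (fun x => f x + c * g x).
Proof.
move=> [pf mf f2] [pg mg g2]; split.
- by move=> x; have [-> ->] := pf x; have [-> ->] := pg x.
- by apply: cmeasurableD => //; exact: cmeasurableZ.
- move: f2 g2; rewrite !L2T_moment => f2 g2.
  by apply: moment_comb_fin => //; exact: measurable_unit_square.
Qed.

Lemma L3_spacetime_comb (u v : R -> R * R -> R[i]) c :
  cmeasurable (fun z : mR * (mR * mR) => u z.1 z.2) ->
  cmeasurable (fun z : mR * (mR * mR) => v z.1 z.2) ->
  L3_spacetime u -> L3_spacetime v -> L3_spacetime (fun t x => u t x + c * v t x).
Proof.
move=> mu mv; rewrite /L3_spacetime !L3_moment//; last first.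
  by apply: cmeasurableD => //; exact: cmeasurableZ.
move=> u3 v3; apply: moment_comb_fin => //; exact: measurable_cylinder.
Qed.

Lemma pairing_comb (f g : R * R -> R[i]) c psi : L2T f -> L2T g -> continuous psi ->
  pairing (fun x => f x + c * g x) psi = pairing f psi + c * pairing g psi.
Proof.
move=> Lf Lg cpsi; have mQ := @measurable_unit_square R.
have [i1 e1] := cintegralZ mQ c (L2T_pairing Lg cpsi).
have [_ e2] := cintegralD mQ (L2T_pairing Lf cpsi) i1.
by rewrite /pairing -e1 -e2; apply: eq_cintegral => x _; ring.
Qed.

Lemma is_cderive_comb (p q : R -> R[i]) t v w c : is_cderive p t v -> is_cderive q t w ->
  is_cderive (fun s => p s + c * q s) t (v + c * w).
Proof.
move=> [p1 p2] [q1 q2]; split.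
  have h := is_deriveD p1 (is_deriveB (is_deriveZ (complex.Re c) q1) (is_deriveZ (complex.Im c) q2)).
  rewrite (_ : (fun s => _) = ((fun s => complex.Re (p s)) +
    (complex.Re c \*: (fun s => complex.Re (q s)) - complex.Im c \*: (fun s => complex.Im (q s))))).
    by apply: (is_derive_eq h); rewrite cReD cReM.
  by apply/funext => s; rewrite cReD cReM.
have h := is_deriveD p2 (is_deriveD (is_deriveZ (complex.Re c) q2) (is_deriveZ (complex.Im c) q1)).
rewrite (_ : (fun s => _) = ((fun s => complex.Im (p s)) +
  (complex.Re c \*: (fun s => complex.Im (q s)) + complex.Im c \*: (fun s => complex.Re (q s))))).
  by apply: (is_derive_eq h); rewrite cImD cImM.
by apply/funext => s; rewrite cImD cImM.
Qed.

Lemma schrodinger_comb phi phi' u u' c : schrodinger_solution phi u -> schrodinger_solution phi' u' ->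
  schrodinger_solution (fun x => phi x + c * phi' x) (fun t x => u t x + c * u' t x).
Proof.
move=> [mu Lu u0 eu] [mu' Lu' u0' eu']; split.
- by apply: cmeasurableD => //; exact: cmeasurableZ.
- by move=> t; exact: L2T_comb.
- have := negligibleU u0 u0'; apply: negligibleS => x /= nx.
  by apply: contrapT => /not_orP[/contrapT e /contrapT e']; apply: nx; rewrite e e'.
- move=> psi tpsi t; have [v dv ev] := eu psi tpsi t; have [v' dv' ev'] := eu' psi tpsi t.
  have cp := test_fun_continuous tpsi; have cl := test_fun_laplacian_continuous tpsi.
  exists (v + c * v').
    rewrite (_ : (fun s => _) = fun s => pairing (u s) psi + c * pairing (u' s) psi).
      exact: is_cderive_comb.
    by apply/funext => s; rewrite pairing_comb.
  rewrite pairing_comb// mulrDr addrACA ev add0r mulrCA -mulrDr.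
  by rewrite ev' mulr0.
Qed.

Definition evolution phi (u : R -> R * R -> R[i]) : Prop :=
  [/\ L2T phi, schrodinger_solution phi u & L3_spacetime u].

Lemma evolution_comb phi phi' u u' c : evolution phi u -> evolution phi' u' ->
  evolution (fun x => phi x + c * phi' x) (fun t x => u t x + c * u' t x).
Proof.
move=> [L s l] [L' s' l']; split; [exact: L2T_comb|exact: schrodinger_comb|].
by case: (s) (s') => [m _ _ _] [m' _ _ _]; exact: L3_spacetime_comb.
Qed.

Lemma L2T_chr k : L2T (chr k : R * R -> R[i]).
Proof.
split.
- by move=> x; rewrite /chr angle_period1 angle_period2 !cis_2pi_int.
- exact: cmeasurable_chr.
- rewrite L2T_moment; apply: (moment_bounded measurable_unit_square lebesgue_unit_square_fin 2 (M := 1)).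
    by move=> x _; rewrite cmod_chr normr1.
  exact: (measurable_cmod (cmeasurable_chr k)).
Qed.

Lemma L2T_scale c (f : R * R -> R[i]) : L2T f -> L2T (fun x => c * f x).
Proof.
move=> Lf; have := L2T_comb (-1 + c) Lf Lf.
by rewrite (_ : (fun x => _) = fun x => c * f x)//; apply/funext => x; ring.
Qed.

Definition mode k (t : R) (x : R * R) : R[i] := cis (eigen k * t) * chr k x.

Lemma cmeasurable_mode k : cmeasurable (fun z : mR * (mR * mR) => mode k z.1 z.2).
Proof.
apply: cmeasurableM; last exact: cmeasurable_comp (measurable_snd) (cmeasurable_chr k).
by apply: cmeasurable_cis; apply: measurable_funM => //; exact: measurable_fst.
Qed.

Lemma pairing_mode k t psi : continuous psi ->
  pairing (mode k t) psi = cis (eigen k * t) * pairing (chr k) psi.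
Proof.
move=> cpsi; rewrite -(cintegralZ measurable_unit_square _ (L2T_pairing (L2T_chr k) cpsi)).2.
by rewrite /pairing /mode; apply: eq_cintegral => x _; rewrite mulrA.
Qed.

Lemma is_cderive_cis (l t : R) z :
  is_cderive (fun s => cis (l * s) * z) t ('i%C * l%:C * (cis (l * t) * z)).
Proof.
case: z => a b; split.
  have h := is_deriveB (is_deriveZ a (is_derive_cos_affine l 0 t))
    (is_deriveZ b (is_derive_sin_affine l 0 t)).
  rewrite (_ : (fun s => _) = ((a \*: (fun s => cos (l * s + 0))) - (b \*: (fun s => sin (l * s + 0))))).
    by apply: (is_derive_eq h); rewrite /cis addr0 /GRing.scale; simpc => /=; ring.
  by apply/funext => s; rewrite cReM /= -[l * s]addr0 ![cos _ * _]mulrC ![sin _ * _]mulrC.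
have h := is_deriveD (is_deriveZ b (is_derive_cos_affine l 0 t))
  (is_deriveZ a (is_derive_sin_affine l 0 t)).
rewrite (_ : (fun s => _) = ((b \*: (fun s => cos (l * s + 0))) + (a \*: (fun s => sin (l * s + 0))))).
  by apply: (is_derive_eq h); rewrite /cis addr0 /GRing.scale; simpc => /=; ring.
by apply/funext => s; rewrite cImM /= -[l * s]addr0 ![cos _ * _]mulrC ![sin _ * _]mulrC.
Qed.

Lemma evolution_mode k : evolution (chr k) (mode k).
Proof.
split; first exact: L2T_chr.
  split.
  - exact: cmeasurable_mode.
  - by move=> t; apply: L2T_scale; exact: L2T_chr.
  - apply: (negligibleS _ (negligible_set0 leb2)) => x /=; apply.
    by rewrite /mode mulr0 cis0 mul1r.
  - move=> psi tpsi t; have cp := test_fun_continuous tpsi.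
    exists ('i%C * (eigen k)%:C * (cis (eigen k * t) * pairing (chr k) psi)).
      rewrite (_ : (fun s => _) = fun s => cis (eigen k * s) * pairing (chr k) psi).
        exact: is_cderive_cis.
      by apply/funext => s; rewrite pairing_mode.
    rewrite pairing_mode ?pairing_chr_laplacian//; last exact: test_fun_laplacian_continuous.
    have ii : 'i%C * 'i%C = -1 :> R[i] by rewrite -expr2 sqr_i.
    by rewrite (mulrA 'i%C) (mulrA 'i%C) ii; ring.
rewrite /L3_spacetime L3_moment; last exact: cmeasurable_mode.
apply: (moment_bounded measurable_cylinder lebesgue_cylinder_fin 3 (M := 1)).
  by move=> z _; rewrite /mode cmodM cis_norm cmod_chr mulr1 normr1.
exact: (measurable_cmod (cmeasurable_mode k)).
Qed.

Lemma evolution_sum (s : seq (int * int)) (a : int * int -> R[i]) :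
  evolution (fun x => \sum_(k <- s) a k * chr k x) (fun t x => \sum_(k <- s) a k * mode k t x).
Proof.
elim: s => [|k s IH].
  (* The zero evolution is obtained as a mode minus itself. *)
  have := evolution_comb (-1) (evolution_mode 0) (evolution_mode 0).
  rewrite (_ : (fun x => _ + _) = fun x => \sum_(k <- [::]) a k * chr k x); last first.
    by apply/funext => x; rewrite big_nil; ring.
  rewrite (_ : (fun t x => _ + _) = fun t x => \sum_(k <- [::]) a k * mode k t x)//.
  by apply/funext => t; apply/funext => x; rewrite big_nil; ring.
have := evolution_comb (a k) IH (evolution_mode k).
rewrite (_ : (fun x => _ + _) = fun x => \sum_(k <- k :: s) a k * chr k x); last first.
  by apply/funext => x; rewrite big_cons addrC.
rewrite (_ : (fun t x => _ + _) = fun t x => \sum_(k <- k :: s) a k * mode k t x)//.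
by apply/funext => t; apply/funext => x; rewrite big_cons addrC.
Qed.

Definition evolve (n : nat) phi (t : R) (x : R * R) : R[i] :=
  \sum_(k <- freqs n) ((freq_weight n k)%:C * coef phi k) * mode k t x.

Lemma evolution_proj n phi : evolution (proj n phi) (evolve n phi).
Proof. exact: evolution_sum. Qed.

(** Averaging commutes with the evolution, both acting by multiplication on each Fourier
    coefficient. *)
Lemma proj_solution n phi u t x : L2T phi -> schrodinger_solution phi u ->
  proj n (u t) x = evolve n phi t x.
Proof.
move=> Lphi su; apply: eq_bigr => k _.
by rewrite (solution_coef k t Lphi su) /mode; ring.
Qed.

End evolution.

(** * The trilinear estimate *)

Section trilinear.
Context d (T : measurableType d) (R : realType) (mu : {measure set T -> \bar R}).
Variables (D : set T) (mD : measurable D).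
Implicit Types (f g h : T -> R[i]) (b : bool).

Definition L3fun f : Prop :=
  cmeasurable f /\ (moment mu D 3 (fun x => cmod (f x)) < +oo)%E.

Definition tri b0 b1 b2 f g h : R[i] :=
  cintegral mu D (fun x => star b0 (f x) * star b1 (g x) * star b2 (h x)).

Lemma L3fun_comb f g c : L3fun f -> L3fun g -> L3fun (fun x => f x + c * g x).
Proof.
move=> [mf f3] [mg g3]; split; first by apply: cmeasurableD => //; exact: cmeasurableZ.
exact: moment_comb_fin.
Qed.

Lemma L3fun_sub f g : L3fun f -> L3fun g -> L3fun (fun x => f x - g x).
Proof.
move=> Lf Lg; have := L3fun_comb (-1) Lf Lg.
by rewrite (_ : (fun x => _) = fun x => f x - g x)//; apply/funext => x; rewrite mulN1r.
Qed.

Lemma tri_swap12 b0 b1 b2 f g h : tri b0 b1 b2 f g h = tri b1 b0 b2 g f h.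
Proof. by apply: eq_cintegral => x _; rewrite [star b0 _ * _]mulrC. Qed.

Lemma tri_swap23 b0 b1 b2 f g h : tri b0 b1 b2 f g h = tri b0 b2 b1 f h g.
Proof. by apply: eq_cintegral => x _; rewrite mulrAC. Qed.

(** Let [b <= c]. If [a <= de c], the product is at most [de c^3]; otherwise [b] and [c] are both
    below [a / de] and the product is at most [de^-2 a^3]. *)
Lemma young3 (a b c de : R) : 0 <= a -> 0 <= b -> 0 <= c -> 0 < de ->
  a * b * c <= de ^- 2 * a ^+ 3 + de * (b ^+ 3 + c ^+ 3).
Proof.
move=> a0 b0 c0 d0.
wlog bc : b c b0 c0 / b <= c.
  move=> H; have [|/ltW cb] := leP b c; first exact: H.
  by rewrite mulrAC [b ^+ 3 + _]addrC; exact: H.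
have [ac|ca] := leP (de^-1 * a) c.
  have : a * b * c <= de * c ^+ 3.
    have -> : a = de * (de^-1 * a) by rewrite mulrA divff ?mul1r// gt_eqF.
    rewrite -!mulrA ler_pM2l// mulrA (_ : c ^+ 3 = c * c * c); last by ring.
    by rewrite mulrA; apply: ler_wpM2r => //; apply: ler_pM => //; rewrite mulr_ge0// invr_ge0 ltW.
  move=> H; apply: le_trans H _; rewrite mulrDr addrA lerDr addr_ge0// mulr_ge0 ?exprn_ge0//.
    by rewrite invr_ge0 exprn_ge0// ltW.
  exact: ltW.
have : a * b * c <= de ^- 2 * a ^+ 3.
  have ca' := ltW ca; have i0 : 0 <= de^-1 * a by rewrite mulr_ge0// invr_ge0 ltW.
  rewrite (_ : de ^- 2 * a ^+ 3 = a * (de^-1 * a) * (de^-1 * a)); last by rewrite -exprVn; ring.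
  by apply: ler_pM => //; rewrite ?mulr_ge0//; apply: ler_pM => //; apply: le_trans bc _.
by move=> H; apply: le_trans H _; rewrite lerDl mulr_ge0 ?addr_ge0 ?exprn_ge0// ltW.
Qed.

Lemma integrable_cmod3 f : L3fun f -> mu.-integrable D (EFin \o (fun x => cmod (f x) ^+ 3)).
Proof.
move=> [mf f3]; apply/integrableP; split.
  by apply/measurable_EFinP; apply: measurable_funTS; apply: measurable_funX; exact: measurable_cmod.
apply: le_lt_trans f3; rewrite le_eqVlt; apply/orP; left; apply/eqP.
by apply: eq_integral => x _; rewrite /= normrX.
Qed.

Lemma tri_integrable b0 b1 b2 f g h : L3fun f -> L3fun g -> L3fun h ->
  cintegrable mu D (fun x => star b0 (f x) * star b1 (g x) * star b2 (h x)).
Proof.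
move=> Lf Lg Lh.
have [i1 _] := Rintegral_comb mD 1 1 (integrable_cmod3 Lg) (integrable_cmod3 Lh).
have [i2 _] := Rintegral_comb mD 1 1 (integrable_cmod3 Lf) i1.
have [mf _] := Lf; have [mg _] := Lg; have [mh _] := Lh.
apply: (cintegrable_le mD _ i2).
  by apply: cmeasurableM; [apply: cmeasurableM|]; exact: cmeasurable_star.
move=> x _; rewrite !cmodM !cmod_star.
apply: le_trans (young3 (cmod_ge0 _) (cmod_ge0 _) (cmod_ge0 _) ltr01) _.
by rewrite expr1n invr1 !mul1r.
Qed.

Lemma tri_subl b0 b1 b2 f f' g h : L3fun f -> L3fun f' -> L3fun g -> L3fun h ->
  tri b0 b1 b2 (fun x => f x - f' x) g h = tri b0 b1 b2 f g h - tri b0 b1 b2 f' g h.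
Proof.
move=> Lf Lf' Lg Lh.
rewrite -(cintegralB mD (tri_integrable b0 b1 b2 Lf Lg Lh) (tri_integrable b0 b1 b2 Lf' Lg Lh)).2.
apply: eq_cintegral => x _.
have -> : star b0 (f x - f' x) = star b0 (f x) - star b0 (f' x).
  by case: (b0) => //; rewrite /star rmorphB.
by rewrite !mulrBl.
Qed.

(** In each term the factor that carries the difference is permuted to the first slot, where
    [tri_small] expects the small function. *)
Lemma tri_telescope b0 b1 b2 f f' g g' h h' :
  L3fun f -> L3fun f' -> L3fun g -> L3fun g' -> L3fun h -> L3fun h' ->
  tri b0 b1 b2 f g h - tri b0 b1 b2 f' g' h' =
    tri b0 b1 b2 (fun x => f x - f' x) g h +
    (tri b1 b0 b2 (fun x => g x - g' x) f' h + tri b2 b1 b0 (fun x => h x - h' x) g' f').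
Proof.
move=> Lf Lf' Lg Lg' Lh Lh'; rewrite !tri_subl//.
rewrite ![tri b1 b0 b2 _ _ _]tri_swap12.
have sw u v w : tri b2 b1 b0 u v w = tri b0 b1 b2 w v u by rewrite tri_swap12 tri_swap23 tri_swap12.
by rewrite !sw; ring.
Qed.

Lemma tri_bound b0 b1 b2 f g h (A B C de : R) : L3fun f -> L3fun g -> L3fun h -> 0 < de ->
  (moment mu D 3 (fun x => cmod (f x)) <= A%:E)%E ->
  (moment mu D 3 (fun x => cmod (g x)) <= B%:E)%E ->
  (moment mu D 3 (fun x => cmod (h x)) <= C%:E)%E ->
  cmod (tri b0 b1 b2 f g h) <= 2 * (de ^- 2 * A + de * (B + C)).
Proof.
move=> Lf Lg Lh d0 fA gB hC.
have [mf _] := Lf; have [mg _] := Lg; have [mh _] := Lh.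
have mP : cmeasurable (fun x => star b0 (f x) * star b1 (g x) * star b2 (h x)).
  by apply: cmeasurableM; [apply: cmeasurableM|]; exact: cmeasurable_star.
apply: (cmod_cintegral_le mD mP).
have c3 (u : T -> R[i]) : cmeasurable u -> measurable_fun D (fun x => (cmod (u x) ^+ 3)%:E).
  by move=> mu'; apply/measurable_EFinP; apply: measurable_funTS; apply: measurable_funX;
    exact: measurable_cmod.
have mE (u : T -> R[i]) : (moment mu D 3 (fun x => cmod (u x)) = \int[mu]_(x in D) (cmod (u x) ^+
  3)%:E)%E.
  by apply: eq_integral => x _; rewrite ger0_norm ?cmod_ge0.
have p0 (u : T -> R[i]) x : D x -> (0 <= (cmod (u x) ^+ 3)%:E)%E by rewrite lee_fin exprn_ge0 ?cmod_ge0.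
have i0 : 0 <= de ^- 2 by rewrite invr_ge0 exprn_ge0// ltW.
apply: (@le_trans _ _ (\int[mu]_(x in D) ((de ^- 2)%:E * (cmod (f x) ^+ 3)%:E +
    de%:E * ((cmod (g x) ^+ 3)%:E + (cmod (h x) ^+ 3)%:E)))%E).
  apply: (ge0_le_integral mu mD) => [x _|||x _].
  - by rewrite lee_fin cmod_ge0.
  - by apply/measurable_EFinP; apply: measurable_funTS; exact: measurable_cmod.
  - apply: emeasurable_funD; first by apply: measurable_funeM; exact: c3.
    by apply: measurable_funeM; apply: emeasurable_funD; exact: c3.
  - apply: (@le_trans _ _ (de ^- 2 * cmod (f x) ^+ 3 + de * (cmod (g x) ^+ 3 + cmod (h x) ^+
    3))%:E); last first.
      by rewrite EFinD !EFinM EFinD.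
    rewrite lee_fin !cmodM !cmod_star.
    by apply: young3; rewrite ?cmod_ge0.
have p2 x : D x -> (0 <= (cmod (g x) ^+ 3)%:E + (cmod (h x) ^+ 3)%:E)%E.
  by move=> Dx; apply: adde_ge0; exact: p0.
have m2 : measurable_fun D (fun x => (cmod (g x) ^+ 3)%:E + (cmod (h x) ^+ 3)%:E)%E.
  by apply: emeasurable_funD; exact: c3.
rewrite (ge0_integralD mu mD).
- rewrite (ge0_integralZl mu mD (c3 f mf) (p0 f)) ?lee_fin// (ge0_integralZl mu mD m2 p2)
  ?lee_fin ?(ltW d0)//.
  rewrite (ge0_integralD mu mD (p0 g) (c3 g mg) (p0 h) (c3 h mh)).
  rewrite -!mE EFinD !EFinM EFinD; apply: leeD; apply: lee_wpmul2l; rewrite ?lee_fin ?(ltW d0)//.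
  exact: leeD.
- by move=> x Dx; rewrite mule_ge0 ?lee_fin//; exact: p0.
- by apply: measurable_funeM; exact: c3.
- by move=> x Dx; rewrite mule_ge0 ?lee_fin ?(ltW d0)//; exact: p2.
- exact: measurable_funeM.
Qed.

Lemma tri_small (K e : R) : 0 <= K -> 0 < e -> exists2 A : R, 0 < A &
  forall b0 b1 b2 f g h, L3fun f -> L3fun g -> L3fun h ->
  (moment mu D 3 (fun x => cmod (f x)) <= A%:E)%E ->
  (moment mu D 3 (fun x => cmod (g x)) <= K%:E)%E ->
  (moment mu D 3 (fun x => cmod (h x)) <= K%:E)%E -> cmod (tri b0 b1 b2 f g h) <= e.
Proof.
(* With this [de] the bounded factors cost at most [e / 4]; the choice of [A] makes the small factor
   cost [e / 4], and [tri_bound] doubles their sum to [e]. *)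
move=> K0 e0; pose de := e / (8 * (K + 1)).
have K1 : 0 < K + 1 by rewrite ltr_wpDl.
have d0 : 0 < de by rewrite divr_gt0// mulr_gt0.
exists (e * de ^+ 2 / 4); first by rewrite divr_gt0// mulr_gt0// exprn_gt0.
move=> b0 b1 b2 f g h Lf Lg Lh fA gK hK.
apply: le_trans (tri_bound b0 b1 b2 Lf Lg Lh d0 fA gK hK) _.
have -> : de ^- 2 * (e * de ^+ 2 / 4) = e / 4.
  by field; rewrite gt_eqF.
have : de * (K + K) <= e / 4.
  rewrite /de -mulrA ler_pM2l//.
  rewrite mulrC ler_pdivrMr ?mulr_gt0//; lra.
by move=> h1; lra.
Qed.

(** Convergence bounds the moments of order 3 by a common constant from some rank on, after which
    each telescoped term is at most [e / 3]. *)
Lemma tri_cvg b0 b1 b2 (f g h : nat -> T -> R[i]) (f' g' h' : T -> R[i]) :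
  (forall n, L3fun (f n)) -> (forall n, L3fun (g n)) -> (forall n, L3fun (h n)) ->
  L3fun f' -> L3fun g' -> L3fun h' ->
  vanish (fun n => moment mu D 3 (fun x => cmod (f n x - f' x))) ->
  vanish (fun n => moment mu D 3 (fun x => cmod (g n x - g' x))) ->
  vanish (fun n => moment mu D 3 (fun x => cmod (h n x - h' x))) ->
  forall e, 0 < e -> \forall n \near \oo,
    cmod (tri b0 b1 b2 (f n) (g n) (h n) - tri b0 b1 b2 f' g' h') <= e.
Proof.
move=> Lf Lg Lh Lf' Lg' Lh' vf vg vh e e0.
have bnd (u : nat -> T -> R[i]) u' : (forall n, L3fun (u n)) -> L3fun u' ->
    vanish (fun n => moment mu D 3 (fun x => cmod (u n x - u' x))) ->
    exists2 K : R, 0 <= K & (moment mu D 3 (fun x => cmod (u' x)) <= K%:E)%E /\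
    \forall n \near \oo, (moment mu D 3 (fun x => cmod (u n x)) <= K%:E)%E.
  move=> Lu Lu' vu; have [mu' u'3] := Lu'.
  set M := moment mu D 3 (fun x => cmod (u' x)) in u'3 *.
  have M0 : (0 <= M)%E by exact: moment_ge0.
  have Mf : M \is a fin_num by rewrite ge0_fin_numE.
  have fM0 : 0 <= fine M by exact: fine_ge0.
  exists (2 ^+ 3 * (1 + fine M)); first by rewrite mulr_ge0// addr_ge0.
  split.
    rewrite -[leLHS](fineK Mf) lee_fin; apply: (@le_trans _ _ (1 + fine M)); first by rewrite lerDr.
    by rewrite ler_peMl ?addr_ge0// exprn_ege1// ler1n.
  near=> n.
  have -> : u n = fun x => (u n x - u' x) + 1 * u' x by apply/funext => x; rewrite mul1r subrK.
  have Ld := L3fun_sub (Lu n) Lu'.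
  apply: le_trans (moment_comb mu 3 1 mD Ld.1 mu') _.
  rewrite -/M cmod1 expr1n mul1e (EFinM (2 ^+ 3)) (EFinD 1) (fineK Mf); apply: lee_wpmul2l => //;
    apply: leeD => //.
  by near: n; exact: vu.
have [K1 K10 [fK fK']] := bnd _ _ Lf Lf' vf.
have [K2 K20 [gK gK']] := bnd _ _ Lg Lg' vg.
have [K3 K30 [hK hK']] := bnd _ _ Lh Lh' vh.
have K0 : 0 <= K1 + K2 + K3 by rewrite !addr_ge0.
have e3 : 0 < e / 3 by rewrite divr_gt0.
have [A A0 HA] := tri_small K0 e3.
have l1 : (K1%:E <= (K1 + K2 + K3)%:E)%E by rewrite lee_fin; lra.
have l2 : (K2%:E <= (K1 + K2 + K3)%:E)%E by rewrite lee_fin; lra.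
have l3 : (K3%:E <= (K1 + K2 + K3)%:E)%E by rewrite lee_fin; lra.
near=> n; rewrite tri_telescope//.
have -> : e = e / 3 + (e / 3 + e / 3) by field.
apply: le_trans (cmodD _ _) _; apply: lerD.
  apply: HA => //; first exact: L3fun_sub.
  - by near: n; exact: vf.
  - by apply: le_trans l2; near: n.
  - by apply: le_trans l3; near: n.
apply: le_trans (cmodD _ _) _; apply: lerD.
  apply: HA => //; first exact: L3fun_sub.
  - by near: n; exact: vg.
  - exact: le_trans l1.
  - by apply: le_trans l3; near: n.
apply: HA => //; first exact: L3fun_sub.
- by near: n; exact: vh.
- exact: le_trans l2.
- exact: le_trans l1.
Unshelve. all: by end_near. Qed.

End trilinear.

(** * The estimate for averaged data *)

Section trig_polynomials.
Context {R : realType}.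
Local Notation leb1 := (@lebesgue_measure R).
Local Notation leb2 := (leb1 \x leb1)%E.
Local Notation I01 := (unit_itv (R := R)).
Local Notation Q := (unit_square (R := R)).

Lemma prod3 (K : comPzRingType) (F : 'I_3 -> K) :
  \prod_(j < 3) F j = F ord0 * F (inord 1) * F (inord 2).
Proof.
rewrite !big_ord_recl big_ord0 mulr1 mulrA; congr (_ * F _ * F _);
  by apply: val_inj; rewrite /= inordK.
Qed.

Lemma mul3_sum (K : comPzRingType) (I : eqType) (s : seq I) (a b c : I -> K) :
  (\sum_(x <- s) a x) * (\sum_(y <- s) b y) * (\sum_(z <- s) c z) =
  \sum_(p <- [seq (x, yz) | x <- s, yz <- [seq (y, z) | y <- s, z <- s]])
    a p.1 * b p.2.1 * c p.2.2.
Proof.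
rewrite big_allpairs -mulrA mulr_suml; apply: eq_bigr => x _.
rewrite big_allpairs mulr_suml mulr_sumr; apply: eq_bigr => y _.
by rewrite !mulr_sumr; apply: eq_bigr => z _; rewrite mulrA.
Qed.

Lemma star_mode b k (t : R) x : star b (mode k t x) =
  cis (- (4 * pi ^+ 2 * (sgz_if b (dot k k))%:~R) * t) * chr (sg2 b k) x.
Proof.
rewrite /mode starM star_chr /eigen; congr (_ * _).
by case: b; rewrite /star /sgz_if // cis_conj rmorphN /=; congr cis; ring.
Qed.

(** For [q != 0] the primitives give at most [(1 + 2) / |w|], and [|w| = 4 pi^2 |q| >= 16 |q|] since
    [pi >= 2]; finally [3 (1 + |q|) <= 16 |q|]. *)
Lemma cis_time_integral (q : int) :
  cmod (cintegral leb1 I01 (fun t => cis (- (4 * pi ^+ 2 * q%:~R) * t))) <= ker q.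
Proof.
set w := - (4 * pi ^+ 2 * q%:~R).
have e1 : \int[leb1]_(t in I01) cos (w * t) = \int[leb1]_(t in I01) cos (w * t + 0).
  by apply: eq_Rintegral => t _; rewrite addr0.
have e2 : \int[leb1]_(t in I01) sin (w * t) = \int[leb1]_(t in I01) sin (w * t + 0).
  by apply: eq_Rintegral => t _; rewrite addr0.
have [q0|q0] := eqVneq q 0.
  have w0 : w = 0 by rewrite /w q0 mulr0 oppr0.
  have -> : cintegral leb1 I01 (fun t => cis (w * t)) = 1.
    rewrite /cintegral /cis /= [X in X +i* _](_ : _ = 1); last first.
      by rewrite -[RHS]Rintegral01_cst; apply: eq_Rintegral => t _; rewrite w0 mul0r cos0.
    rewrite [X in _ +i* X](_ : _ = 0)//.
    by rewrite -[RHS]Rintegral01_cst; apply: eq_Rintegral => t _; rewrite w0 mul0r sin0.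
  by rewrite cmod1 /ker q0 normr0 addr0 invr1.
have pi2 : 2 <= pi :> R by exact: pi_ge2.
have pi4 : 4 <= pi ^+ 2 :> R by rewrite (_ : 4 = 2 * 2) ?expr2 ?ler_pM// -natrM.
have q1 : 1 <= (`|q|)%:~R :> R by rewrite ler1z; lia.
have aw : 16 * (`|q|)%:~R <= `|w|.
  rewrite /w normrN normrM -intr_norm ger0_norm; last by rewrite mulr_ge0// exprn_ge0// (le_trans _ pi2).
  by rewrite ler_wpM2r; [|lra|lra].
have w0 : w != 0 by rewrite -normr_gt0 (lt_le_trans _ aw)//; lra.
have -> : cintegral leb1 I01 (fun t => cis (w * t)) =
    ((sin (w + 0) - sin 0) / w) +i* ((cos 0 - cos (w + 0)) / w).
  by rewrite /cintegral /cis /= e1 e2 Rintegral_cos_affine// Rintegral_sin_affine.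
apply: le_trans (cmod_le _) _; rewrite [complex.Re _]/= [complex.Im _]/= !normrM normfV -mulrDl.
rewrite ler_pdivrMr ?normr_gt0// /ker mulrC ler_pdivlMr; last by lra.
have s1 : `|sin (w + 0) - sin 0| <= 1 by rewrite sin0 subr0 sin_max.
have c1 : `|cos 0 - cos (w + 0)| <= 2.
  rewrite cos0; apply: le_trans (ler_normB _ _) _; rewrite normr1.
  by have := @cos_max R (w + 0); lra.
apply: (@le_trans _ _ (3 * (1 + (`|q|)%:~R))); last by apply: le_trans aw; lra.
by rewrite ler_wpM2r; [|lra|lra].
Qed.

(** The constant is that of [discrete_trilinear] and does not depend on [n]: the multipliers are at
    most 1 and Bessel's inequality bounds the l2 norms of the coefficients by the L^2 norms of the
    data. *)
Lemma evolve_trilinear : exists2 C : R, 0 < C & forall s phi n,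
  (forall j : 'I_3, L2T (phi j)) ->
  cmod (spacetime_integral s (fun j => evolve n (phi j))) <= C * \prod_(j < 3) L2norm (phi j).
Proof.
have [C C0 HC] := @discrete_trilinear R.
exists C => // s phi n Lphi.
have key (x y z : R) (b : bool) : 0 <= x -> y <= z -> x * b%:R * y <= b%:R * (x * z).
  by move=> x0 yz; case: b; rewrite ?mulr1 ?mul1r ?mulr0 ?mul0r// ler_wpM2l.
pose A j k := (freq_weight n k)%:C * coef (phi j) k : R[i].
pose L := [seq (x, yz) | x <- freqs n, yz <- [seq (y, z) | y <- freqs n, z <- freqs n]].
pose B (p : (int * int) * ((int * int) * (int * int))) : R[i] :=
  star (s ord0) (A ord0 p.1) * star (s (inord 1)) (A (inord 1) p.2.1) * star (s (inord 2))
    (A (inord 2) p.2.2).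
pose ph (p : (int * int) * ((int * int) * (int * int))) := phase s p.1 p.2.1 p.2.2.
pose om (p : (int * int) * ((int * int) * (int * int))) : R := - (4 * pi ^+ 2 * (ph p)%:~R).
pose fr (p : (int * int) * ((int * int) * (int * int))) :=
  sg2 (s ord0) p.1 + sg2 (s (inord 1)) p.2.1 + sg2 (s (inord 2)) p.2.2.
(* Expanding into triples of modes, the integral in [x] keeps exactly the resonant triples, each
   with its time frequency [om p]. *)
have inner t : cintegral leb2 Q (fun x => \prod_(j < 3) star (s j) (evolve n (phi j) t x)) =
    \sum_(p <- L) (B p * (fr p == 0)%:R) * cis (om p * t).
  have e x : \prod_(j < 3) star (s j) (evolve n (phi j) t x) =
      \sum_(p <- L) (B p * cis (om p * t)) * chr (fr p) x.
    rewrite prod3 /evolve !star_sum mul3_sum; apply: eq_bigr => p _.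
    rewrite (starM _ (A ord0 p.1)) (starM _ (A (inord 1) p.2.1)) (starM _ (A (inord 2) p.2.2)).
    rewrite !star_mode /B /om /fr !chrD.
    have -> : cis (- (4 * pi ^+ 2 * (ph p)%:~R) * t) =
      cis (- (4 * pi ^+ 2 * (sgz_if (s ord0) (dot p.1 p.1))%:~R) * t) *
      cis (- (4 * pi ^+ 2 * (sgz_if (s (inord 1)) (dot p.2.1 p.2.1))%:~R) * t) *
      cis (- (4 * pi ^+ 2 * (sgz_if (s (inord 2)) (dot p.2.2 p.2.2))%:~R) * t).
      by rewrite -!cisD /ph /phase !rmorphD /=; congr cis; ring.
    ring.
  rewrite (eq_cintegral leb2 (fun x _ => e x)) cintegral_trig.
  by apply: eq_bigr => p _; rewrite mulrAC.
have mI := @measurable_unit_itv R.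
have ci p : cintegrable leb1 I01 (fun t => cis (om p * t)).
  apply: (cintegrable_le mI (g := fun=> 1)).
  - by apply: cmeasurable_cis; exact: measurable_funM.
  - exact: (@continuous_integrable01 R (fun=> 1) (@cst_continuous _ _ (1 : R))).
  - by move=> t _; rewrite cis_norm.
have -> : spacetime_integral s (fun j => evolve n (phi j)) =
    \sum_(p <- L) (B p * (fr p == 0)%:R) * cintegral leb1 I01 (fun t => cis (om p * t)).
  rewrite /spacetime_integral (eq_cintegral leb1 (fun t _ => inner t)).
  have [_ ->] := @cintegral_sum _ _ _ leb1 I01 mI _ L xpredT _ (fun p => (cintegralZ mI (B p * (fr p == 0)%:R) (ci p)).1).
  by apply: eq_bigr => p _; rewrite (cintegralZ mI _ (ci p)).2.
apply: le_trans (cmod_sum _ _ _) _.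
pose a j k := cmod (A j k).
have a0 j k : 0 <= a j k by exact: cmod_ge0.
have := HC s (freqs n) (a ord0) (a (inord 1)) (a (inord 2)) (uniq_freqs n) (a0 _) (a0 _) (a0 _).
have -> : \sum_(x <- freqs n) \sum_(y <- freqs n) \sum_(z <- freqs n | resonant s x y z)
      a ord0 x * a (inord 1) y * a (inord 2) z * ker (phase s x y z) =
    \sum_(p <- L) (fr p == 0)%:R * (a ord0 p.1 * a (inord 1) p.2.1 * a (inord 2) p.2.2 * ker (ph p)).
  rewrite /L big_allpairs; apply: eq_bigr => x _; rewrite big_allpairs; apply: eq_bigr => y _.
  rewrite [LHS]big_mkcond /=; apply: eq_bigr => z _; rewrite /resonant /fr /ph /=.
  by case: ifP => _; rewrite ?mul1r ?mul0r.
move=> H; apply: le_trans (le_trans _ H) _.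
  apply: ler_sum => p _; rewrite !cmodM !cmod_star -/(a _ _) -/(a _ _) -/(a _ _).
  have -> : cmod ((fr p == 0)%:R : R[i]) = (fr p == 0)%:R by case: (_ == _); rewrite ?cmod1 ?cmod0.
  by apply: key; [rewrite !mulr_ge0|exact: cis_time_integral].
rewrite ler_pM2l// prod3.
have l j : l2 (freqs n) (a j) <= L2norm (phi j).
  have [_ mphi phi2] := Lphi j; have iphi := L2T_integrable (Lphi j).
  rewrite /l2 /L2norm; apply: ler_wsqrtr.
  have i2 : leb2.-integrable Q (EFin \o (fun x => cmod (phi j x) ^+ 2)).
    apply/integrableP; split.
      by apply/measurable_EFinP; apply: measurable_funTS; apply: measurable_funX; exact: measurable_cmod.
    apply: le_lt_trans phi2; rewrite le_eqVlt; apply/orP; left; apply/eqP.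
    by apply: eq_integral => x _; rewrite /= ger0_norm ?exprn_ge0 ?cmod_ge0.
  apply: le_trans (bessel (uniq_freqs n) mphi iphi i2); apply: ler_sum => k _.
  rewrite /a /A cmodM cmod_real ger0_norm ?freq_weight_ge0//.
  rewrite lerXn2r ?nnegrE ?mulr_ge0 ?cmod_ge0 ?freq_weight_ge0//.
  by rewrite ler_piMl ?cmod_ge0// freq_weight_le1.
by apply: ler_pM; rewrite ?mulr_ge0 ?l2_ge0//; apply: ler_pM; rewrite ?l2_ge0.
Qed.

End trig_polynomials.

(** * Convergence of the averaged evolutions in L^3 of space-time *)

Section projection_convergence.
Context {R : realType}.
Local Notation leb1 := (@lebesgue_measure R).
Local Notation leb2 := (leb1 \x leb1)%E.
Local Notation mR := (measurableTypeR R).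
Local Notation I01 := (unit_itv (R := R)).
Local Notation Q := (unit_square (R := R)).
Local Notation mom p f := (moment (leb2sf (R := R)) Q p (fun x => cmod (f x))).

Lemma vanish_cvg (u : nat -> \bar R) : (forall n, 0 <= u n)%E -> vanish u -> u @ \oo --> 0%E.
Proof.
move=> u0 vu; apply/fine_cvgP; split.
  near=> n; rewrite ge0_fin_numE//; apply: le_lt_trans (ltry 1).
  by near: n; exact: vu ltr01.
apply/cvgrPdist_le => e e0; near=> n.
rewrite sub0r normrN ger0_norm ?fine_ge0//.
have h : (u n <= e%:E)%E by near: n; exact: vu.
by rewrite -lee_fin fineK// ge0_fin_numE// (le_lt_trans h)// ltry.
Unshelve. all: by end_near. Qed.

Lemma moment_proj_sub p n (f : (mR * mR)%type -> R[i]) : cmeasurable f -> cintegrable leb2 Q f ->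
  (mom p (fun x => proj n f x - f x)%R <=
   (2 ^+ p)%:E * (moment leb2sf Q p (fun x => mop leb2sf Q (vpk2 n) (fun y => complex.Re (f y))
     x - complex.Re (f x))%R +
                  moment leb2sf Q p (fun x => mop leb2sf Q (vpk2 n) (fun y => complex.Im (f y))
                    x - complex.Im (f x))%R))%E.
Proof.
move=> mf fi; have [m1 m2] := mf; have mQ := @measurable_unit_square R.
have kM := @doubly_markov_vpk2 R n.
have d1 : measurable_fun setT (fun x => mop leb2sf Q (vpk2 n) (fun y => complex.Re (f y))
  x - complex.Re (f x)).
  by apply: measurable_funB => //; exact: measurable_mop.
have d2 : measurable_fun setT (fun x => mop leb2sf Q (vpk2 n) (fun y => complex.Im (f y))
  x - complex.Im (f x)).
  by apply: measurable_funB => //; exact: measurable_mop.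
have n1 := measurableT_comp (@normr_measurable R setT) d1.
have n2 := measurableT_comp (@normr_measurable R setT) d2.
have := momentD leb2sf mQ p n1 n2.
have E (g : (mR * mR)%type -> R) : moment leb2sf Q p (fun x => `|g x|) = moment leb2sf Q p g.
  by apply: eq_integral => x _; rewrite normr_id.
rewrite [X in (_ <= _ * (X + _))%E]E [X in (_ <= _ * (_ + X))%E]E; apply: le_trans.
apply: (moment_le leb2sf mQ).
- apply: measurable_cmod; apply: cmeasurableD; last first.
    by have := cmeasurableZ (-1) mf; under eq_fun do rewrite mulN1r.
  by apply: cmeasurable_sum => k; apply: cmeasurableZ; exact: cmeasurable_chr.
- exact: measurable_funD.
- move=> x _; rewrite ger0_norm ?cmod_ge0// [leRHS]ger0_norm; last by apply: addr_ge0; exact: normr_ge0.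
  apply: le_trans (cmod_le _) _; rewrite proj_mop//=.
  by case: (f x) => a b /=; exact: lexx.
Qed.

Lemma moment_Re p (f : (mR * mR)%type -> R[i]) : cmeasurable f ->
  (moment leb2sf Q p (fun x => complex.Re (f x)) <= mom p f)%E.
Proof.
move=> mf; apply: (moment_le leb2sf (@measurable_unit_square R)) => [||x _].
- by case: mf.
- exact: measurable_cmod.
- by rewrite [leRHS]ger0_norm ?cmod_ge0// Re_le_cmod.
Qed.

Lemma moment_Im p (f : (mR * mR)%type -> R[i]) : cmeasurable f ->
  (moment leb2sf Q p (fun x => complex.Im (f x)) <= mom p f)%E.
Proof.
move=> mf; apply: (moment_le leb2sf (@measurable_unit_square R)) => [||x _].
- by case: mf.
- exact: measurable_cmod.
- by rewrite [leRHS]ger0_norm ?cmod_ge0// Im_le_cmod.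
Qed.

Lemma proj_vanish p (f : (mR * mR)%type -> R[i]) : cmeasurable f -> cintegrable leb2 Q f ->
  (mom p.+1 f < +oo)%E -> vanish (fun n => mom p.+1 (fun x => proj n f x - f x)).
Proof.
move=> mf fi fp; have [m1 m2] := mf.
have a1 := approx_vpk2_Lp m1 (le_lt_trans (moment_Re p.+1 mf) fp).
have a2 := approx_vpk2_Lp m2 (le_lt_trans (moment_Im p.+1 mf) fp).
apply: vanish_le (vanishZ (exprn_ge0 p.+1 (ler0n R 2)) (vanishD a1 a2)) => n.
exact: moment_proj_sub.
Qed.

(** By contraction, uniformly in [n]; this is the domination used in [evolve_vanish]. *)
Lemma moment_proj_sub_le p n (f : (mR * mR)%type -> R[i]) : cmeasurable f -> cintegrable leb2 Q f ->
  (mom p.+1 (fun x => proj n f x - f x)%R <= (2 ^+ p.+1 * (2 ^+ p.+1 * 4))%:E * mom p.+1 f)%E.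
Proof.
move=> mf fi; have [m1 m2] := mf; have mQ := @measurable_unit_square R.
have kM := @doubly_markov_vpk2 R n.
apply: le_trans (moment_proj_sub p.+1 n mf fi) _.
have M0 : (0 <= mom p.+1 f)%E by exact: moment_ge0.
have D0 (g : (mR * mR)%type -> R) : measurable_fun setT g -> (moment leb2sf Q p.+1 g <= mom p.+1 f)%E ->
  (moment leb2sf Q p.+1 (fun x => mop leb2sf Q (vpk2 n) g x - g x)%R <= (2 ^+
    p.+1 * 2)%:E * mom p.+1 f)%E.
  move=> mg gf; have mm := measurable_mop mQ kM mg.
  have mNg : measurable_fun setT (fun x => - g x) by exact: measurableT_comp.
  apply: le_trans (momentD leb2sf mQ p.+1 mm mNg) _.
  rewrite EFinM -muleA; apply: lee_wpmul2l; first by rewrite lee_fin exprn_ge0.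
  rewrite (_ : 2%:E * mom p.+1 f = mom p.+1 f + mom p.+1 f)%E; last first.
    by rewrite (_ : 2 = 1 + 1)// EFinD ge0_muleDl// mul1e.
  have t1 := moment_mop mQ (lebesgue_unit_square_fin : (leb2sf Q < +oo)%E) kM p mg.
  apply: leeD; first exact: le_trans t1 gf.
  rewrite (_ : moment _ _ _ _ = moment leb2sf Q p.+1 g)//.
  by apply: eq_integral => x _; rewrite normrN.
rewrite EFinM -muleA; apply: lee_wpmul2l; first by rewrite lee_fin exprn_ge0.
rewrite (_ : (2 ^+ p.+1 * 4)%:E * _ = (2 ^+ p.+1 * 2)%:E * mom p.+1 f + (2 ^+
  p.+1 * 2)%:E * mom p.+1 f)%E.
  by apply: leeD; apply: D0 => //; [exact: moment_Re|exact: moment_Im].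
rewrite -ge0_muleDl ?lee_fin ?mulr_ge0 ?exprn_ge0//; congr (_ * _)%E.
by rewrite -EFinD; congr (_%:E); rewrite -mulrDr -natrD.
Qed.

(** For almost every [t] the slice [u t] is in L^3, so its averages, which are the slices of
    [evolve n phi], converge to it there. Their errors are dominated by a multiple of the moment of
    [u t], integrable in [t]. *)
Lemma evolve_vanish phi u : evolution phi u ->
  vanish (fun n => moment (m3 (R := R)) cylinder 3 (fun z => cmod (evolve n phi z.1 z.2 - u z.1 z.2))).
Proof.
move=> [Lphi su u3]; have [mu Lu _ _] := su.
pose g n t := mom 3 (fun x => evolve n phi t x - u t x).
pose G t := mom 3 (u t).
have mI := @measurable_unit_itv R; have mQ := @measurable_unit_square R.
have mev n : cmeasurable (fun z : mR * (mR * mR) => evolve n phi z.1 z.2).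
  by have [_ [+ _ _ _] _] := evolution_proj n phi.
have mdiff n : cmeasurable (fun z : mR * (mR * mR) => evolve n phi z.1 z.2 - u z.1 z.2).
  apply: cmeasurableD => //.
  by have := cmeasurableZ (-1) mu; under eq_fun do rewrite mulN1r.
have E n : moment (m3 (R := R)) cylinder 3 (fun z => cmod (evolve n phi z.1 z.2 - u z.1 z.2)) =
    (\int[leb1]_(t in I01) g n t)%E.
  have p0 z : (0 <= (`|cmod (evolve n phi z.1 z.2 - u z.1 z.2)| ^+ 3)%:E)%E by rewrite lee_fin exprn_ge0.
  exact: (tonelli_on1 leb1 leb2sf mI mQ (measurable_normX 3 (measurable_cmod (mdiff n))) p0).
have mg n : measurable_fun I01 (g n).
  apply: measurable_funTS.
  apply: (@measurable_integral_ge0 _ _ _ _ R leb2sf Q mQ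
    (fun z => (`|cmod (evolve n phi z.1 z.2 - u z.1 z.2)| ^+ 3)%:E)).
  - exact: (measurable_normX 3 (measurable_cmod (mdiff n))).
  - by move=> z; rewrite lee_fin exprn_ge0.
have G0 t : (0 <= G t)%E by exact: moment_ge0.
have mG : measurable_fun I01 G.
  apply: measurable_funTS.
  apply: (@measurable_integral_ge0 _ _ _ _ R leb2sf Q mQ (fun z => (`|cmod (u z.1 z.2)| ^+ 3)%:E)).
  - exact: (measurable_normX 3 (measurable_cmod mu)).
  - by move=> z; rewrite lee_fin exprn_ge0.
have Gi : leb1.-integrable I01 G.
  apply/integrableP; split=> //; apply: le_lt_trans u3; rewrite le_eqVlt; apply/orP; left; apply/eqP.
  apply: eq_integral => t _; rewrite gee0_abs//; apply: eq_integral => x _.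
  by rewrite ger0_norm ?cmod_ge0.
pose K : R := 2 ^+ 3 * (2 ^+ 3 * 4).
have mut t : cmeasurable (u t : (mR * mR)%type -> R[i]) by have [] := Lu t.
have gE n t : g n t = mom 3 (fun x => proj n (u t) x - u t x).
  by apply: eq_integral => x _; rewrite (proj_solution n t x Lphi su).
have gG n t : (g n t <= K%:E * G t)%E.
  by rewrite gE; exact: moment_proj_sub_le (mut t) (L2T_integrable (Lu t)).
have g0 n t : (0 <= g n t)%E by exact: moment_ge0.
have KG : leb1.-integrable I01 (fun t => K%:E * G t)%E by exact: integrableZl.
have ae0 : {ae leb1, forall t, I01 t -> g ^~ t @ \oo --> (cst 0%E : mR -> \bar R) t}.
  apply: filterS (integrable_ae mI Gi) => t Gt It; apply: vanish_cvg => //.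
  have : vanish (fun n => mom 3 (fun x => proj n (u t) x - u t x)).
    apply: proj_vanish (mut t) (L2T_integrable (Lu t)) _.
    by have := Gt It; rewrite ge0_fin_numE.
  by apply: vanish_le => n; rewrite gE.
have aeb : {ae leb1, forall t, forall n, I01 t -> (`|g n t| <= K%:E * G t)%E}.
  by apply: aeW => t n It; rewrite gee0_abs.
have [_ _ h] := dominated_convergence mI mg (@measurable_cst _ _ _ _ _ (0%E : \bar R)) ae0 KG aeb.
apply: (@vanish_le _ _ (fun n => \int[leb1]_(t in I01) g n t)%E) => [n|]; first by rewrite E.
by apply: cvg_vanish; move: h; rewrite integral0; apply.
Qed.

End projection_convergence.

(** * From averaged data to all of L^2 *)

Section strichartz.
Context {R : realType}.
Local Notation leb1 := (@lebesgue_measure R).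
Local Notation leb2 := (leb1 \x leb1)%E.
Local Notation mR := (measurableTypeR R).
Local Notation Q := (unit_square (R := R)).
Local Notation L3 := (L3fun (m3 (R := R)) cylinder).
Local Notation tri3 := (tri (m3 (R := R)) cylinder).
Local Notation joint u := (fun z : mR * (mR * mR) => u z.1 z.2).

Let mC : measurable (cylinder (R := R)). Proof. exact: measurable_cylinder. Qed.

Lemma evolution_L3 (phi : R * R -> R[i]) (u : R -> R * R -> R[i]) : evolution phi u -> L3 (joint u).
Proof. by move=> [_ [mu _ _ _]]; rewrite /L3_spacetime L3_moment. Qed.

Lemma spacetime_integral_tri s (u : 'I_3 -> R -> R * R -> R[i]) : (forall j, L3 (joint (u j))) ->
  spacetime_integral s u =
  tri3 (s ord0) (s (inord 1)) (s (inord 2)) (joint (u ord0)) (joint (u (inord 1))) (joint (u (inord 2))).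
Proof.
move=> Lu; have [i1 i2] := tri_integrable mC (s ord0) (s (inord 1)) (s (inord 2)) (Lu ord0)
  (Lu (inord 1)) (Lu (inord 2)).
have mP : cmeasurable (fun z : mR * (mR * mR) => star (s ord0) (u ord0 z.1 z.2) *
    star (s (inord 1)) (u (inord 1) z.1 z.2) * star (s (inord 2)) (u (inord 2) z.1 z.2)).
  have mu j : cmeasurable (fun z : mR * (mR * mR) => star (s j) (u j z.1 z.2)).
    by apply: cmeasurable_star; case: (Lu j).
  by apply: cmeasurableM; [apply: cmeasurableM|].
have [mP1 mP2] := mP.
have mI := @measurable_unit_itv R; have mQ := @measurable_unit_square R.
have [_ f1] := Rintegral_fubini mI mQ mP1 i1.
have [_ f2] := Rintegral_fubini mI mQ mP2 i2.
have e : (fun t => cintegral leb2 Q (fun x => \prod_(j < 3) star (s j) (u j t x))) =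
    (fun t => cintegral leb2 Q (fun x => star (s ord0) (u ord0 t x) *
      star (s (inord 1)) (u (inord 1) t x) * star (s (inord 2)) (u (inord 2) t x))).
  by apply/funext => t; apply: eq_cintegral => x _; rewrite prod3.
rewrite /spacetime_integral e; apply: complex_eq; [exact: esym f1|exact: esym f2].
Qed.

(** The bound for [evolve n (phi j)] involves the norms of [phi j] only, so it survives the limit in
    [n] taken inside the trilinear form. *)
Lemma evolution_bound : exists2 C : R, 0 < C & forall s (phi : 'I_3 -> R * R -> R[i]) u,
  (forall j, evolution (phi j) (u j)) ->
  cmod (spacetime_integral s u) <= C * \prod_(j < 3) L2norm (phi j).
Proof.
have [C C0 HC] := @evolve_trilinear R; exists C => // s phi u ev.
have Lphi j : L2T (phi j) by case: (ev j).
have Lu j := evolution_L3 (ev j).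
have Ln j n := evolution_L3 (evolution_proj n (phi j)).
apply/ler_addgt0Pr => e e0.
have [n _ /(_ n (leqnn n)) h] := tri_cvg mC (s ord0) (s (inord 1)) (s (inord 2))
  (Ln ord0) (Ln (inord 1)) (Ln (inord 2)) (Lu ord0) (Lu (inord 1)) (Lu (inord 2))
  (evolve_vanish (ev ord0)) (evolve_vanish (ev (inord 1))) (evolve_vanish (ev (inord 2))) e0.
have := HC s phi n Lphi; rewrite (spacetime_integral_tri s Lu).
rewrite (@spacetime_integral_tri s (fun j => evolve n (phi j))) => [H|j]; last exact: Ln.
move: h H; set a := tri3 _ _ _ _ _ _; set b := tri3 _ _ _ _ _ _ => h H.
have -> : b = a - (a - b) by ring.
by apply: le_trans (cmodD _ _) _; rewrite cmodN; exact: lerD.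
Qed.

Lemma L2norm_ge0 (f : R * R -> R[i]) : 0 <= L2norm f.
Proof. exact: sqrtr_ge0. Qed.

Lemma L2norm_sqr (f : R * R -> R[i]) : L2T f ->
  moment leb2 Q 2 (fun x => cmod (f x)) = (L2norm f ^+ 2)%:E.
Proof.
move=> Lf; have [_ _] := Lf; rewrite L2T_moment => f2.
have f0 := moment_ge0 leb2 Q 2 (fun x => cmod (f x)).
have fE : moment leb2 Q 2 (fun x => cmod (f x)) = (\int[leb2]_(x in Q) (cmod (f x) ^+ 2)%:E)%E.
  by rewrite -L2T_moment.
rewrite /L2norm sqr_sqrtr; last by apply: fine_ge0; rewrite -fE.
by rewrite /Rintegral -fE fineK// ge0_fin_numE.
Qed.

Lemma L2norm_comb (f g : R * R -> R[i]) c : cmod c = 1 -> L2T f -> L2T g ->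
  L2norm (fun x => f x + c * g x) <= 2 * (L2norm f + L2norm g).
Proof.
move=> c1 Lf Lg; have [_ mf _] := Lf; have [_ mg _] := Lg.
have := moment_comb leb2 2 c (@measurable_unit_square R) mf mg.
rewrite (L2norm_sqr (L2T_comb c Lf Lg)) (L2norm_sqr Lf) (L2norm_sqr Lg) c1 expr1n mul1e.
rewrite -EFinD -EFinM lee_fin => h.
have a0 := L2norm_ge0 f; have b0 := L2norm_ge0 g.
rewrite -(ler_pXn2r (n := 2)) ?nnegrE ?mulr_ge0 ?addr_ge0 ?L2norm_ge0//.
apply: le_trans h _; rewrite exprMn; apply: ler_wpM2l; first by rewrite exprn_ge0.
by rewrite sqrrD addrAC lerDl mulrn_wge0// mulr_ge0.
Qed.

Lemma L2norm_sub (f g : R * R -> R[i]) : L2T f -> L2T g ->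
  L2norm (fun x => f x - g x) <= 2 * (L2norm f + L2norm g).
Proof.
move=> Lf Lg; have c1 : cmod (-1 : R[i]) = 1 by rewrite cmodN cmod1.
have := L2norm_comb c1 Lf Lg.
by rewrite (_ : (fun x => _ + _) = fun x => f x - g x)//; apply/funext => x; rewrite mulN1r.
Qed.

Lemma L2T_sub (f g : R * R -> R[i]) : L2T f -> L2T g -> L2T (fun x => f x - g x).
Proof.
move=> Lf Lg; have := L2T_comb (-1) Lf Lg.
by rewrite (_ : (fun x => _ + _) = fun x => f x - g x)//; apply/funext => x; rewrite mulN1r.
Qed.

Lemma evolution_sub (phi phi' : R * R -> R[i]) u u' : evolution phi u -> evolution phi' u' ->
  evolution (fun x => phi x - phi' x) (fun t x => u t x - u' t x).
Proof.
move=> e1 e2; have := evolution_comb (-1) e1 e2.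
rewrite (_ : (fun x => _ + _) = fun x => phi x - phi' x); last by apply/funext => x; rewrite mulN1r.
rewrite (_ : (fun t x => _ + _) = fun t x => u t x - u' t x)//.
by apply/funext => t; apply/funext => x; rewrite mulN1r.
Qed.

(** The version with separate slots, so that after [tri_telescope] the functions and their
    conjugations can be permuted; [pick3] turns three objects back into a family over ['I_3]. *)
Lemma tri_evolution_bound : exists2 C : R, 0 < C & forall b0 b1 b2 (f g h : R * R -> R[i]) u v w,
  evolution f u -> evolution g v -> evolution h w ->
  cmod (tri3 b0 b1 b2 (joint u) (joint v) (joint w)) <= C * (L2norm f * L2norm g * L2norm h).
Proof.
have [C C0 HC] := evolution_bound; exists C => // b0 b1 b2 f g h u v w ef eg eh.
pose pick3 (A : Type) (a b c : A) (j : 'I_3) := if j == ord0 then a else if j == inord 1 then b else c.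
have i10 : (inord 1 : 'I_3) == ord0 = false by apply/negbTE; rewrite -val_eqE /= inordK.
have i20 : (inord 2 : 'I_3) == ord0 = false by apply/negbTE; rewrite -val_eqE /= inordK.
have i21 : (inord 2 : 'I_3) == inord 1 = false by apply/negbTE; rewrite -val_eqE /= !inordK.
have ev j : evolution (pick3 _ f g h j) (pick3 _ u v w j) 
  by rewrite /pick3; case: (j == ord0); [exact: ef|case: (j == inord 1); [exact: eg|exact: eh]].
have E0 A (a b c : A) : pick3 A a b c ord0 = a by [].
have E1 A (a b c : A) : pick3 A a b c (inord 1) = b by rewrite /pick3 i10 eqxx.
have E2 A (a b c : A) : pick3 A a b c (inord 2) = c by rewrite /pick3 i20 i21.
have := HC (pick3 _ b0 b1 b2) _ _ ev.
rewrite (spacetime_integral_tri _ (fun j => evolution_L3 (ev j))).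
by rewrite prod3 !E0 !E1 !E2.
Qed.

(** Differences of evolutions are evolutions, so the bound in L^2 norms applies to each telescoped
    term. One [h] serves all pairs of approximations, which yields both the Cauchy property and the
    independence of the limit. *)
Lemma evolution_continuity (s : 'I_3 -> bool) (phi : 'I_3 -> R * R -> R[i]) : (forall j, L2T (phi j)) ->
  forall e : R, 0 < e -> exists2 h : R, 0 < h & forall psi psi' u u',
  (forall j, evolution (psi j) (u j)) -> (forall j, evolution (psi' j) (u' j)) ->
  (forall j, L2norm (fun x => psi j x - phi j x) <= h) ->
  (forall j, L2norm (fun x => psi' j x - phi j x) <= h) ->
  cmod (spacetime_integral s u - spacetime_integral s u') <= e.
Proof.
move=> Lphi e e0; have [C C0 HC] := tri_evolution_bound.
pose N := \sum_(j < 3) L2norm (phi j).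
have Nj j : L2norm (phi j) <= N by rewrite /N (bigD1 j)//= lerDl sumr_ge0// => i _; exact: L2norm_ge0.
have N0 : 0 <= N by rewrite sumr_ge0// => i _; exact: L2norm_ge0.
pose K := 2 * (1 + N); have K0 : 0 < K by rewrite mulr_gt0// ltr_wpDr.
(* [K] bounds the norm of any datum within [h <= 1] of [phi j]. Two such data differ by at most
   [4 h], so three terms of size [4 C K^2 h] have to stay below [e]. *)
pose h := Num.min 1 (e / (12 * C * K ^+ 2)).
have CK : 0 < 12 * C * K ^+ 2 by apply: mulr_gt0; [exact: mulr_gt0|exact: exprn_gt0].
have h0 : 0 < h by rewrite lt_min ltr01 divr_gt0.
have h1 : h <= 1 by rewrite ge_min lexx.
have he : 12 * C * K ^+ 2 * h <= e by rewrite mulrC -ler_pdivlMr// ge_min lexx orbT.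
exists h => // psi psi' u u' ev ev' d d'.
have Lpsi j : L2T (psi j) by case: (ev j).
have Lpsi' j : L2T (psi' j) by case: (ev' j).
have bnd (f : 'I_3 -> R * R -> R[i]) j : L2T (f j) -> L2norm (fun x => f j x - phi j x) <= h ->
  L2norm (f j) <= K.
  move=> Lf fh; have c1 : cmod (1 : R[i]) = 1 := cmod1.
  have := L2norm_comb c1 (L2T_sub Lf (Lphi j)) (Lphi j).
  rewrite (_ : (fun x => _ + _) = f j); last by apply/funext => x; rewrite mul1r subrK.
  move=> H; apply: le_trans H _; rewrite /K ler_pM2l//; apply: lerD => //; exact: le_trans fh h1.
have dif j : L2norm (fun x => psi j x - psi' j x) <= 4 * h.
  have := L2norm_sub (L2T_sub (Lpsi j) (Lphi j)) (L2T_sub (Lpsi' j) (Lphi j)).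
  rewrite (_ : (fun x => _ - _ - _) = fun x => psi j x - psi' j x); last by apply/funext => x; ring.
  move=> H; apply: le_trans H _; have := d j; have := d' j; lra.
have b1 j : L2norm (psi j) <= K by exact: bnd.
have b2 j : L2norm (psi' j) <= K by exact: bnd.
have Lu j := evolution_L3 (ev j); have Lu' j := evolution_L3 (ev' j).
rewrite !spacetime_integral_tri// tri_telescope//.
have step b0 b1' b2' (f g k : R * R -> R[i]) v w z : evolution f v -> evolution g w -> evolution k z ->
    L2norm f <= 4 * h -> L2norm g <= K -> L2norm k <= K ->
    cmod (tri3 b0 b1' b2' (joint v) (joint w) (joint z)) <= 4 * (C * K ^+ 2 * h).
  move=> ef eg ek fh gK kK; apply: le_trans (HC _ _ _ _ _ _ _ _ _ ef eg ek) _.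
  have -> : 4 * (C * K ^+ 2 * h) = C * ((4 * h) * K * K) by ring.
  rewrite ler_pM2l//; apply: ler_pM; rewrite ?mulr_ge0 ?L2norm_ge0//.
  by apply: ler_pM; rewrite ?L2norm_ge0.
have es j := evolution_sub (ev j) (ev' j).
apply: le_trans he; rewrite (_ : 12 * C * K ^+ 2 * h = 4 * (C * K ^+ 2 * h) +
  (4 * (C * K ^+ 2 * h) + 4 * (C * K ^+ 2 * h))); last by ring.
apply: le_trans (cmodD _ _) _; apply: lerD; first exact: step (es _) (ev _) (ev _) (dif _) (b1 _) (b1 _).
apply: le_trans (cmodD _ _) _; apply: lerD; first exact:
  step (es _) (ev' _) (ev _) (dif _) (b2 _) (b1 _).
exact: step (es _) (ev' _) (ev' _) (dif _) (b2 _) (b2 _).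
Qed.

Lemma proj_L2norm_cvg (phi : R * R -> R[i]) : L2T phi ->
  (fun n => L2norm (fun x => proj n phi x - phi x)) @ \oo --> 0.
Proof.
move=> Lphi; have [_ mphi phi2] := Lphi.
have p2 : (moment leb2sf Q 2 (fun x => cmod (phi x)) < +oo)%E by have := phi2; rewrite L2T_moment.
have v := proj_vanish mphi (L2T_integrable Lphi) p2.
apply/cvgrPdist_le => e e0; near=> n.
rewrite sub0r normrN ger0_norm ?L2norm_ge0//.
have Ln : L2T (fun x => proj n phi x - phi x).
  by apply: L2T_sub => //; case: (evolution_proj n phi).
have h : (moment leb2 Q 2 (fun x => cmod (proj n phi x - phi x))%R <= (e ^+ 2)%:E)%E.
  by near: n; exact: v (exprn_gt0 2 e0).
move: h; rewrite L2norm_sqr// lee_fin => h.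
by rewrite -(ler_pXn2r (n := 2)) ?nnegrE ?L2norm_ge0// ltW.
Unshelve. all: by end_near. Qed.

Lemma complex_cauchy_cvg (z : nat -> R[i]) :
  (forall e : R, 0 < e -> exists N, forall n m, (N <= n)%N -> (N <= m)%N -> cmod (z n - z m) <= e) ->
  exists I : R[i], (fun n => cmod (z n - I)) @ \oo --> 0.
Proof.
move=> hz.
have key (a : nat -> R) : (forall n m, `|a n - a m| <= cmod (z n - z m)) -> exists l : R, a @ \oo --> l.
  move=> az; suff /cvg_ex : cvg (a @ \oo) by [].
  apply: cauchy_cvg; apply: cauchy_exP => e /= e0.
  have e2 : 0 < e / 2 by rewrite divr_gt0.
  have [N HN] := hz _ e2; exists (a N); exists N => // n /= Nn.
  rewrite /ball /=; apply: le_lt_trans (az _ _) _; apply: le_lt_trans (HN _ _ (leqnn N) Nn) _.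
  by rewrite ltr_pdivrMr// ltr_pMr// ltr1n.
have [a ha] : exists l : R, (fun n => complex.Re (z n)) @ \oo --> l.
  apply: key => n m; apply: le_trans (Re_le_cmod _); rewrite le_eqVlt; apply/orP; left; apply/eqP.
  by congr `|_|; case: (z n) => ? ?; case: (z m).
have [b hb] : exists l : R, (fun n => complex.Im (z n)) @ \oo --> l.
  apply: key => n m; apply: le_trans (Im_le_cmod _); rewrite le_eqVlt; apply/orP; left; apply/eqP.
  by congr `|_|; case: (z n) => ? ?; case: (z m).
exists (a +i* b); apply/cvgrPdist_le => e e0.
have e2 : 0 < e / 2 by rewrite divr_gt0.
move/cvgrPdist_le : ha => /(_ _ e2) ha; move/cvgrPdist_le : hb => /(_ _ e2) hb.
near=> n; rewrite sub0r normrN ger0_norm ?cmod_ge0//.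
apply: le_trans (cmod_le _) _; rewrite (splitr e).
have h1 : `|a - complex.Re (z n)| <= e / 2 by near: n.
have h2 : `|b - complex.Im (z n)| <= e / 2 by near: n.
by move: h1 h2; rewrite distrC [X in _ -> X <= _ -> _]distrC; case: (z n) => x y /= h1 h2; exact: lerD.
Unshelve. all: by end_near. Qed.

End strichartz.

Theorem mainTheorem3 (R : realType) :
  exists2 C : R, 0 < C &
    forall (s : 'I_3 -> bool) (phi : 'I_3 -> R * R -> R[i]),
      (forall j, L2T (phi j)) ->
      exists2 I : R[i], is_trilinear_integral s phi I
        & cmod I <= C * \prod_(j < 3) L2norm (phi j).
Proof.
have [C C0 HC] := @evolve_trilinear R; exists C => // s phi Lphi.
pose v n j := evolve n (phi j); pose S n := spacetime_integral s (v n).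
have evn n j : evolution (proj n (phi j)) (v n j) by exact: evolution_proj.
have cn j := proj_L2norm_cvg (Lphi j).
have small (psi : nat -> 'I_3 -> R * R -> R[i]) :
  (forall j, (fun n => L2norm (fun x => psi n j x - phi j x)) @ \oo --> 0) ->
    forall h : R, 0 < h -> \forall n \near \oo, forall j, L2norm (fun x => psi n j x - phi j x) <= h.
  move=> cpsi h h0; have N j : \forall n \near \oo, L2norm (fun x => psi n j x - phi j x) <= h.
    have /cvgrPdist_le/(_ h h0) := cpsi j; apply: filterS => n.
    by rewrite sub0r normrN ger0_norm ?L2norm_ge0.
  exact: (@filter_forall nat 'I_3 (fun j n => L2norm (fun x => psi n j x - phi j x) <= h) \oo _ N).
(* The candidate is the limit along the averaged data, where [evolution_continuity] makes the
   integrals a Cauchy sequence. *)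
have [I hI] : exists I : R[i], (fun n => cmod (S n - I)) @ \oo --> 0.
  apply: complex_cauchy_cvg => e e0; have [h h0 H] := evolution_continuity s Lphi e0.
  have [N _ HN] := small (fun n j => proj n (phi j)) cn h h0.
  by exists N => n m Nn Nm; apply: H (evn n) (evn m) _ _ => j; apply: HN.
exists I.
  split.
    exists (fun n j => proj n (phi j)), v; split=> // n j; exact: evn.
  (* An arbitrary approximation is compared with the averaged one: both are eventually [h]-close to
     [phi], so their integrals share the limit [I]. *)
  move=> psi u [ev cpsi]; apply/cvgrPdist_le => e e0.
  have e2 : 0 < e / 2 by rewrite divr_gt0.
  have [h h0 H] := evolution_continuity s Lphi e2.
  have s1 := small _ cpsi h h0; have s2 := small (fun n j => proj n (phi j)) cn h h0.
  have s3 : \forall n \near \oo, `|0 - cmod (S n - I)| <= e / 2 by move/cvgrPdist_le : hI; apply.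
  near=> n; rewrite sub0r normrN ger0_norm ?cmod_ge0//.
  have -> : spacetime_integral s (u n) - I = (spacetime_integral s (u n) - S n) + (S n - I) by ring.
  apply: le_trans (cmodD _ _) _; rewrite (splitr e); apply: lerD.
    by apply: (H _ _ _ _ (ev n) (evn n)); near: n.
  have : `|0 - cmod (S n - I)| <= e / 2 by near: n.
  by rewrite sub0r normrN ger0_norm ?cmod_ge0.
(* Every [S n] obeys the bound with the norms of [phi] itself, so the limit inherits it with the
   same constant. *)
apply/ler_addgt0Pr => e e0.
have /cvgrPdist_le/(_ e e0)[N _ /(_ N (leqnn N))] := hI.
rewrite sub0r normrN ger0_norm ?cmod_ge0// => h.
have -> : I = S N - (S N - I) by ring.
apply: le_trans (cmodD _ _) _; rewrite cmodN; apply: lerD => //; exact: HC.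
Unshelve. all: by end_near. Qed.
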